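(* Let $d>0$ be a real number and let $k_1,k_2$ be integers such that there exists a doubly regular tournament of order $k_2$ and $d\in(u_{k_1-1},\ell_{k_2}]$. Then asymptotically almost surely (as $n\to\infty$) the oriented chromatic number of the random oriented graph $\vec{\mathcal{G}}(n,p)$ with $p=\frac{d}{n}$ satisfies $$\chi_o(\vec{\mathcal{G}}(n,p=\tfrac{d}{n}))\in[k_1,\,2k_2+11].$$
   Context: An oriented graph is an orientation of a simple undirected graph (no loops, no directed 2-cycles). The oriented chromatic number $\chi_o(\vec{G})$ of an oriented graph $\vec{G}$ is the smallest $k$ for which there is a homomorphism (of oriented graphs) from $\vec G$ to some tournament of order $k$. $\vec{\mathcal{G}}(n,p)$: each of the $\binom n2$ possible edges on $n$ labelled vertices is present independently with probability $p$, and then each present edge is given one of its two orientations uniformly at random, independently. ''Asymptotically almost surely'' means with probability tending to $1$ as $n\to\infty$. A tournament $T$ of order $k$ is doubly regular if every vertex has out-degree $\frac{k-1}{2}$ and for every pair of distinct vertices $v,w$ there are exactly $\frac{k-3}{4}$ vertices $u$ with $v\to u$ and $w\to u$. For integers $k\ge 2$ set $u_k=\frac{2\log k}{\log k-\log(\frac{k-1}{2})}$, and for integers $k\ge 3$ set $\ell_k=\frac{2(k-1)^3}{k(k+1)(k-2)}\log(k-1)$, where $\log$ is the natural logarithm. The integers $k_1,k_2$ are such that $u_{k_1-1}$ and $\ell_{k_2}$ are defined. *)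

(* Defs.v *)
From HB Require Import structures.
From mathcomp Require Import all_boot all_order all_algebra.
From mathcomp Require Import all_classical all_reals all_analysis.
Set Implicit Arguments.
Unset Strict Implicit.
Unset Printing Implicit Defensive.
Import Order.TTheory GRing.Theory Num.Theory.
Import numFieldNormedType.Exports.
Local Open Scope ring_scope.

Definition oriented (V : finType) (E : {set V * V}) : bool :=
  [forall x, (x, x) \notin E] &&
  [forall x, forall y, ((x, y) \in E) ==> ((y, x) \notin E)].

Record ograph (V : finType) := OGraph {
  arcs : {set V * V};
  arcsP : oriented arcs }.

HB.instance Definition _ (V : finType) := [isSub for @arcs V].
HB.instance Definition _ (V : finType) := [Countable of ograph V by <:].
HB.instance Definition _ (V : finType) := [Finite of ograph V by <:].

Definition arc (V : finType) (G : ograph V) : rel V :=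
  fun x y => (x, y) \in arcs G.

Definition is_hom (V W : finType) (G : ograph V) (H : ograph W)
    (f : {ffun V -> W}) : bool :=
  [forall x, forall y, arc G x y ==> arc H (f x) (f y)].

Definition tournament (V : finType) (T : ograph V) : bool :=
  [forall x, forall y, (x != y) ==> (arc T x y || arc T y x)].

(* The degree conditions are stated in [rat] to avoid truncated division. *)
Definition doubly_regular (k : nat) (T : ograph 'I_k) : bool :=
  [&& tournament T,
      [forall v, #|[set u | arc T v u]|%:R == (k%:R - 1) / 2 :> rat] &
      [forall v, forall w, (v != w) ==>
        (#|[set u | arc T v u && arc T w u]|%:R == (k%:R - 3) / 4 :> rat)]].

Definition ocolorable (V : finType) (G : ograph V) (k : nat) : bool :=
  [exists T : ograph 'I_k, tournament T &&
    [exists f : {ffun V -> 'I_k}, is_hom G T f]].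

Lemma arc_irr (V : finType) (G : ograph V) x : arc G x x = false.
Proof. by case: G => E hE; apply/negbTE; case/andP: (hE) => /forallP/(_ x). Qed.

Lemma arc_asym (V : finType) (G : ograph V) x y : arc G x y -> ~~ arc G y x.
Proof.
case: G => E hE; case/andP: (hE) => _ /forallP/(_ x)/forallP/(_ y)/implyP.
exact.
Qed.

Lemma ex_ocolorable (V : finType) (G : ograph V) : exists k, ocolorable G k.
Proof.
pose t (x y : 'I_#|V|) :=
  let gx := enum_val x in let gy := enum_val y in
  arc G gx gy || (~~ arc G gy gx && (x < y)%N).
pose E := [set e : 'I_#|V| * 'I_#|V| | t e.1 e.2].
have hE : oriented E.
  apply/andP; split; apply/forallP => x.
    by rewrite inE /t /= arc_irr ltnn.
  apply/forallP => y; apply/implyP; rewrite !inE /t /=.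
  case/orP => [h|/andP[h xy]].
    by rewrite h (negbTE (arc_asym h)).
  by rewrite (negbTE h) /= negb_and -leqNgt (ltnW xy) orbT.
exists #|V|; apply/existsP; exists (OGraph hE); apply/andP; split.
  apply/forallP => x; apply/forallP => y; apply/implyP => xy.
  rewrite /arc /= !inE /t /=.
  case: (arc G (enum_val x) (enum_val y)) => //=.
  by case: (arc G (enum_val y) (enum_val x)) => //=; rewrite -neq_ltn.
apply/existsP; exists [ffun x => enum_rank x].
apply/forallP => x; apply/forallP => y; apply/implyP => xy.
by rewrite /arc !ffunE inE /t /= !enum_rankK xy.
Qed.

Definition chi_o (V : finType) (G : ograph V) : nat := ex_minn (ex_ocolorable G).

(* Law of the random oriented graph on ['I_n]: independently for each pair
   [i < j], there is no arc with probability [1 - p], and each of the arcs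
   [i -> j], [j -> i] is chosen with probability [p / 2].
   This is a probability only for [0 <= p <= 1]; with [p = d / n] that holds
   for all [n >= d], which is all that a limit in [n] sees. *)
Definition Gnp_weight (R : realType) (n : nat) (p : R) (G : ograph 'I_n) : R :=
  \prod_(e : 'I_n * 'I_n | (e.1 < e.2)%N)
    (if arc G e.1 e.2 || arc G e.2 e.1 then p * 2^-1 else 1 - p).

Definition Gnp_prob (R : realType) (n : nat) (p : R) (A : pred (ograph 'I_n)) : R :=
  \sum_(G : ograph 'I_n | A G) Gnp_weight p G.

(* Meaningful for [2 <= k]. *)
Definition u_ (R : realType) (k : nat) : R :=
  2 * ln (k%:R : R) / (ln (k%:R : R) - ln ((k%:R - 1) / 2 : R)).

(* Meaningful for [3 <= k]. *)
Definition ell_ (R : realType) (k : nat) : R :=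
  2 * (k%:R - 1) ^+ 3 / (k%:R * (k%:R + 1) * (k%:R - 2)) * ln (k%:R - 1 : R).

(* Main.v *)
Require Import Defs.
From mathcomp Require Import all_boot all_order all_algebra.
From mathcomp Require Import all_classical all_reals all_analysis.
From mathcomp Require Import ring lra zify.
Set Implicit Arguments.
Unset Strict Implicit.
Unset Printing Implicit Defensive.
Import Order.TTheory GRing.Theory Num.Theory.
Import numFieldNormedType.Exports.
Import Defs.
Local Open Scope ring_scope.

(** Write [k] for a number of colours, [q = (k - 1) / (2 * k)] for the probability
that an arc with uniformly coloured ends is respected by a tournament of order
[k], and [dn/2] for the typical number of arcs.

Lower bound. For a fixed map [f] to a tournament of order [k], the probability
that [f] is a homomorphism and that there are at least [m] arcs is at most
[q ^ m] up to a constant. There are [k ^ n] maps and boundedly many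
tournaments, and [d > u_k] says exactly that [k * q ^ (d / 2) < 1], so that the
union bound tends to 0 with [m] slightly below [dn/2] ([chi_o_lower]). The
number of arcs has to be controlled because the plain expected number of
homomorphisms is dominated by atypically sparse graphs.

Upper bound. Let [T] be the doubly regular tournament of order [k]. The graph
maps to [T] with probability at least [exp (- eps * n)] for every [eps > 0].
This weak bound implies that with high probability the graph maps to [T] after
the removal of [eta * n] vertices, and the removed part can be repaired with
new colours.

The first step ([defect_zero_prob]) is a second moment computation for the
number of homomorphisms to [T] with almost equal colour classes, each weighted
by [q ^ - (number of arcs)] and discarded if there are too many arcs. The weight
removes the effect of the fluctuation of the number of arcs. For two
colourings with normalised overlap matrix [a], the rate of the second moment is
governed by the quadratic form [sum a_ij a_i'j'] over [i -> i'], [j -> j'].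
Double regularity says that the skew adjacency matrix of [T] is [sqrt k] times
an isometry on the vectors of sum 0, which bounds the form by
[q ^ 2 + (k + 1) / 4 * (sum a_ij ^ 2 - 1 / k ^ 2)] ([drt_form_le]). On the
other hand the number of pairs of colourings with a given overlap decreases
exponentially with its relative entropy, and the entropy deficit of a vector of
[k] probabilities is at least
[(k - 1) ln (k - 1) / (k - 2)] times its excess squared norm
([entropy_deficit_ge]). These two constants balance exactly when [d = ell_k].

The second step ([defect_tail]) is concentration: the least number of vertices
whose removal leaves a graph that maps to [T], the defect, changes by at most 1
when the arcs at one vertex change, so the product of the probabilities that it
is 0 and that it is at least [eta * n] is exponentially small.

The third step ([chi_o_le_of_defect]) uses that small sets [S] of vertices span
fewer than [6/5 * #|S|] arcs ([dense_sets_prob]). Hence the removed set can be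
enlarged to a set [S], still small, such that every vertex outside has at most
one neighbour in [S], and the graph on [S] maps to the Paley tournament of
order 7. Two copies of [T] for the outside, one for the vertices with an arc to
[S] and one for the others, complete a colouring with [2 * k + 7] colours. *)

(** * Scalar inequalities *)

Local Open Scope classical_set_scope.
Local Open Scope ring_scope.

Lemma deriv_cst (R : realType) (c x : R) : is_derive x (1:R) (fun=> c) 0.
Proof. exact: is_derive_cst. Qed.

Lemma deriv_id (R : realType) (x : R) : is_derive x (1:R) (fun y : R => y) 1.
Proof. exact: is_derive_id. Qed.

Lemma deriv_add (R : realType) (f g : R -> R) (x df dg : R) :
  is_derive x (1:R) f df -> is_derive x (1:R) g dg ->
  is_derive x (1:R) (fun y => f y + g y) (df + dg).
Proof. by move=> hf hg; exact: is_deriveD. Qed.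

Lemma deriv_opp (R : realType) (f : R -> R) (x df : R) :
  is_derive x (1:R) f df -> is_derive x (1:R) (fun y => - f y) (- df).
Proof. by move=> hf; exact: is_deriveN. Qed.

Lemma deriv_mul (R : realType) (f g : R -> R) (x df dg : R) :
  is_derive x (1:R) f df -> is_derive x (1:R) g dg ->
  is_derive x (1:R) (fun y => f y * g y) (f x * dg + g x * df).
Proof. by move=> hf hg; exact: is_deriveM. Qed.

Lemma deriv_ln (R : realType) (f : R -> R) (x df : R) :
  0 < f x -> is_derive x (1:R) f df ->
  is_derive x (1:R) (fun y => ln (f y)) ((f x)^-1 * df).
Proof.
move=> fx hf; have hl := is_derive1_ln fx.
by have := is_derive1_comp hl hf.
Qed.

Ltac derive_rec :=
  first [ eapply deriv_cst | eapply deriv_id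
        | eapply deriv_add; [derive_rec | derive_rec]
        | eapply deriv_opp; derive_rec
        | eapply deriv_mul; [derive_rec | derive_rec]
        | eapply deriv_ln; [ | derive_rec] ].
Ltac derive_to := eapply is_derive_eq; [derive_rec | ].

Lemma ndecr_of_deriv (R : realType) (f df : R -> R) (a b : R) :
  a <= b ->
  (forall x, a <= x <= b -> is_derive x (1:R) f (df x)) ->
  (forall x, a <= x <= b -> 0 <= df x) -> f a <= f b.
Proof.
move=> ab fd df0.
have [||c cab e] := @MVT_segment R f df a b ab.
- by move=> x; rewrite in_itv /= => /andP[ax xb]; apply: fd; rewrite !ltW.
- apply: derivable_within_continuous => x; rewrite in_itv /= => xab.
  by have := fd x xab => h; exact: ex_derive.
- rewrite -subr_ge0 e mulr_ge0 ?subr_ge0// df0//.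
Qed.

Lemma concave_chord (R : realType) (f df : R -> R) (a b t : R) :
  a <= t <= b ->
  (forall x, a <= x <= b -> is_derive x (1:R) f (df x)) ->
  (forall x y, a <= x -> x <= y -> y <= b -> df y <= df x) ->
  (b - t) * f a + (t - a) * f b <= (b - a) * f t.
Proof.
move=> /andP[atx tb] fd dec.
have cont u v : a <= u -> v <= b -> {within `[u, v], continuous f}.
  move=> au vb; apply: derivable_within_continuous => x.
  rewrite in_itv /= => /andP[ux xv].
  have h : is_derive x (1:R) f (df x) by apply: fd; rewrite (le_trans au) ?(le_trans xv).
  exact: ex_derive.
have dd u v : a <= u -> v <= b -> forall x, x \in `]u, v[%R -> is_derive x (1:R) f (df x).
  move=> au vb x; rewrite in_itv /= => /andP[ux xv]; apply: fd.
  by rewrite (le_trans au (ltW ux)) (le_trans (ltW xv) vb).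
have [c1 + e1] := @MVT_segment R f df a t atx (dd _ _ (lexx a) tb) (cont _ _ (lexx a) tb).
have [c2 + e2] := @MVT_segment R f df t b tb (dd _ _ atx (lexx b)) (cont _ _ atx (lexx b)).
rewrite !in_itv /= => /andP[tc2 c2b] /andP[ac1 c1t].
have c12 := dec c1 c2 ac1 (le_trans c1t tc2) c2b.
have -> : f b = f t + df c2 * (b - t) by rewrite -e2; ring.
have -> : f a = f t - df c1 * (t - a) by rewrite -e1; ring.
have : 0 <= (b - t) * (t - a) * (df c1 - df c2).
  by rewrite !mulr_ge0 ?subr_ge0.
lra.
Qed.

Lemma ln_ge_1BV (R : realType) (x : R) : 0 < x -> 1 - x^-1 <= ln x.
Proof.
move=> x0; rewrite -[x in ln x]invrK lnV ?posrE ?invr_gt0// lerNr opprB.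
have := @le_ln1Dx R (x^-1 - 1).
rewrite addrCA subrr addr0; apply.
by rewrite ltrBrDr addNr invr_gt0.
Qed.

Lemma ln_le_Bx1 (R : realType) (x : R) : 0 < x -> ln x <= x - 1.
Proof.
move=> x0; have := @le_ln1Dx R (x - 1).
by rewrite addrCA subrr addr0; apply; lra.
Qed.

Lemma ln_ge_frac (R : realType) (x : R) : 1 <= x -> 2 * (x - 1) <= (x + 1) * ln x.
Proof.
move=> x1.
pose f (y : R) := (y + 1) * ln y - 2 * (y - 1).
rewrite -subr_ge0 -/(f x).
have -> : 0 = f 1 by rewrite /f ln1; ring.
apply: (@ndecr_of_deriv R f (fun y => ln y + y^-1 - 1) 1 x); [exact: x1|move=> y /andP[y1 _]|move=> y /andP[y1 _]].
  have y0 : 0 < y by lra.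
  rewrite /f; derive_to => //=; field; lra.
have y0 : 0 < y by lra.
by have := ln_ge_1BV y0; lra.
Qed.

Lemma ln_le_half (R : realType) (x : R) : 1 <= x -> 2 * x * ln x <= x ^+ 2 - 1.
Proof.
move=> x1.
pose f (y : R) := y * y - 1 - 2 * (y * ln y).
rewrite -subr_ge0.
have -> : x ^+ 2 - 1 - 2 * x * ln x = f x by rewrite /f; ring.
have -> : 0 = f 1 by rewrite /f ln1; ring.
apply: (@ndecr_of_deriv R f (fun y => 2 * y - 2 * ln y - 2) 1 x); [exact: x1|move=> y /andP[y1 _]|move=> y /andP[y1 _]].
  have y0 : 0 < y by lra.
  rewrite /f; derive_to => //=; field; lra.
have y0 : 0 < y by lra.
by have := ln_le_Bx1 y0; lra.
Qed.

Lemma xlnx_ge (R : realType) (x : R) : 0 < x <= 1 ->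
  (1 - x) ^+ 2 / 2 <= x * ln x - x + 1.
Proof.
move=> /andP[x0 x1].
pose f (y : R) := (1 - y) * (1 - y) / 2 - (y * ln y - y + 1).
rewrite -subr_le0 expr2 -/(f x).
have -> : 0 = f 1 by rewrite /f ln1; field.
apply: (@ndecr_of_deriv R f (fun y => y - 1 - ln y) x 1); [exact: x1|move=> y /andP[y1 _]|move=> y /andP[y1 _]].
  have y0 : 0 < y by lra.
  rewrite /f; derive_to => //=; field; lra.
have y0 : 0 < y by lra.
by have := ln_le_Bx1 y0; lra.
Qed.

(** The best constant in [entropy_deficit_ge] for [K] entries: equality holds there
    for one entry [1 - 1 / K] and the others equal. *)
Definition row_cst (R : realType) (K : R) : R := (K - 1) * ln (K - 1) / (K - 2).

Section RowEntropyReal.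
Variables (R : realType) (K : R).
Hypothesis K3 : 3 <= K.
Let L : R := ln (K - 1).
Let C : R := row_cst K.

Let K0 : 0 < K. Proof. by have := K3; lra. Qed.
Let K10 : 0 < K - 1. Proof. by have := K3; lra. Qed.
Let K20 : 0 < K - 2. Proof. by have := K3; lra. Qed.
Let L0 : 0 < L. Proof. by apply: ln_gt0; have := K3; lra. Qed.

Ltac hyps := move: (K3) (K0) (K10) (K20) (L0) => k3 k0 k10 k20 l0.

Lemma row_cst_gt0 : 0 < C.
Proof. by rewrite /C /row_cst divr_gt0// mulr_gt0. Qed.

Lemma row_cst_le : 2 * C <= K.
Proof.
hyps.
have -> : 2 * C = (2 * (K - 1) * L) / (K - 2) by rewrite /C /row_cst -/L; field; lra.
rewrite ler_pdivrMr//.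
have := @ln_le_half R (K - 1); rewrite -/L => /(_ ltac:(lra)).
rewrite expr2; lra.
Qed.

(** The derivative of [two_value_gap] below. *)
Definition logit_gap (t : R) : R :=
  ln t - ln (1 - t) + L - 2 * L / (K - 2) * (K * t - 1).

Let logit_gap_chord (a t : R) : 0 < a -> a <= t <= 1 / 2 ->
  (1 / 2 - t) * logit_gap a <= (1 / 2 - a) * logit_gap t.
Proof.
hyps.
move=> a0 /andP[atx th].
have h12 : logit_gap (1 / 2) = 0.
  rewrite /logit_gap (_ : 1 - 1 / 2 = 1 / 2); last by field.
  by field; lra.
have := @concave_chord R logit_gap
  (fun y => y^-1 + (1 - y)^-1 - 2 * L / (K - 2) * K) a (1 / 2) t.
rewrite h12 mulr0 addr0; apply.
- by rewrite atx.
- move=> y /andP[ay yh].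
  rewrite /logit_gap; derive_to => //=; [lra|lra|].
  by field; lra.
- move=> x y ax xy yh.
  have x0 : 0 < x by lra.
  have e (z : R) : 0 < z -> z <= 1/2 -> z^-1 + (1 - z)^-1 = (z * (1 - z))^-1.
    by move=> z0 zh; field; lra.
  rewrite lerD2r !e//; try lra.
  rewrite lef_pV2 ?posrE; nra.
Qed.

Let logit_gap_inv : logit_gap K^-1 = 0.
Proof.
hyps.
rewrite /logit_gap (_ : 1 - K^-1 = (K - 1) / K); last by field; lra.
rewrite ln_div ?posrE// lnV ?posrE// -/L; field; lra.
Qed.

Let invK : K^-1 <= 1/2 /\ 0 < K^-1 /\ K^-1 < 1/2.
Proof.
hyps.
have h : K^-1 < 1/2 by rewrite ltr_pdivlMr// mulrC ltr_pdivrMr//; lra.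
by split; [lra|split; [rewrite invr_gt0|]].
Qed.

(** [logit_gap] is concave on [(0, 1/2]] and vanishes at [1/K] and [1/2], which
    determines its sign on both sides of [1/K]. *)
Lemma logit_gap_ge0 (t : R) : K^-1 <= t <= 1 / 2 -> 0 <= logit_gap t.
Proof.
hyps.
move=> /andP[h1 h2]; have [i1 [i2 i3]] := invK.
have := @logit_gap_chord K^-1 t i2; rewrite h1 h2 => /(_ isT).
rewrite logit_gap_inv mulr0 pmulr_rge0//; lra.
Qed.

Lemma logit_gap_le0 (t : R) : 0 < t <= K^-1 -> logit_gap t <= 0.
Proof.
hyps.
move=> /andP[h1 h2]; have [i1 [i2 i3]] := invK.
have := @logit_gap_chord t K^-1 h1; rewrite h2 i1 => /(_ isT).
rewrite logit_gap_inv mulr0 pmulr_rle0//; lra.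
Qed.

(** The gap in [entropy_deficit_ge] for the vector with one entry [t] and [K - 1]
    entries [(1 - t) / (K - 1)]. *)
Definition two_value_gap (t : R) : R :=
  ln K + t * ln t + (1 - t) * ln (1 - t) - (1 - t) * L
  - C * (t * t + (1 - t) * (1 - t) / (K - 1) - K^-1).

Let two_value_gap_sym (t : R) : two_value_gap (1 - t) = two_value_gap t.
Proof.
hyps.
rewrite /two_value_gap (_ : 1 - (1 - t) = t); last by ring.
rewrite /C /row_cst -/L; field; lra.
Qed.

Let two_value_gap_deriv (t : R) : 0 < t <= 1/2 ->
  is_derive t (1:R) two_value_gap (logit_gap t).
Proof.
hyps.
move=> /andP[t0 th].
rewrite /two_value_gap /logit_gap; derive_to => //=; [lra|].
by rewrite /C /row_cst -/L; field; lra.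
Qed.

Let two_value_gap_inv : two_value_gap K^-1 = 0.
Proof.
hyps.
rewrite /two_value_gap /C /row_cst -/L (_ : 1 - K^-1 = (K - 1) / K); last by field; lra.
rewrite ln_div ?posrE// lnV ?posrE// -/L; field; lra.
Qed.

(** The value of [row_cst] makes the gap symmetric about [1/2]. Below [1/2] it
    decreases to its zero [1/K] and increases afterwards. *)
Lemma two_value_gap_ge0 (t : R) : 0 <= t <= 1 -> 0 <= two_value_gap t.
Proof.
hyps.
wlog th : t / t <= 1 / 2.
  move=> H /andP[t0 t1]; have [th|th] := leP t (1/2); first by apply: H => //; lra.
  by rewrite -two_value_gap_sym; apply: H; lra.
move=> /andP[t0 t1]; have [i1 [i2 i3]] := invK.
move: t0; rewrite le_eqVlt => /predU1P[<-|t0].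
  rewrite /two_value_gap subr0 ln1 mul0r /C /row_cst -/L.
  have h1 : K^-1 <= ln K - L.
    rewrite /L -ln_div ?posrE//.
    apply: le_trans (ln_ge_1BV _); last by rewrite divr_gt0.
    by rewrite invf_div le_eqVlt; apply/orP; left; apply/eqP; field; lra.
  have h2 : L <= K - 2 by have := ln_le_Bx1 K10; rewrite -/L; lra.
  have h3 : L / (K - 2) <= 1 by rewrite ler_pdivrMr// mul1r.
  have -> : ln K + 0 + 1 * 0 - 1 * L - (K - 1) * L / (K - 2) *
    (0 * 0 + 1 * 1 / (K - 1) - K^-1) = (ln K - L) - (L / (K - 2)) * K^-1.
    by field; lra.
  have := ler_wpM2r (ltW i2) h3; lra.
have [tK|tK] := leP K^-1 t.
  rewrite -two_value_gap_inv.
  apply: (@ndecr_of_deriv R two_value_gap logit_gap K^-1 t) => [//|x /andP[x1 x2]|x /andP[x1 x2]].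
    by apply: two_value_gap_deriv; lra.
  by apply: logit_gap_ge0; rewrite x1; lra.
rewrite -oppr_le0 -[X in _ <= X]oppr0 -two_value_gap_inv.
apply: (@ndecr_of_deriv R (fun x => - two_value_gap x) (fun x => - logit_gap x) t K^-1)
  => [|x /andP[x1 x2]|x /andP[x1 x2]]; first exact: ltW.
  by apply: deriv_opp; apply: two_value_gap_deriv; lra.
by rewrite oppr_ge0; apply: logit_gap_le0; rewrite x2 andbT; lra.
Qed.

(** The function [x * ln x - C * x ^ 2] at [r], minus its tangent line at [s]. *)
Definition tangent_gap (s r : R) : R :=
  r * (ln r - ln s) - (r - s) - C * ((r - s) * (r - s)).

(** Near [s] the convexity of [x * ln x] dominates, for
    [r >= s] in the sharp form [ln x >= 2 * (x - 1) / (x + 1)]. *)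
Let tangent_gap_small (s r : R) : 0 < s <= K^-1 -> 0 <= r ->
  C * (r + s) <= 1 \/ r <= s -> 0 <= tangent_gap s r.
Proof.
hyps.
move=> /andP[s0 sK] r0 h; rewrite /tangent_gap.
have C0 := row_cst_gt0; have CK := row_cst_le.
have Cs : 2 * C * s <= 1.
  apply: (@le_trans _ _ (K * K^-1)); last by rewrite divff// gt_eqF.
  by apply: ler_pM => //; lra.
move: r0; rewrite le_eqVlt => /predU1P[<-|r0].
  nra.
have [rs|sr] := leP r s.
  have x1 : 0 < r / s <= 1 by rewrite divr_gt0//= ler_pdivrMr// mul1r.
  have := xlnx_ge x1; rewrite ln_div ?posrE// => h2.
  have {}h2 := ler_wpM2l (ltW s0) h2.
  have e1 : s * (r / s * (ln r - ln s) - r / s + 1) = r * (ln r - ln s) - (r - s).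
    by field; lra.
  have e2 : s * ((1 - r / s) ^+ 2 / 2) = (r - s) * (r - s) * (2 * s)^-1 by field; lra.
  rewrite e1 e2 in h2.
  have h3 : C <= (2 * s)^-1 by rewrite -[_^-1]mul1r ler_pdivlMr; lra.
  have := ler_wpM2l (mulr_ge0 (_ : 0 <= s - r) (_ : 0 <= s - r)) h3.
  by rewrite subr_ge0 rs => /(_ isT isT); lra.
have {h} h : C * (r + s) <= 1 by case: h => //; lra.
have x1 : 1 <= r / s by rewrite ler_pdivlMr// mul1r ltW.
have := ln_ge_frac x1; rewrite ln_div ?posrE// => h2.
have {}h2 := ler_wpM2l (ltW s0) h2.
have e1 : s * (2 * (r / s - 1)) = 2 * (r - s) by field; lra.
have e2 : s * ((r / s + 1) * (ln r - ln s)) = (r + s) * (ln r - ln s) by field; lra.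
rewrite e1 e2 in h2.
have rs0 : 0 < r + s by lra.
rewrite -(pmulr_rge0 _ rs0).
have h3 : r * (2 * (r - s)) <= r * ((r + s) * (ln r - ln s)) by apply: ler_wpM2l => //; lra.
have h4 : 0 <= (1 - C * (r + s)) * ((r - s) * (r - s)).
  by apply: mulr_ge0; [lra|apply: mulr_ge0; lra].
lra.
Qed.

(** For [t >= 1/2] this is [K * L >= 2 * (K - 2)]. For [t <= 1/2], either
    [tangent_gap_small] applies to [t], or [L * (1 + (K - 2) * t) >= K - 2], and
    then the sign of [logit_gap] at [t] is enough: the two conditions are
    complementary. *)
Let tangent_gap_end (t b : R) : K^-1 <= t -> t < 1 -> b = Num.min t (1 - t) ->
  0 <= tangent_gap ((1 - t) / (K - 1)) b.
Proof.
hyps.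
move=> tK t1 ->.
have [i1 [i2 i3]] := invK.
have C0 := row_cst_gt0; have CK := row_cst_le.
have sK : 0 < (1 - t) / (K - 1) <= K^-1.
  rewrite divr_gt0//=; last lra.
  rewrite ler_pdivrMr//; have : K * K^-1 = 1 by rewrite divff// gt_eqF.
  lra.
have [th|th] := leP (1 / 2) t.
  rewrite min_r; last lra.
  rewrite /tangent_gap.
  rewrite ln_div ?posrE -/L//; last lra.
  have -> : (1 - t) * (ln (1 - t) - (ln (1 - t) - L)) - (1 - t - (1 - t) / (K - 1)) -
    C * ((1 - t - (1 - t) / (K - 1)) * (1 - t - (1 - t) / (K - 1))) =
    (1 - t) / (K - 1) * (L * (K - 1) - (K - 2) - (1 - t) * (L * (K - 2))).
    by rewrite /C /row_cst -/L; field; lra.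
  apply: mulr_ge0; first by case/andP: sK => /ltW.
  have := @ln_ge_frac R (K - 1); rewrite -/L => /(_ ltac:(lra)) h.
  have : (1 - t) * (L * (K - 2)) <= 1 / 2 * (L * (K - 2)).
    by apply: ler_wpM2r; [rewrite mulr_ge0; lra|lra].
  lra.
rewrite min_l; last lra.
have [h|h] := leP (C * (t + (1 - t) / (K - 1))) 1.
  by apply: tangent_gap_small => //; [lra|left].
have h1 : K - 2 <= L * (1 + (K - 2) * t).
  have e : C * (t + (1 - t) / (K - 1)) = L * (1 + (K - 2) * t) / (K - 2).
    by rewrite /C /row_cst -/L; field; lra.
  by move: h; rewrite e ltr_pdivlMr// mul1r => /ltW.
have := @logit_gap_ge0 t; rewrite tK (ltW th) => /(_ isT); rewrite /logit_gap => h2.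
rewrite /tangent_gap ln_div ?posrE -/L//; last lra.
have h3 : t * (2 * L / (K - 2) * (K * t - 1)) <= t * (ln t - (ln (1 - t) - L)).
  by apply: ler_wpM2l; lra.
have Kt : 0 <= K * t - 1.
  have : K * K^-1 <= K * t by apply: ler_wpM2l => //; lra.
  by rewrite divff ?gt_eqF//; lra.
have : 0 <= (K * t - 1) * (L * (1 + (K - 2) * t) - (K - 2)) / ((K - 1) * (K - 2)).
  by rewrite divr_ge0// mulr_ge0//; [lra|rewrite ltW|rewrite ltW].
have -> : (K * t - 1) * (L * (1 + (K - 2) * t) - (K - 2)) / ((K - 1) * (K - 2)) =
  t * (2 * L / (K - 2) * (K * t - 1)) - (t - (1 - t) / (K - 1)) -
  C * ((t - (1 - t) / (K - 1)) * (t - (1 - t) / (K - 1))).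
  by rewrite /C /row_cst -/L; field; lra.
lra.
Qed.

(** [x * ln x - C * x ^ 2] is convex only for [x <= 1 / (2 * C)], so its tangent at
    [s] need not stay below it. It does up to the largest value that an entry
    other than [t] can take: until [C * (r + s) = 1] by [tangent_gap_small], and
    from there on because the gap is concave in [r] and nonnegative at both
    ends. *)
Lemma tangent_gap_ge0 (t r : R) : K^-1 <= t -> t < 1 -> 0 <= r -> r <= t -> r <= 1 - t ->
  0 <= tangent_gap ((1 - t) / (K - 1)) r.
Proof.
hyps.
move=> tK t1 r0 rt rt1.
have [i1 [i2 i3]] := invK.
have C0 := row_cst_gt0; have CK := row_cst_le.
set s := (1 - t) / (K - 1).
have sK : 0 < s <= K^-1.
  rewrite divr_gt0//=; last lra.
  rewrite ler_pdivrMr//; have : K * K^-1 = 1 by rewrite divff// gt_eqF.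
  lra.
have [rs|rs] := leP r s; first by apply: tangent_gap_small => //; right.
have [h|h] := leP (C * (r + s)) 1; first by apply: tangent_gap_small => //; left.
have Cs : 2 * C * s <= 1.
  apply: (@le_trans _ _ (K * K^-1)); last by rewrite divff// gt_eqF.
  by case/andP: sK => s0 sK; apply: ler_pM => //; lra.
pose b := Num.min t (1 - t).
(* The largest [r] that [tangent_gap_small] reaches. *)
pose r1 : R := C^-1 - s.
have CC : C * C^-1 = 1 by rewrite divff// gt_eqF.
have r1r : r1 < r by rewrite /r1 ltrBlDr -[_^-1]mul1r ltr_pdivrMr// mulrC.
have r1C : (2 * C)^-1 <= r1.
  by rewrite /r1 invfM lerBrDr; rewrite -(ler_pM2l C0) mulrDr mulrCA CC; lra.
have r10 : 0 < r1 by apply: lt_le_trans r1C; rewrite invr_gt0; lra.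
have rb : r <= b by rewrite /b le_min rt.
have gb : 0 <= tangent_gap s b by apply: tangent_gap_end.
have gr1 : 0 <= tangent_gap s r1.
  apply: tangent_gap_small => //; first exact: ltW.
  by left; rewrite /r1 subrK CC.
have := @concave_chord R (tangent_gap s)
  (fun y => ln y - ln s - 2 * C * (y - s)) r1 b r.
rewrite (ltW r1r) rb => /(_ isT) chord.
have : (b - r) * tangent_gap s r1 + (r - r1) * tangent_gap s b <= (b - r1) * tangent_gap s r.
  apply: chord.
    move=> y /andP[y1 y2]; rewrite /tangent_gap; derive_to => //=; first lra.
    by field; lra.
  move=> x y x1 xy yb.
  have x0 : 0 < x by lra.
  have y0 : 0 < y by lra.
  have : ln (y / x) <= y / x - 1 by apply: ln_le_Bx1; rewrite divr_gt0.
  rewrite ln_div ?posrE// => h1.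
  have e : y / x - 1 = (y - x) / x by field; lra.
  have h2 : (y - x) / x <= (y - x) * (2 * C).
    apply: ler_wpM2l; first lra.
    rewrite -[2 * C]invrK lef_pV2 ?posrE//; [lra|rewrite invr_gt0; lra].
  lra.
move=> {}chord; have : 0 <= (b - r1) * tangent_gap s r.
  by apply: le_trans chord; rewrite addr_ge0// mulr_ge0//; lra.
by rewrite pmulr_rge0//; lra.
Qed.
End RowEntropyReal.

Local Close Scope classical_set_scope.

(** * Entropy against squared norm *)

(** Averaging all entries but the largest one, [t], can only shrink the gap, by
    [tangent_gap_ge0] summed over these entries. The averaged vector has two
    values, the case of [two_value_gap_ge0]. *)
Lemma entropy_deficit_ge (R : realType) (k : nat) (r : 'I_k -> R) :
  (3 <= k)%N -> (forall j, 0 <= r j) -> \sum_j r j = 1 ->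
  row_cst k%:R * (\sum_j r j ^+ 2 - k%:R^-1) <= \sum_j r j * ln (k%:R * r j).
Proof.
move=> k3 r0 r1.
have K3 : 3 <= k%:R :> R by rewrite ler_nat.
set K : R := k%:R in K3 *.
have C0 := row_cst_gt0 K3.
set C := row_cst K in C0 *.
have Lpos : (0 < k)%N by case: (k) k3.
have [j0 _ jmax] : exists2 j0 : 'I_k, true & forall j, r j <= r j0.
  exists [arg max_(j > Ordinal Lpos) r j]%O => //.
  by case: arg_maxP => // i _ h j; exact: h.
set t := r j0.
have cK : (#|'I_k|%:R = K) by rewrite card_ord.
have tK : K^-1 <= t.
  have : \sum_j r j <= \sum_(j < k) t by apply: ler_sum => j _; exact: jmax.
  rewrite r1 sumr_const card_ord -mulr_natl -/K => h.
  by rewrite -[_^-1]mul1r ler_pdivrMr; [rewrite mulrC|lra].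
have rest : \sum_(j | j != j0) r j = 1 - t by have := r1; rewrite (bigD1 j0)//= -/t => <-; rewrite addrAC subrr add0r.
have t1 : t <= 1.
  have : 0 <= \sum_(j | j != j0) r j by apply: sumr_ge0.
  by rewrite rest subr_ge0.
have rle j : j != j0 -> r j <= 1 - t.
  move=> jj; rewrite -rest (bigD1 j)//= lerDl; exact: sumr_ge0.
have -> : \sum_j r j * ln (K * r j) = ln K + \sum_j r j * ln (r j).
  rewrite -[ln K]mul1r -r1 mulr_suml -big_split/=; apply: eq_bigr => j _.
  have := r0 j; rewrite le_eqVlt => /predU1P[<-|rj]; first by rewrite !mul0r addr0.
  by rewrite lnM ?posrE//; [ring|lra].
have key : (1 - t) * (ln (1 - t) - ln (K - 1)) - C * ((1 - t) * (1 - t) / (K - 1)) <=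
    \sum_(j | j != j0) r j * ln (r j) - C * \sum_(j | j != j0) r j ^+ 2.
  move: t1; rewrite le_eqVlt => /predU1P[t1|t1].
    rewrite t1 subrr !(mul0r, mulr0) subr0.
    have z j : j != j0 -> r j = 0.
      by move=> jj; apply/eqP; rewrite eq_le r0 andbT -(subrr (1:R)) -{2}t1 rle.
    rewrite big1 ?big1 ?mulr0 ?subr0// => j /z ->; by rewrite ?mul0r ?expr0n.
  set s := (1 - t) / (K - 1).
  have s0 : 0 < s by rewrite divr_gt0; lra.
  have -> : (1 - t) * (ln (1 - t) - ln (K - 1)) - C * ((1 - t) * (1 - t) / (K - 1)) =
     \sum_(j | j != j0) (r j * ln s + (r j - s) + C * (s * s - 2 * s * r j)).
    have cs (x : R) : \sum_(i < k | i != j0) x = (K - 1) * x.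
      have := sumr_const 'I_k x; rewrite (bigD1 j0)//= card_ord -mulr_natl -/K => h.
      by rewrite mulrBl -h mul1r addrAC subrr add0r.
    transitivity (\sum_(j | j != j0) ((ln s + 1 - C * 2 * s) * r j + (C * (s * s) - s))).
      rewrite big_split/= -mulr_sumr rest cs /s ln_div ?posrE; try lra.
      by field; lra.
    by apply: eq_bigr => j _; ring.
  rewrite mulr_sumr -sumrB; apply: ler_sum => j jj.
  have := tangent_gap_ge0 K3 tK t1 (r0 j) (jmax j) (rle _ jj).
  rewrite /tangent_gap -/s -/C expr2; lra.
have := @two_value_gap_ge0 R K K3 t.
rewrite (le_trans _ tK) ?invr_ge0 ?t1; [|lra] => /(_ isT).
rewrite /two_value_gap -/C.
have split_j0 (f : 'I_k -> R) : \sum_j f j = f j0 + \sum_(j | j != j0) f j.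
  by rewrite (bigD1 j0).
rewrite !split_j0 -/t expr2.
lra.
Qed.

(** * The bilinear form of a doubly regular tournament *)

Lemma sum_sqr_dev (R : realType) (k : nat) (b : 'I_k -> R) : (0 < k)%N ->
  \sum_j (b j - (\sum_i b i) / k%:R) ^+ 2 = \sum_j b j ^+ 2 - (\sum_j b j) ^+ 2 / k%:R.
Proof.
move=> k0; have K0 : 0 < k%:R :> R by rewrite ltr0n.
set a := \sum_j b j.
transitivity (\sum_j (b j ^+ 2 + (- (2 * a / k%:R) * b j + (a / k%:R) ^+ 2))).
  by apply: eq_bigr => j _; ring.
rewrite big_split big_split /= -mulr_sumr -/a sumr_const card_ord -mulr_natl.
by field; lra.
Qed.

Lemma sqr_sum_le (R : realType) (k : nat) (b : 'I_k -> R) : (0 < k)%N ->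
  (\sum_j b j) ^+ 2 / k%:R <= \sum_j b j ^+ 2.
Proof.
move=> k0; rewrite -subr_ge0 -sum_sqr_dev//.
by apply: sumr_ge0 => j _; exact: sqr_ge0.
Qed.

Section Spectral.
Variables (R : realType) (k : nat).
Implicit Types (A B : 'M[R]_k) (v : 'cV[R]_k).

Definition adj_mx (T : ograph 'I_k) : 'M[R]_k := \matrix_(i, j) (arc T i j)%:R.

Let u : 'cV[R]_k := const_mx 1.
Let J : 'M[R]_k := const_mx 1.

Let JE : J = u *m u^T.
Proof. by apply/matrixP => i j; rewrite !mxE big_ord1 !mxE mulr1. Qed.

Let ratr_nat_eq (n : nat) (x : rat) : n%:R = x -> n%:R = ratr x :> R.
Proof. by move=> <-; rewrite ratr_nat. Qed.

Lemma out_degree (T : ograph 'I_k) (v : 'I_k) : doubly_regular T ->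
  \sum_j (arc T v j)%:R = (k%:R - 1) / 2 :> R.
Proof.
case/and3P => _ /forallP/(_ v)/eqP h _.
have := ratr_nat_eq h; rewrite rmorphM rmorphB /= fmorphV !rmorph_nat rmorph1 => <-.
rewrite -sum1_card natr_sum [RHS]big_mkcond /=.
by apply: eq_bigr => j _; rewrite inE; case: ifP.
Qed.

Lemma common_out (T : ograph 'I_k) (v w : 'I_k) : doubly_regular T -> v != w ->
  \sum_j (arc T v j)%:R * (arc T w j)%:R = (k%:R - 3) / 4 :> R.
Proof.
case/and3P => _ _ /forallP/(_ v)/forallP/(_ w)/implyP h vw.
have /eqP {}h := h vw.
have := ratr_nat_eq h; rewrite rmorphM rmorphB /= fmorphV !rmorph_nat => <-.
rewrite -sum1_card natr_sum [RHS]big_mkcond /=.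
apply: eq_bigr => j _; rewrite inE -natrM.
by case: (arc T v j) (arc T w j) => [] [].
Qed.

Lemma adj_mx_tr (T : ograph 'I_k) : tournament T ->
  (adj_mx T)^T = J - 1%:M - adj_mx T.
Proof.
move=> tT; apply/matrixP => i j; rewrite !mxE.
have [->|ij] := eqVneq i j; first by rewrite arc_irr ?eqxx /=; ring.
have /orP[h|h] := implyP (forallP (forallP tT i) j) ij.
  by rewrite h (negbTE (arc_asym h)) ?(negbTE ij) /=; ring.
by rewrite h (negbTE (arc_asym h)) ?(negbTE ij) /=; ring.
Qed.

Lemma adj_mx_u (T : ograph 'I_k) : doubly_regular T ->
  adj_mx T *m u = ((k%:R - 1) / 2) *: u.
Proof.
move=> dT; apply/matrixP => i j; rewrite !mxE mulr1 -(out_degree i dT).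
by apply: eq_bigr => l _; rewrite !mxE mulr1.
Qed.

Lemma adj_mx_gram (T : ograph 'I_k) : doubly_regular T ->
  adj_mx T *m (adj_mx T)^T = ((k%:R + 1) / 4)%:M + ((k%:R - 3) / 4) *: J.
Proof.
move=> dT; apply/matrixP => i j; rewrite !mxE mulr1.
have [<-|ij] := eqVneq i j; rewrite ?mulr1n ?mulr0n.
  transitivity (\sum_l (arc T i l)%:R : R).
    by apply: eq_bigr => l _; rewrite !mxE -natrM mulnb andbb.
  by rewrite out_degree//; field.
rewrite add0r -(common_out dT ij).
by apply: eq_bigr => l _; rewrite !mxE.
Qed.

(** The skew adjacency matrix, with entries 0, 1 and -1. *)
Definition skew_mx (T : ograph 'I_k) : 'M[R]_k := 2 *: adj_mx T - J + 1%:M.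

Let trJ : J^T = J. Proof. by apply/matrixP => i j; rewrite !mxE. Qed.
Let uu : u^T *m u = k%:R%:M.
Proof.
apply/matrixP => i j; rewrite !mxE !ord1 eqxx mulr1n.
rewrite (eq_bigr (fun=> 1)) ?sumr_const ?card_ord// => l _.
by rewrite !mxE mulr1.
Qed.

Lemma skew_mx_tr (T : ograph 'I_k) : tournament T -> (skew_mx T)^T = - skew_mx T.
Proof.
move=> tT; rewrite /skew_mx !linearD /= !linearN /= !linearZ /= adj_mx_tr// trJ tr_scalar_mx.
by apply/matrixP => i j; rewrite !mxE; ring.
Qed.

Lemma skew_mx_u (T : ograph 'I_k) : doubly_regular T -> skew_mx T *m u = 0.
Proof.
move=> dT; rewrite /skew_mx !mulmxDl mulNmx -scalemxAl adj_mx_u// JE -mulmxA uu mul1mx.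
by apply/matrixP => i j; rewrite mul_mx_scalar !mxE; field.
Qed.

(** This and [skew_mx_u] say that the skew adjacency matrix is [sqrt k] times an
    isometry on the vectors whose coordinates sum to 0. *)
Lemma skew_mx_gram (T : ograph 'I_k) : doubly_regular T ->
  skew_mx T *m (skew_mx T)^T = k%:R%:M - J.
Proof.
move=> dT; have tT : tournament T by case/and3P: dT.
have TJ : adj_mx T *m J = ((k%:R - 1) / 2) *: J.
  by rewrite JE mulmxA adj_mx_u// -scalemxAl.
have JT : J *m (adj_mx T)^T = ((k%:R - 1) / 2) *: J.
  by rewrite -[J in LHS]trJ -trmx_mul TJ linearZ /= trJ.
have JJ : J *m J = k%:R *: J.
  by rewrite {1 2}JE mulmxA -(mulmxA _ _ u) uu mul_mx_scalar -scalemxAl -JE.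
have -> : (skew_mx T)^T = 2 *: (adj_mx T)^T - J + 1%:M.
  by rewrite /skew_mx !linearD /= !linearN /= !linearZ /= trJ tr_scalar_mx.
rewrite /skew_mx !mulmxDl !mulmxDr !mulmx1 !mul1mx !(mulNmx,mulmxN) opprK
  -!(scalemxAl,scalemxAr) TJ JT JJ adj_mx_gram// adj_mx_tr//.
by apply/matrixP => i j; rewrite !mxE; field.
Qed.

Definition mxdot (A B : 'M[R]_k) : R := \tr (A^T *m B).

Lemma mxdotE A B : mxdot A B = \sum_i \sum_j A i j * B i j.
Proof.
rewrite /mxdot /mxtrace exchange_big /=; apply: eq_bigr => j _.
by rewrite mxE; apply: eq_bigr => i _; rewrite mxE.
Qed.

Lemma mxdot_amgm A B : 2 * mxdot A B <= mxdot A A + mxdot B B.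
Proof.
rewrite !mxdotE mulr_sumr -big_split /=; apply: ler_sum => i _.
rewrite mulr_sumr -big_split /=; apply: ler_sum => j _.
rewrite -subr_ge0; have := sqr_ge0 (A i j - B i j); rewrite expr2; lra.
Qed.

Let tr_skew (A : 'M[R]_k) : A^T = - A -> \tr A = 0.
Proof.
move=> h; have := mxtrace_tr A; rewrite h linearN /=.
by move=> e; lra.
Qed.

Let tr_sym_skew (P S : 'M[R]_k) : P^T = P -> S^T = - S -> \tr (P *m S) = 0.
Proof.
move=> hP hS; have := mxtrace_tr (P *m S).
by rewrite trmx_mul hP hS mulNmx linearN /= mxtrace_mulC => e; lra.
Qed.

Let colJ (c : 'M[R]_k) : \tr (c^T *m J *m c) = \sum_j (\sum_i c i j) ^+ 2.
Proof.
rewrite -mulmxA -/(mxdot c (J *m c)) mxdotE exchange_big /=.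
apply: eq_bigr => j _; rewrite expr2 mulr_suml; apply: eq_bigr => i _.
by rewrite !mxE; congr (_ * _); apply: eq_bigr => l _; rewrite !mxE mul1r.
Qed.

Let rowJ (c : 'M[R]_k) : \tr (c^T *m c *m J) = \sum_i (\sum_j c i j) ^+ 2.
Proof.
rewrite -mulmxA -/(mxdot c (c *m J)) mxdotE.
apply: eq_bigr => i _; rewrite expr2 mulr_suml; apply: eq_bigr => j _.
by rewrite !mxE; congr (_ * _); apply: eq_bigr => l _; rewrite !mxE mulr1.
Qed.

Let allJ (c : 'M[R]_k) : \tr (c^T *m J *m c *m J) = (\sum_i \sum_j c i j) ^+ 2.
Proof.
rewrite -!mulmxA -/(mxdot c (J *m (c *m J))) mxdotE expr2 mulr_suml.
apply: eq_bigr => i _; rewrite mulr_suml; apply: eq_bigr => j _.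
congr (_ * _); rewrite mxE; apply: eq_bigr => l _; rewrite !mxE mul1r.
by apply: eq_bigr => m _; rewrite !mxE mulr1.
Qed.

(** Since [S] kills constants, [c] may be replaced by [D], the matrix minus its
    row means; the form is then the inner product of [S D] and [D S], whose
    norms are at most [sqrt k] times that of [D]. *)
Lemma skew_form_le (T : ograph 'I_k) (c : 'M[R]_k) : (0 < k)%N -> doubly_regular T ->
  - \tr (c^T *m skew_mx T *m c *m skew_mx T) <=
  k%:R * (mxdot c c - \sum_i (\sum_j c i j) ^+ 2 / k%:R).
Proof.
move=> k0 dT; have tT : tournament T by case/and3P: dT.
have K0 : 0 < k%:R :> R by rewrite ltr0n.
have trS := skew_mx_tr tT; have gram := skew_mx_gram dT.
have Su := skew_mx_u dT.
move: (skew_mx T) trS gram Su => S trS gram Su.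
have JS : J *m S = 0.
  have : (S *m u)^T = 0 by rewrite Su trmx0.
  by rewrite trmx_mul trS mulmxN => /eqP; rewrite oppr_eq0 => /eqP e; rewrite JE -mulmxA e mulmx0.
(* [c] minus its row means. *)
pose D : 'M[R]_k := c - k%:R^-1 *: (c *m J).
have DE i j : D i j = c i j - k%:R^-1 * (c *m J) i j by rewrite !mxE.
have DS : c *m S = D *m S.
  by rewrite /D mulmxBl -scalemxAl -mulmxA JS mulmx0 scaler0 subr0.
have SD : S *m c^T = S *m D^T.
  apply: oppr_inj; rewrite -!mulNmx -trS -!trmx_mul; congr (_^T); exact: DS.
have -> : \tr (c^T *m S *m c *m S) = - mxdot (S *m D) (D *m S).
  rewrite /mxdot trmx_mul trS mulmxN mulNmx linearN /= opprK.
  transitivity (\tr (S *m D *m (S *m c^T))).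
    by rewrite -!mulmxA DS mxtrace_mulC !mulmxA.
  by rewrite SD mulmxA mxtrace_mulC !mulmxA.
rewrite opprK.
clearbody D.
have DD : mxdot D D = mxdot c c - \sum_i (\sum_j c i j) ^+ 2 / k%:R.
  rewrite !mxdotE -sumrB; apply: eq_bigr => i _.
  have cJ l : (c *m J) i l = \sum_j c i j.
    by rewrite mxE; apply: eq_bigr => m _; rewrite mxE mulr1.
  set g := \sum_j c i j in cJ *.
  transitivity (\sum_j (c i j - g / k%:R) ^+ 2).
    by apply: eq_bigr => j _; rewrite DE cJ; ring.
  by rewrite sum_sqr_dev//; congr (_ - _); apply: eq_bigr => j _; rewrite expr2.
rewrite -DD.
have h1 : mxdot (S *m D) (S *m D) <= k%:R * mxdot D D.
  rewrite /mxdot trmx_mul mulmxA -(mulmxA D^T).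
  have -> : S^T *m S = k%:R%:M - J by rewrite -gram trS mulNmx mulmxN.
  rewrite mulmxBr mulmxBl linearB /= colJ mul_mx_scalar -scalemxAl linearZ /=.
  by rewrite gerBl sumr_ge0// => j _; exact: sqr_ge0.
have h2 : mxdot (D *m S) (D *m S) <= k%:R * mxdot D D.
  rewrite /mxdot trmx_mul mxtrace_mulC mulmxA -(mulmxA D) gram.
  rewrite [X in X <= _]mxtrace_mulC mulmxA mulmxBr linearB /= rowJ mul_mx_scalar linearZ /=.
  by rewrite gerBl sumr_ge0// => j _; exact: sqr_ge0.
have := mxdot_amgm (S *m D) (D *m S); lra.
Qed.

(** With [A = (J - I + S) / 2], expanding gives the squared total, minus the
    squared column sums, minus the squared row sums, plus the squared norm,
    minus the form of [skew_form_le]; the terms that pair a symmetric matrix with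
    a skew one vanish. By Cauchy-Schwarz, row and column sums are at least as
    large, in sum of squares, as if they were constant. *)
Lemma drt_form_le (T : ograph 'I_k) (c : 'M[R]_k) : (0 < k)%N -> doubly_regular T ->
  mxdot c (adj_mx T *m c *m (adj_mx T)^T) <=
  (k%:R - 1) ^+ 2 / (4 * k%:R ^+ 2) * (\sum_i \sum_j c i j) ^+ 2 +
  (k%:R + 1) / 4 * (mxdot c c - \sum_i (\sum_j c i j) ^+ 2 / k%:R).
Proof.
move=> k0 dT; have tT : tournament T by case/and3P: dT.
have K0 : 0 < k%:R :> R by rewrite ltr0n.
have trS := skew_mx_tr tT; have form := skew_form_le c k0 dT.
have eA : adj_mx T = 2^-1 *: (J - 1%:M + skew_mx T).
  by apply/matrixP => i j; rewrite /skew_mx !mxE; field.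
have eAt : (adj_mx T)^T = 2^-1 *: (J - 1%:M - skew_mx T).
  by rewrite adj_mx_tr//; apply/matrixP => i j; rewrite /skew_mx !mxE; field.
move: (skew_mx T) trS form eA eAt => S trS form -> ->.
set a := \sum_i \sum_j c i j.
have symcc : (c^T *m c)^T = c^T *m c by rewrite trmx_mul trmxK.
have symcJc : (c^T *m J *m c)^T = c^T *m J *m c.
  by rewrite !trmx_mul trmxK trJ mulmxA.
have skcSc : (c^T *m S *m c)^T = - (c^T *m S *m c).
  by rewrite !trmx_mul trmxK trS mulNmx mulmxN mulmxA.
have -> : mxdot c (2^-1 *: (J - 1%:M + S) *m c *m (2^-1 *: (J - 1%:M - S))) =
  4^-1 * (a ^+ 2 - \sum_j (\sum_i c i j) ^+ 2 - \sum_i (\sum_j c i j) ^+ 2 + mxdot c c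
   - \tr (c^T *m S *m c *m S)).
  have dotD A B : mxdot c (A + B) = mxdot c A + mxdot c B.
    by rewrite /mxdot mulmxDr linearD.
  have dotN A : mxdot c (- A) = - mxdot c A by rewrite /mxdot mulmxN linearN.
  have left : (J - 1%:M + S) *m c = J *m c - c + S *m c.
    by rewrite mulmxDl mulmxBl mul1mx.
  have right A : A *m (J - 1%:M - S) = A *m J - A - A *m S.
    by rewrite mulmxBr mulmxBr mulmx1.
  have split3 A : (J *m c - c + S *m c) *m A = J *m c *m A - c *m A + S *m c *m A.
    by rewrite mulmxDl mulmxBl.
  rewrite -!scalemxAl -scalemxAr scalerA left right !split3 !opprD !opprK.
  have -> A : mxdot c ((2^-1 * 2^-1) *: A) = 4^-1 * mxdot c A.
    by rewrite /mxdot -scalemxAr linearZ /=; congr (_ * _); field.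
  congr (_ * _); rewrite !(dotD, dotN) /mxdot !mulmxA.
  rewrite allJ colJ rowJ -/a.
  rewrite (tr_sym_skew symcJc trS) (tr_sym_skew symcc trS) (tr_skew skcSc).
  rewrite [\tr (c^T *m S *m c *m J)]mxtrace_mulC (tr_sym_skew trJ skcSc).
  ring.
have hb := @sqr_sum_le R k (fun j => \sum_i c i j) k0.
have hg := @sqr_sum_le R k (fun i => \sum_j c i j) k0.
rewrite exchange_big /= in hb; rewrite -/a in hb hg.
set B := \sum_j (\sum_i c i j) ^+ 2 in hb *.
set G := \sum_i (\sum_j c i j) ^+ 2 in hg form *.
rewrite -mulr_suml -/G in form *.
have e : k%:R * (G / k%:R) = G by field; lra.
rewrite mulrBr e in form.
have e2 : (k%:R - 1) ^+ 2 / (4 * k%:R ^+ 2) * a ^+ 2 =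
  (a ^+ 2 - 2 * (a ^+ 2 / k%:R) + a ^+ 2 / k%:R * k%:R^-1) / 4 by field; lra.
rewrite e2 [_ * (mxdot _ _ - _)](_ : _ = (k%:R * mxdot c c + mxdot c c - G - G * k%:R^-1) / 4);
  last by field; lra.
have : 0 <= (G - a ^+ 2 / k%:R) * (1 - k%:R^-1).
  rewrite mulr_ge0 ?subr_ge0// invf_le1// ler1n//.
lra.
Qed.
End Spectral.

(** * The random oriented graph as a product space *)

Definition Gnp_exp (R : realType) (n : nat) (p : R) (F : ograph 'I_n -> R) : R :=
  \sum_(G : ograph 'I_n) Gnp_weight p G * F G.

(** A state for every ordered pair [e], although only the pairs with [e.1 < e.2] are
    read: the others have state [None] with probability 1. The index type of the
    product space is then a plain product. *)
Definition config (n : nat) : finType := {ffun 'I_n * 'I_n -> option bool}.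

Definition config_arc n (w : config n) : rel 'I_n := fun x y =>
  (x < y)%N && (w (x, y) == Some true) || (y < x)%N && (w (y, x) == Some false).

Lemma config_oriented n (w : config n) :
  oriented [set e : 'I_n * 'I_n | config_arc w e.1 e.2]%SET.
Proof.
apply/andP; split; apply/forallP => x.
  by rewrite inE /config_arc /= ltnn.
apply/forallP => y; apply/implyP; rewrite !inE /config_arc /=.
case: ltngtP => //= _; last by rewrite orbF; case: eqP => // ->.
by rewrite orbF; case: eqP => // ->.
Qed.

Definition graph_of n (w : config n) : ograph 'I_n := OGraph (config_oriented w).

Lemma arc_graph_of n (w : config n) x y : arc (graph_of w) x y = config_arc w x y.
Proof. by rewrite /arc inE. Qed.

Definition pair_state n (G : ograph 'I_n) (e : 'I_n * 'I_n) : option bool :=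
  if arc G e.1 e.2 then Some true else if arc G e.2 e.1 then Some false else None.

Lemma pair_state_graph_of n (w : config n) (e : 'I_n * 'I_n) :
  (e.1 < e.2)%N -> pair_state (graph_of w) e = w e.
Proof.
move=> lt; rewrite /pair_state !arc_graph_of /config_arc lt ltnNge (ltnW lt) /=.
by rewrite orbF -surjective_pairing; case: (w e) => [[]|].
Qed.

(** Being the preimage of a given graph is a condition on each pair separately,
    so that its probability is a product. *)
Lemma graph_ofP n (w : config n) (G : ograph 'I_n) :
  (graph_of w == G) =
  [forall e : 'I_n * 'I_n, (e.1 < e.2)%N ==> (w e == pair_state G e)].
Proof.
apply/eqP/forallP => [<- e|h].
  by apply/implyP => lt; rewrite pair_state_graph_of.
apply: val_inj; apply/setP => -[x y] /=; rewrite inE /config_arc /=.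
have h1 := implyP (h (x, y)); have h2 := implyP (h (y, x)).
rewrite -/(arc G x y); move: h1 h2; rewrite /pair_state /=.
case: ltngtP => //= [xy /(_ isT)/eqP -> _|yx _ /(_ isT)/eqP ->|xy _ _].
- by rewrite orbF; case: (arc G x y) (arc G y x) => [] [].
- case xy: (arc G x y); first by rewrite (negbTE (arc_asym xy)).
  by case: (arc G y x).
- by rewrite (val_inj xy) arc_irr.
Qed.

Definition pair_weight (R : realType) n (p : R) (e : 'I_n * 'I_n) (s : option bool) : R :=
  if (e.1 < e.2)%N then (if s is Some _ then p * 2^-1 else 1 - p) else (s == None)%:R.

Definition config_weight (R : realType) n (p : R) (w : config n) : R :=
  \prod_e pair_weight p e (w e).

Lemma sum_option_bool (R : realType) (f : option bool -> R) :
  \sum_s f s = f None + f (Some true) + f (Some false).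
Proof.
rewrite (bigD1 None)//= (bigD1 (Some true))//= (bigD1 (Some false))//= big1 ?addr0 ?addrA//.
by case=> [[]|].
Qed.

Lemma pair_weight_sum (R : realType) n (p : R) (e : 'I_n * 'I_n) : \sum_s pair_weight p e s = 1.
Proof. by rewrite sum_option_bool /pair_weight; case: ifP => _ /=; [field|ring]. Qed.

Lemma config_sum_prod (R : realType) n (p : R) (g : 'I_n * 'I_n -> option bool -> R) :
  \sum_(w : config n) config_weight p w * \prod_e g e (w e) =
  \prod_e \sum_s pair_weight p e s * g e s.
Proof.
rewrite bigA_distr_bigA /=; apply: eq_bigr => w _.
by rewrite -big_split.
Qed.

Lemma prod_bool (R : realType) (I : finType) (P : pred I) :
  \prod_i (P i)%:R = [forall i, P i]%:R :> R.
Proof.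
case: (boolP [forall i, P i]) => [/forallP h|].
  by rewrite big1// => i _; rewrite h.
rewrite negb_forall => /existsP[i /negbTE Pi].
by rewrite (bigD1 i)//= Pi mul0r.
Qed.

Lemma Gnp_weight_config (R : realType) n (p : R) (G : ograph 'I_n) :
  Gnp_weight p G = \sum_(w | graph_of w == G) config_weight p w.
Proof.
rewrite big_mkcond /=.
transitivity (\sum_(w : config n) config_weight p w *
   \prod_(e : 'I_n * 'I_n) (((e.1 < e.2)%N ==> (w e == pair_state G e))%:R)).
  rewrite (config_sum_prod p (fun (e : 'I_n * 'I_n) s => ((e.1 < e.2)%N ==> (s == pair_state G e))%:R)).
  rewrite /Gnp_weight big_mkcond /=; apply: eq_bigr => e _.
  rewrite /pair_weight; case: ifP => lt /=.
    rewrite (bigD1 (pair_state G e))//= eqxx mulr1 big1 ?addr0; last first.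
      by move=> s /negbTE ->; rewrite mulr0.
    by rewrite /pair_state; case: (arc G e.1 e.2) => //; case: (arc G e.2 e.1).
  by rewrite sum_option_bool /=; ring.
apply: eq_bigr => w _; rewrite graph_ofP prod_bool.
by case: ifP => _; rewrite ?mulr1 ?mulr0.
Qed.

Lemma Gnp_exp_config (R : realType) n (p : R) (F : ograph 'I_n -> R) :
  Gnp_exp p F = \sum_(w : config n) config_weight p w * F (graph_of w).
Proof.
rewrite (partition_big (@graph_of n) xpredT)//=; apply: eq_bigr => G _.
rewrite Gnp_weight_config mulr_suml; apply: eq_bigr => w /eqP wG.
by rewrite wG.
Qed.

(** A product over arcs is a product over unordered pairs of functions of the
    state of the pair. *)
Lemma prod_arcs (R : realType) n (G : ograph 'I_n) (a : 'I_n -> 'I_n -> R) :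
  \prod_(e : 'I_n * 'I_n | arc G e.1 e.2) a e.1 e.2 =
  \prod_(e : 'I_n * 'I_n | (e.1 < e.2)%N)
    (if pair_state G e is Some b then (if b then a e.1 e.2 else a e.2 e.1) else 1).
Proof.
rewrite (bigID (fun e : 'I_n * 'I_n => (e.1 < e.2)%N)) /=.
rewrite [X in _ * X](reindex_inj (h := fun e : 'I_n * 'I_n => (e.2, e.1))) /=; last first.
  by move=> [x y] [x' y'] /= [-> ->].
have -> : \prod_(j : 'I_n * 'I_n | arc G j.2 j.1 && ~~ (j.2 < j.1)%N) a j.2 j.1 =
   \prod_(j : 'I_n * 'I_n | arc G j.2 j.1 && (j.1 < j.2)%N) a j.2 j.1.
  apply: eq_bigl => -[x y] /=; rewrite -leqNgt leq_eqVlt.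
  by case: eqP => //= /val_inj ->; rewrite arc_irr.
rewrite big_mkcondl [X in _ * X]big_mkcondl /= -big_split /=.
apply: eq_bigr => e lt; rewrite /pair_state.
case h: (arc G e.1 e.2); last by rewrite mul1r; case: ifP.
by rewrite (negbTE (arc_asym h)) mulr1.
Qed.

(** Independence of the pairs. All expectations below are reduced to this one by
    the choice of [a]. *)
Lemma Gnp_exp_prod (R : realType) n (p : R) (a : 'I_n -> 'I_n -> R) :
  Gnp_exp p (fun G => \prod_(e : 'I_n * 'I_n | arc G e.1 e.2) a e.1 e.2) =
  \prod_(e : 'I_n * 'I_n | (e.1 < e.2)%N) (1 - p + p / 2 * (a e.1 e.2 + a e.2 e.1)).
Proof.
rewrite Gnp_exp_config.
pose g (e : 'I_n * 'I_n) (s : option bool) : R :=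
  if (e.1 < e.2)%N then (if s is Some b then (if b then a e.1 e.2 else a e.2 e.1) else 1) else 1.
transitivity (\sum_(w : config n) config_weight p w * \prod_e g e (w e)).
  apply: eq_bigr => w _; congr (_ * _); rewrite prod_arcs big_mkcond /=.
  apply: eq_bigr => e _; rewrite /g; case: ifP => // lt.
  by rewrite pair_state_graph_of.
rewrite config_sum_prod [RHS]big_mkcond /=; apply: eq_bigr => e _.
rewrite sum_option_bool /pair_weight /g; case: ifP => _ /=; ring.
Qed.

(** * Expectations of products over arcs *)

Lemma Gnp_probE (R : realType) n (p : R) (A : pred (ograph 'I_n)) :
  Gnp_prob p A = Gnp_exp p (fun G => (A G)%:R).
Proof.
rewrite /Gnp_prob big_mkcond /=; apply: eq_bigr => G _.
by case: (A G); rewrite ?mulr1 ?mulr0.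
Qed.

Lemma Gnp_weight_ge0 (R : realType) n (p : R) (G : ograph 'I_n) :
  0 <= p <= 1 -> 0 <= Gnp_weight p G.
Proof.
move=> /andP[p0 p1]; apply: prodr_ge0 => e _; case: ifP => _; last by lra.
by rewrite mulr_ge0 ?invr_ge0.
Qed.

Lemma Gnp_exp_le (R : realType) n (p : R) (F F' : ograph 'I_n -> R) :
  0 <= p <= 1 -> (forall G, F G <= F' G) -> Gnp_exp p F <= Gnp_exp p F'.
Proof.
move=> p01 h; apply: ler_sum => G _; apply: ler_wpM2l => //; exact: Gnp_weight_ge0.
Qed.

Lemma Gnp_exp_ge0 (R : realType) n (p : R) (F : ograph 'I_n -> R) :
  0 <= p <= 1 -> (forall G, 0 <= F G) -> 0 <= Gnp_exp p F.
Proof.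
by move=> p01 h; apply: sumr_ge0 => G _; rewrite mulr_ge0// Gnp_weight_ge0.
Qed.

Lemma Gnp_expZ (R : realType) n (p c : R) (F : ograph 'I_n -> R) :
  Gnp_exp p (fun G => c * F G) = c * Gnp_exp p F.
Proof. by rewrite /Gnp_exp mulr_sumr; apply: eq_bigr => G _; rewrite mulrCA. Qed.

Lemma Gnp_expD (R : realType) n (p : R) (F F' : ograph 'I_n -> R) :
  Gnp_exp p (fun G => F G + F' G) = Gnp_exp p F + Gnp_exp p F'.
Proof. by rewrite /Gnp_exp -big_split; apply: eq_bigr => G _; rewrite mulrDr. Qed.

Lemma Gnp_exp_sum (R : realType) n (p : R) (I : Type) (r : seq I) (P : pred I)
    (F : I -> ograph 'I_n -> R) :
  Gnp_exp p (fun G => \sum_(i <- r | P i) F i G) = \sum_(i <- r | P i) Gnp_exp p (F i).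
Proof.
by rewrite /Gnp_exp exchange_big; apply: eq_bigr => G _; rewrite mulr_sumr.
Qed.

Lemma eq_Gnp_exp (R : realType) n (p : R) (F F' : ograph 'I_n -> R) :
  F =1 F' -> Gnp_exp p F = Gnp_exp p F'.
Proof. by move=> h; apply: eq_bigr => G _; rewrite h. Qed.

Lemma Gnp_exp1 (R : realType) n (p : R) : Gnp_exp (n := n) p (fun=> 1) = 1.
Proof.
transitivity (Gnp_exp (n := n) p
  (fun G => \prod_(e : 'I_n * 'I_n | arc G e.1 e.2) (fun _ _ => 1) e.1 e.2)).
  by apply: eq_Gnp_exp => G; rewrite big1.
by rewrite (Gnp_exp_prod p (fun _ _ => 1)) big1// => e _; field.
Qed.

Lemma sum_ltn_pairs (R : realType) n (a : 'I_n -> 'I_n -> R) :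
  \sum_x \sum_y a x y =
  \sum_(e : 'I_n * 'I_n | (e.1 < e.2)%N) (a e.1 e.2 + a e.2 e.1) + \sum_x a x x.
Proof.
rewrite pair_big /= (bigID (fun e : 'I_n * 'I_n => (e.1 < e.2)%N)) /= big_split /= -!addrA.
congr (_ + _).
rewrite (bigID (fun e : 'I_n * 'I_n => (e.2 < e.1)%N)) /=; congr (_ + _).
  rewrite [RHS](reindex_inj (h := fun e : 'I_n * 'I_n => (e.2, e.1))) /=; last first.
    by move=> [x y] [x' y'] /= [-> ->].
  apply: eq_bigl => -[x y] /=.
  by case: ltngtP.
rewrite (reindex_onto (fun x : 'I_n => (x, x)) (fun e : 'I_n * 'I_n => e.1)) /=; last first.
  by move=> [x y] /=; case: ltngtP => //= /val_inj ->.
by apply: eq_bigl => x; rewrite ltnn /= eqxx.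
Qed.

Lemma card_ltn_pairs (R : realType) n :
  2 * (\sum_(e : 'I_n * 'I_n | (e.1 < e.2)%N) 1) = n%:R ^+ 2 - n%:R :> R.
Proof.
have h := sum_ltn_pairs (fun _ _ : 'I_n => 1 : R).
have c1 : \sum_(x < n) 1 = n%:R :> R by rewrite sumr_const card_ord.
have -> : 2 * (\sum_(e : 'I_n * 'I_n | (e.1 < e.2)%N) 1) =
  \sum_(e : 'I_n * 'I_n | (e.1 < e.2)%N) (1 + 1) :> R.
  by rewrite mulr_sumr; apply: eq_bigr => e _; ring.
have -> : n%:R ^+ 2 = \sum_(x < n) \sum_(y < n) 1 :> R.
  rewrite (eq_bigr (fun=> n%:R * 1)) => [|x _]; last by rewrite c1 mulr1.
  by rewrite -mulr_sumr c1 expr2.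
by rewrite h c1 addrK.
Qed.

Lemma Gnp_exp_prod_le (R : realType) n (p : R) (a : 'I_n -> 'I_n -> R) :
  0 <= p <= 1 -> (forall x y, 0 <= a x y) ->
  Gnp_exp p (fun G => \prod_(e : 'I_n * 'I_n | arc G e.1 e.2) a e.1 e.2) <=
  expR (p / 2 * (\sum_x \sum_y a x y - n%:R ^+ 2 + n%:R)).
Proof.
move=> /andP[p0 p1] a0; rewrite Gnp_exp_prod.
apply: (@le_trans _ _ (\prod_(e : 'I_n * 'I_n | (e.1 < e.2)%N)
    expR (p / 2 * (a e.1 e.2 + a e.2 e.1) - p))).
  apply: ler_prod => e _; apply/andP; split.
    by apply: addr_ge0; [lra|apply: mulr_ge0; [lra|exact: addr_ge0]].
  by apply: le_trans (expR_ge1Dx _); lra.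
rewrite -expR_sum ler_expR sumrB -mulr_sumr.
have := sum_ltn_pairs a; have := card_ltn_pairs R n.
set N := \sum_(e | _) 1 => e1 ->.
have -> : \sum_(e : 'I_n * 'I_n | (e.1 < e.2)%N) p = p * N.
  by rewrite /N mulr_sumr; apply: eq_bigr => e _; rewrite mulr1.
have : 0 <= p / 2 * \sum_x a x x by rewrite mulr_ge0 ?divr_ge0 ?sumr_ge0.
have -> : n%:R ^+ 2 = 2 * N + n%:R by rewrite e1; ring.
lra.
Qed.

(** Obtained from [1 + x <= expR x] at [x = - (u - 2 * u ^ 2)] by inversion. *)
Lemma ge_expR_sqr (R : realType) (u : R) : - (1 / 2) <= u -> expR (u - 2 * u ^+ 2) <= 1 + u.
Proof.
move=> u0.
have h := expR_ge1Dx (- (u - 2 * u ^+ 2)).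
have d0 : 0 < 1 - (u - 2 * u ^+ 2) by rewrite expr2; nra.
rewrite -[X in expR X]opprK expRN.
apply: (@le_trans _ _ (1 - (u - 2 * u ^+ 2))^-1).
  rewrite lef_pV2; [exact: h|by rewrite posrE expR_gt0|by rewrite posrE].
rewrite -[_^-1]mul1r ler_pdivrMr//.
have : 0 <= u ^+ 2 * (1 + 2 * u) by rewrite mulr_ge0 ?sqr_ge0//; lra.
by rewrite !expr2; lra.
Qed.

Lemma Gnp_exp_prod_ge (R : realType) n (p : R) (a : 'I_n -> 'I_n -> R) :
  0 <= p <= 1 / 2 -> (forall x, a x x = 0) ->
  (forall x y, 0 <= a x y + a y x <= 4) ->
  expR (p / 2 * (\sum_x \sum_y a x y - n%:R ^+ 2) - p ^+ 2 * n%:R ^+ 2) <=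
  Gnp_exp p (fun G => \prod_(e : 'I_n * 'I_n | arc G e.1 e.2) a e.1 e.2).
Proof.
move=> /andP[p0 p1] axx a4; rewrite Gnp_exp_prod.
apply: (@le_trans _ _ (\prod_(e : 'I_n * 'I_n | (e.1 < e.2)%N)
    expR (p / 2 * (a e.1 e.2 + a e.2 e.1) - (p + 2 * p ^+ 2)))); last first.
  apply: ler_prod => e _; apply/andP; split; first exact: expR_ge0.
  set s := a e.1 e.2 + a e.2 e.1.
  have /andP[s0 s4] : 0 <= s <= 4 := a4 e.1 e.2.
  have u1 : - p <= p / 2 * s - p.
    by have ps := mulr_ge0 p0 s0; lra.
  have u2 : p / 2 * s - p <= p by have := ler_wpM2l p0 s4; lra.
  have u3 : - (1 / 2) <= p / 2 * s - p by lra.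
  apply: (@le_trans _ _ (expR ((p / 2 * s - p) - 2 * (p / 2 * s - p) ^+ 2))).
    rewrite ler_expR opprD addrA; set u := p / 2 * s - p in u1 u2 *.
    have : 0 <= (p - u) * (p + u) by apply: mulr_ge0; lra.
    by rewrite !expr2; lra.
  by apply: le_trans (ge_expR_sqr u3) _; lra.
rewrite -expR_sum ler_expR sumrB -mulr_sumr.
have := sum_ltn_pairs a; have := card_ltn_pairs R n.
set N := \sum_(e | _) 1 => e1 ->.
have -> : \sum_(e : 'I_n * 'I_n | (e.1 < e.2)%N) (p + 2 * p ^+ 2) = (p + 2 * p ^+ 2) * N.
  by rewrite /N mulr_sumr; apply: eq_bigr => e _; rewrite mulr1.
rewrite [\sum_x a x x]big1// addr0.
have eN : n%:R ^+ 2 = 2 * N + n%:R by rewrite e1; ring.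
rewrite eN.
have n0 : 0 <= n%:R :> R by [].
have h1 : 0 <= p * n%:R by rewrite mulr_ge0.
have h2 : 0 <= p ^+ 2 * n%:R by rewrite mulr_ge0// sqr_ge0.
lra.
Qed.

(** * Concentration *)

Definition upd n (w : config n) (e : 'I_n * 'I_n) (s : option bool) : config n :=
  [ffun e' => if e' == e then s else w e'].

Lemma upd_same n (w : config n) e s s' : upd (upd w e s') e s = upd w e s.
Proof. by apply/ffunP => e'; rewrite !ffunE; case: eqP. Qed.

Lemma upd_id n (w : config n) e : upd w e (w e) = w.
Proof. by apply/ffunP => e'; rewrite !ffunE; case: eqP => [->|]. Qed.

Lemma upd_comm n (w : config n) e e' s s' : e != e' ->
  upd (upd w e' s') e s = upd (upd w e s) e' s'.
Proof.
move=> ee; apply/ffunP => x; rewrite !ffunE.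
by case: eqP => [->|//]; rewrite (negbTE ee).
Qed.

Definition config_exp (R : realType) n (p : R) (F : config n -> R) : R :=
  \sum_w config_weight p w * F w.

Definition resample (R : realType) n (p : R) e (F : config n -> R) (w : config n) : R :=
  \sum_s pair_weight p e s * F (upd w e s).

(** Detailed balance for the resampling of one pair. *)
Lemma config_weight_upd (R : realType) n (p : R) (w : config n) e s :
  config_weight p (upd w e s) * pair_weight p e (w e) =
  config_weight p w * pair_weight p e s.
Proof.
rewrite /config_weight (bigD1 e)//= [X in _ = X * _](bigD1 e)//= ffunE eqxx.
rewrite mulrAC [RHS]mulrAC; congr (_ * _); first by rewrite mulrC.
by apply: eq_bigr => e' /negbTE ee; rewrite ffunE ee.
Qed.

Lemma config_exp_resample (R : realType) n (p : R) e (F : config n -> R) :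
  config_exp p (resample p e F) = config_exp p F.
Proof.
rewrite /config_exp /resample.
transitivity (\sum_(ws : config n * option bool)
   config_weight p (upd ws.1 e ws.2) * pair_weight p e (ws.1 e) * F (upd ws.1 e ws.2)).
  rewrite -(pair_big xpredT xpredT (fun w s => config_weight p (upd w e s) *
     pair_weight p e (w e) * F (upd w e s))) /=.
  apply: eq_bigr => w _; rewrite mulr_sumr; apply: eq_bigr => s _.
  by rewrite config_weight_upd mulrA.
rewrite (reindex_inj (h := fun ws : config n * option bool => (upd ws.1 e ws.2, ws.1 e))) /=.
  rewrite -(pair_big xpredT xpredT (fun w s =>
    config_weight p (upd (upd w e s) e (w e)) * pair_weight p e (upd w e s e) *
      F (upd (upd w e s) e (w e)))) /=.
  apply: eq_bigr => w _; rewrite -[RHS]mulr1 -(pair_weight_sum p e) mulr_sumr.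
  apply: eq_bigr => s _; rewrite upd_same upd_id ffunE eqxx; ring.
move=> [w s] [w' s'] /= [h1 h2].
have hs : s = s' by have := congr1 (fun f : config n => f e) h1; rewrite !ffunE eqxx.
rewrite hs; congr (_, _).
by rewrite -[w](upd_id _ e) -[w'](upd_id _ e) h2 -(upd_same w e _ s) -(upd_same w' e _ s') h1.
Qed.

Lemma ratio_add_inv_le (R : realType) (M x y : R) : 1 <= M -> 0 < x -> 0 < y ->
  x <= M * y -> y <= M * x -> x / y + y / x <= 2 + (M - 1) ^+ 2.
Proof.
wlog yx : x y / y <= x.
  move=> H M1 x0 y0 xy yx; have [h|h] := leP y x; first exact: H.
  by rewrite addrC; apply: H => //; exact: ltW.
move=> M1 x0 y0 xM _.
have -> : x / y + y / x = 2 + (x - y) ^+ 2 / (x * y) by field; lra.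
rewrite lerD2l ler_pdivrMr ?mulr_gt0//.
have h1 : (x - y) ^+ 2 <= ((M - 1) * y) ^+ 2 by rewrite ler_sqr ?nnegrE; [lra|lra|rewrite mulr_ge0; lra].
apply: le_trans h1 _; rewrite exprMn; apply: ler_wpM2l; first exact: sqr_ge0.
by rewrite expr2; apply: ler_wpM2r => //; exact: ltW.
Qed.

Definition pair_prob (R : realType) n (p : R) (e : 'I_n * 'I_n) : R :=
  if (e.1 < e.2)%N then p else 0.

(** The product of the two means is the mean of [f s / f s'] for independent [s]
    and [s']. These differ with probability at most [2 * p], and when they do, the
    ratios for [(s, s')] and [(s', s)] add up to at most [2 + (M - 1) ^ 2]. *)
Lemma one_coordinate (R : realType) n (p M : R) (e : 'I_n * 'I_n) (f : option bool -> R) :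
  0 <= p < 1 -> 1 <= M -> (forall s, 0 < f s) -> (forall s s', f s <= M * f s') ->
  (\sum_s pair_weight p e s * f s) * (\sum_s pair_weight p e s * (f s)^-1) <=
  1 + pair_prob p e * (M - 1) ^+ 2.
Proof.
move=> /andP[p0 p1] M1 f0 fM; rewrite !sum_option_bool /pair_weight /pair_prob.
move: (f0 None) (f0 (Some true)) (f0 (Some false)).
have h01 := ratio_add_inv_le M1 (f0 None) (f0 (Some true)) (fM _ _) (fM _ _).
have h02 := ratio_add_inv_le M1 (f0 None) (f0 (Some false)) (fM _ _) (fM _ _).
have h12 := ratio_add_inv_le M1 (f0 (Some true)) (f0 (Some false)) (fM _ _) (fM _ _).
move: h01 h02 h12; set x := f None; set y := f (Some true); set z := f (Some false).
move=> h01 h02 h12 x0 y0 z0.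
case: ifP => _ /=; last first.
  by rewrite ?mulr1n ?mulr0n !mul0r !addr0 !mul1r divff ?lexx// gt_eqF.
have -> : ((1 - p) * x + p / 2 * y + p / 2 * z) * ((1 - p) / x + p / 2 / y + p / 2 / z) =
  (1 - p) * (1 - p) + p * p / 2 + (1 - p) * p / 2 * (x / y + y / x) +
  (1 - p) * p / 2 * (x / z + z / x) + p * p / 4 * (y / z + z / y) by field; lra.
set m := (M - 1) ^+ 2 in h01 h02 h12 *.
have m0 : 0 <= m by rewrite sqr_ge0.
have q0 : 0 <= (1 - p) * p / 2 by rewrite divr_ge0// mulr_ge0//; lra.
have pp0 : 0 <= p * p / 4 by rewrite divr_ge0// mulr_ge0.
have g1 := ler_wpM2l q0 h01; have g2 := ler_wpM2l q0 h02; have g3 := ler_wpM2l pp0 h12.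
have g4 := mulr_ge0 (mulr_ge0 p0 p0) m0.
lra.
Qed.

Lemma pair_weight_ge0 (R : realType) n (p : R) (e : 'I_n * 'I_n) s :
  0 <= p < 1 -> 0 <= pair_weight p e s.
Proof.
move=> /andP[p0 p1]; rewrite /pair_weight; case: ifP => // _.
by case: s => [_|]; [rewrite mulr_ge0// invr_ge0|lra].
Qed.

Lemma config_weight_sum (R : realType) n (p : R) : \sum_(w : config n) config_weight p w = 1.
Proof.
transitivity (\sum_(w : config n) config_weight p w * \prod_(e : 'I_n * 'I_n) (fun _ _ => 1) e (w e)).
  by apply: eq_bigr => w _; rewrite big1// mulr1.
rewrite (config_sum_prod p (fun _ _ => 1)) big1// => e _.
by rewrite -[RHS](pair_weight_sum p e); apply: eq_bigr => s _; rewrite mulr1.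
Qed.

(** Averaging over one pair keeps the ratio condition on [F], removes one
    dependence, and by [one_coordinate] costs one factor on the side of the
    inverse; at the end the function is constant. *)
Lemma config_exp_inv_le (R : realType) n (p M : R) (J : seq ('I_n * 'I_n)) (F : config n -> R) :
  0 <= p < 1 -> 1 <= M -> (forall w, 0 < F w) ->
  (forall w e s, F (upd w e s) <= M * F w) ->
  (forall w w' : config n, {in J, w =1 w'} -> F w = F w') ->
  config_exp p F * config_exp p (fun w => (F w)^-1) <=
  \prod_(e <- J) (1 + pair_prob p e * (M - 1) ^+ 2).
Proof.
move=> p01 M1; elim: J F => [|e J IH] F F0 FM FJ.
  pose w0 : config n := [ffun=> None].
  have Fc w : F w = F w0 by apply: FJ.
  rewrite big_nil /config_exp.
  under eq_bigr do rewrite Fc.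
  under [X in _ * X <= _]eq_bigr do rewrite Fc.
  by rewrite -!mulr_suml config_weight_sum !mul1r divff// gt_eqF.
pose F' := resample p e F.
have pw0 s := pair_weight_ge0 e s p01.
have F'0 w : 0 < F' w.
  rewrite /F' /resample sum_option_bool.
  apply: ltr_wpDr; first by rewrite mulr_ge0// ltW.
  apply: ltr_wpDr; first by rewrite mulr_ge0// ltW.
  rewrite mulr_gt0// /pair_weight; case: ifP => _ //.
  by case/andP: p01; lra.
have F'M w e' s' : F' (upd w e' s') <= M * F' w.
  rewrite /F' /resample mulr_sumr; apply: ler_sum => s _.
  rewrite mulrCA; apply: ler_wpM2l => //.
  have [->|ee] := eqVneq e e'; last by rewrite upd_comm.
  by rewrite upd_same ler_peMl// ltW.
have F'J (w w' : config n) : {in J, w =1 w'} -> F' w = F' w'.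
  move=> h; apply: eq_bigr => s _; congr (_ * _); apply: FJ => e'.
  rewrite !ffunE inE; case: eqP => //= _; exact: h.
have IH' := IH F' F'0 F'M F'J.
have step : config_exp p (fun w => (F w)^-1) <=
   (1 + pair_prob p e * (M - 1) ^+ 2) * config_exp p (fun w => (F' w)^-1).
  rewrite -(config_exp_resample p e (fun w => (F w)^-1)) /config_exp mulr_sumr.
  apply: ler_sum => w _; rewrite mulrCA; apply: ler_wpM2l.
    by apply: prodr_ge0 => e' _; exact: pair_weight_ge0.
  rewrite -(ler_pM2l (F'0 w)) mulrCA divff ?gt_eqF// mulr1.
  apply: (@one_coordinate R n p M e (fun s => F (upd w e s))) => // s s'.
  by rewrite -(upd_same w e s s').
rewrite big_cons -(config_exp_resample p e F) -/F'.
have EF'0 : 0 <= config_exp p F'.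
  apply: sumr_ge0 => w _; rewrite mulr_ge0// ?(ltW (F'0 w))//.
  by apply: prodr_ge0 => e' _; exact: pair_weight_ge0.
apply: le_trans (ler_wpM2l EF'0 step) _.
rewrite mulrCA; apply: ler_wpM2l => //.
have h0 : 0 <= (M - 1) ^+ 2 by exact: sqr_ge0.
rewrite addr_ge0// mulr_ge0// /pair_prob; case: ifP => // _; lra.
Qed.

(** With [F = exp (t * f)] this bounds an upper tail of [f] times a lower tail. Each
    pair contributes its probability [p] to the exponent, so that for [p = d / n]
    the exponent is of order [n], although there are about [n ^ 2 / 2] pairs. *)
Lemma Gnp_exp_inv_le (R : realType) n (p M : R) (F : ograph 'I_n -> R) :
  0 <= p < 1 -> 1 <= M -> (forall G, 0 < F G) ->
  (forall G G' v, (forall x y, x != v -> y != v -> arc G x y = arc G' x y) ->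
     F G <= M * F G') ->
  Gnp_exp p F * Gnp_exp p (fun G => (F G)^-1) <= expR (p * n%:R ^+ 2 / 2 * (M - 1) ^+ 2).
Proof.
move=> p01 M1 F0 FM; rewrite !Gnp_exp_config.
have := @config_exp_inv_le R n p M (index_enum _) (fun w => F (graph_of w)) p01 M1.
move=> /(_ (fun w => F0 _)); rewrite /config_exp => H.
apply: le_trans (H _ _) _.
- move=> w e s; apply: (FM _ _ e.1) => x y xe ye.
  rewrite !arc_graph_of /config_arc !ffunE.
  have n1 : ((x, y) == e) = false by case: e xe {ye} => a b /= xa; apply/eqP => -[/eqP]; rewrite (negbTE xa).
  have n2 : ((y, x) == e) = false by case: e ye {xe n1} => a b /= xa; apply/eqP => -[/eqP]; rewrite (negbTE xa).
  by rewrite n1 n2.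
- move=> w w' h; congr (F (graph_of _)); apply/ffunP => e; apply: h.
  by rewrite mem_index_enum.
case/andP: p01 => p0 p1; have m0 : 0 <= (M - 1) ^+ 2 by exact: sqr_ge0.
apply: (@le_trans _ _ (\prod_(e : 'I_n * 'I_n) expR (pair_prob p e * (M - 1) ^+ 2))).
  apply: ler_prod => e _; rewrite expR_ge1Dx andbT.
  by rewrite addr_ge0// mulr_ge0// /pair_prob; case: ifP.
rewrite -expR_sum ler_expR -mulr_suml; apply: ler_wpM2r => //.
rewrite /pair_prob -big_mkcond /=.
have := card_ltn_pairs R n; set N := \sum_(e | _) 1 => eN.
have -> : \sum_(e : 'I_n * 'I_n | (e.1 < e.2)%N) p = p * N.
  by rewrite /N mulr_sumr; apply: eq_bigr => e _; rewrite mulr1.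
have -> : n%:R ^+ 2 = 2 * N + n%:R by rewrite eN; ring.
have : 0 <= p * n%:R by rewrite mulr_ge0.
lra.
Qed.

(** * From a partial colouring to a colouring *)

Local Open Scope nat_scope.

(** The Paley tournament of order 7: the nonzero squares modulo 7 are 1, 2, 4. *)
Definition qr7 (a b : 'I_7) : bool := (b + 7 - a) %% 7 \in [:: 1; 2; 4].

Definition oriented_as (W : Type) (r : W -> W -> bool) (b : bool) (x y : W) : bool :=
  if b then r x y else r y x.

(** Any two vertices, even equal ones, are joined by a walk of length 3 with any
    prescribed orientations of its steps. *)
Lemma qr7_path (c1 c2 : 'I_7) (b1 b2 b3 : bool) :
  exists a b, [/\ oriented_as qr7 b1 a c1, oriented_as qr7 b2 b c2 & oriented_as qr7 b3 a b].
Proof.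
pose q (x y : nat) := (y + 7 - x) %% 7 \in [:: 1; 2; 4].
have H : all (fun c1 => all (fun c2 => all (fun b1 => all (fun b2 => all (fun b3 =>
   has (fun a => has (fun b => [&& oriented_as q b1 a c1, oriented_as q b2 b c2
     & oriented_as q b3 a b]) (iota 0 7)) (iota 0 7))
   [:: true; false]) [:: true; false]) [:: true; false]) (iota 0 7)) (iota 0 7).
  by vm_compute.
have inb (b : bool) : b \in [:: true; false] by case: b.
have ini (c : 'I_7) : (c : nat) \in iota 0 7 by rewrite mem_iota /=.
have := allP (allP (allP (allP (allP H _ (ini c1)) _ (ini c2)) _ (inb b1)) _ (inb b2)) _ (inb b3).
move=> /hasP[a a7 /hasP[b b7 /and3P[h1 h2 h3]]]; rewrite !mem_iota in a7 b7.
exists (Ordinal a7), (Ordinal b7).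
by split; [move: h1|move: h2|move: h3]; rewrite /oriented_as; case: ifP.
Qed.

Lemma qr7_irr a : qr7 a a = false.
Proof. by rewrite /qr7 addnC addnK. Qed.

Lemma qr7_asym a b : qr7 a b -> ~~ qr7 b a.
Proof.
pose q (x y : nat) := (y + 7 - x) %% 7 \in [:: 1; 2; 4].
have H : all (fun a => all (fun b => q a b ==> ~~ q b a) (iota 0 7)) (iota 0 7) by vm_compute.
have ini (c : 'I_7) : (c : nat) \in iota 0 7 by rewrite mem_iota /=.
exact: (implyP (allP (allP H _ (ini a)) _ (ini b))).
Qed.

Definition adj (V : finType) (G : ograph V) : rel V := fun x y => arc G x y || arc G y x.

Lemma adjC (V : finType) (G : ograph V) x y : adj G x y = adj G y x.
Proof. by rewrite /adj orbC. Qed.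

Lemma adjE (V : finType) (G : ograph V) x y : adj G x y = arc G x y + arc G y x :> nat.
Proof.
rewrite /adj; case h: (arc G x y); first by rewrite (negbTE (arc_asym h)).
by case: (arc G y x).
Qed.

Definition inner_arcs (V : finType) (G : ograph V) (S : {set V}) : nat :=
  \sum_(x in S) \sum_(y in S) arc G x y.

Definition inner_deg (V : finType) (G : ograph V) (S : {set V}) (x : V) : nat :=
  \sum_(y in S) adj G x y.

Lemma sum_inner_deg (V : finType) (G : ograph V) (S : {set V}) :
  \sum_(x in S) inner_deg G S x = 2 * inner_arcs G S.
Proof.
transitivity (\sum_(x in S) \sum_(y in S) arc G x y + \sum_(x in S) \sum_(y in S) arc G y x).
  rewrite -big_split /=; apply: eq_bigr => x _; rewrite -big_split /=.
  by apply: eq_bigr => y _; rewrite adjE.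
rewrite mul2n -addnn; congr (_ + _); exact: exchange_big.
Qed.

Lemma inner_arcs_add (V : finType) (G : ograph V) (S : {set V}) (v : V) : v \notin S ->
  inner_arcs G (v |: S) = inner_arcs G S + inner_deg G S v.
Proof.
move=> vS; rewrite /inner_arcs big_setU1//= big_setU1//= arc_irr add0n.
rewrite addnC (eq_bigr (fun x => arc G x v + \sum_(y in S) arc G x y)); last first.
  by move=> x _; rewrite big_setU1.
rewrite big_split /= addnAC addnC; congr (_ + _).
by rewrite /inner_deg -big_split /=; apply: eq_bigr => x _; rewrite adjE addnC.
Qed.

Lemma inner_deg_le1 (V : finType) (G : ograph V) (S : {set V}) (x : V) :
  inner_deg G S x <= 1 -> exists u, forall v, v \in S -> adj G x v -> v = u.
Proof.
move=> h; case: (pickP (fun v => (v \in S) && adj G x v)) => [u /andP[uS xu]|none].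
  exists u => v vS xv; apply/eqP/negPn/negP => vu.
  by move: h; rewrite /inner_deg (bigD1 u)//= (bigD1 v) ?vS//= xu xv.
by exists x => v vS xv; have := none v; rewrite vS xv.
Qed.

Definition locally_sparse (V : finType) (G : ograph V) (S : {set V}) : bool :=
  5 * inner_arcs G S < 6 * #|S|.

(** If all degrees are at least 2 and the vertices of degree 2 form an independent
    set [D], then the rest [M] has degree sum at least [3 * #|M|], and at least
    [2 * #|D|] because it absorbs all arcs at [D]. Together these force
    [6/5 * #|S|] arcs. *)
Lemma sparse_reducible (V : finType) (G : ograph V) (S : {set V}) : locally_sparse G S ->
  (exists2 x, x \in S & inner_deg G S x <= 1) \/
  (exists x y, [/\ x \in S, y \in S, adj G x y, inner_deg G S x = 2 & inner_deg G S y = 2]).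
Proof.
rewrite /locally_sparse => sp.
have [/exists_inP[x xS hx]|/exists_inPn low] :=
  boolP [exists x in S, inner_deg G S x <= 1]; first by left; exists x.
have [/exists_inP[x xS /exists_inP[y yS /and3P[hxy /eqP hx /eqP hy]]]|none] :=
  boolP [exists x in S, [exists y in S, [&& adj G x y, inner_deg G S x == 2 & inner_deg G S y == 2]]].
  by right; exists x, y.
exfalso.
pose D := [set x in S | inner_deg G S x == 2]%SET.
pose M := [set x in S | inner_deg G S x != 2]%SET.
have splitS (f : V -> nat) : \sum_(x in S) f x = \sum_(x in D) f x + \sum_(x in M) f x.
  rewrite (bigID (fun x => inner_deg G S x == 2)) /=; congr (_ + _);
  by apply: eq_bigl => x; rewrite inE.
have sumD : \sum_(x in D) inner_deg G S x = 2 * #|D|.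
  rewrite (eq_bigr (fun=> 2)); first by rewrite sum_nat_const mulnC.
  by move=> x; rewrite inE => /andP[_ /eqP].
have sumM : 3 * #|M| <= \sum_(x in M) inner_deg G S x.
  rewrite mulnC -sum_nat_const; apply: leq_sum => x; rewrite inE => /andP[xS hx].
  by have := low x xS; lia.
have cross : \sum_(x in D) inner_deg G S x <= \sum_(x in M) inner_deg G S x.
  have -> : \sum_(x in D) inner_deg G S x = \sum_(x in D) \sum_(y in M) adj G x y.
    apply: eq_bigr => x xD; rewrite /inner_deg splitS big1 ?add0n// => y yD.
    apply/eqP; rewrite eqb0; apply/negP => xy.
    move/negP: none; apply; move: xD yD; rewrite !inE => /andP[xS hx] /andP[yS hy].
    by apply/exists_inP; exists x => //; apply/exists_inP; exists y => //; rewrite xy hx hy.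
  rewrite exchange_big /=; apply: leq_sum => y _.
  rewrite /inner_deg splitS; apply: leq_trans (leq_addr _ _).
  by apply: leq_sum => x _; rewrite adjC.
have cS : #|S| = #|D| + #|M| by rewrite -!sum1_card splitS.
have tot := sum_inner_deg G S; rewrite splitS sumD in tot.
lia.
Qed.

(** Induction on the number of vertices, removing the configuration given by
    [sparse_reducible]: a vertex of degree at most 1, or two adjacent vertices of
    degree 2, which form the middle of a walk of length 3 between their outer
    neighbours, so that [qr7_path] extends the map. *)
Lemma sparse_hom_qr7 (V : finType) (G : ograph V) (S : {set V}) :
  (forall S' : {set V}, S' \subset S -> S' != finset.set0 -> locally_sparse G S') ->
  exists f : V -> 'I_7, forall x y, x \in S -> y \in S -> arc G x y -> qr7 (f x) (f y).
Proof.
have [m] := ubnP #|S|; elim: m S => // m IH S Sm sp.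
have [->|S0] := eqVneq S finset.set0; first by exists (fun=> ord0) => x y; rewrite inE.
have := sparse_reducible (sp S (subxx _) S0).
have ok (S' : {set V}) (f : V -> 'I_7) x u b a :
  (forall v, v \in S' -> adj G x v -> v = u) -> b = arc G x u ->
  oriented_as qr7 b a (f u) -> forall v, v \in S' ->
  (arc G x v -> qr7 a (f v)) /\ (arc G v x -> qr7 (f v) a).
  move=> hu -> ha v vS'; split=> xv.
    have e : v = u by apply: hu => //; rewrite /adj xv.
    by move: ha; rewrite -e xv.
  have e : v = u by apply: hu => //; rewrite /adj xv orbT.
  by move: ha; rewrite -e (negbTE (arc_asym xv)).
case=> [[x xS dx]|[x [y [xS yS xy dx dy]]]].
  have [|S' sS' S'0|f fP] := IH (S :\ x).
  - by move: Sm; rewrite (cardsD1 x S) xS; lia.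
  - by apply: sp => //; apply: fintype.subset_trans sS' (finset.subD1set _ _).
  have [u hu] := inner_deg_le1 dx.
  have [a [_ [ha _ _]]] := qr7_path (f u) ord0 (arc G x u) true true.
  exists (fun z => if z == x then a else f z) => v w vS wS vw.
  have := @ok S f x u _ a hu erefl ha.
  case: (eqVneq v x) vw => [->|vx] vw; case: (eqVneq w x) vw => [->|wx] vw h.
  - by rewrite arc_irr in vw.
  - by case: (h w wS) => + _; apply.
  - by case: (h v vS) => _; apply.
  - by apply: fP => //; rewrite !inE ?vx ?wx.
have xney : x != y by apply/eqP => e; move: xy; rewrite e /adj arc_irr.
have [|S' sS' S'0|f fP] := IH (S :\ x :\ y).
- have := subset_leq_card (finset.subD1set (S :\ x) y).
  by move: Sm; rewrite (cardsD1 x S) xS; lia.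
- apply: sp => //; apply: fintype.subset_trans sS' _.
  by apply: fintype.subset_trans (finset.subD1set _ _) (finset.subD1set _ _).
pose S1 := (S :\ x :\ y)%SET.
have degS1 p q : p \in S -> q \in S -> p != q -> adj G p q -> inner_deg G S p = 2 ->
    inner_deg G (S :\ p :\ q) p <= 1.
  move=> pS qS pq apq; rewrite /inner_deg (big_setD1 p)//= (big_setD1 q) /=; last first.
    by rewrite !inE eq_sym pq.
  by rewrite apq /adj arc_irr /=; lia.
have [u hu] := inner_deg_le1 (degS1 x y xS yS xney xy dx).
have [w hw] : exists w, forall v, v \in S1 -> adj G y v -> v = w.
  rewrite adjC in xy; rewrite eq_sym in xney.
  have [w hw] := inner_deg_le1 (degS1 y x yS xS xney xy dy).
  by exists w => v vS1; apply: hw; move: vS1; rewrite !inE andbCA.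
have [a [b [ha hb hab]]] := qr7_path (f u) (f w) (arc G x u) (arc G y w) (arc G x y).
exists (fun z => if z == x then a else if z == y then b else f z) => s t sS tS st.
have hx := @ok S1 f x u _ a hu erefl ha.
have hy := @ok S1 f y w _ b hw erefl hb.
have inS1 z : z \in S -> z != x -> z != y -> z \in S1 by move=> zS zx zy; rewrite !inE zx zy.
have yx : (y == x) = false by rewrite eq_sym; exact: negbTE.
case: (eqVneq s x) st => [->|sx] st; case: (eqVneq t x) st => [->|tx] st.
- by rewrite arc_irr in st.
- case: (eqVneq t y) st => [->|ty] st; first by move: hab; rewrite st.
  by case: (hx t (inS1 t tS tx ty)) => + _; apply.
- case: (eqVneq s y) st => [->|sy] st.
    by move: hab; rewrite (negbTE (arc_asym st)).
  by case: (hx s (inS1 s sS sx sy)) => _; apply.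
- case: (eqVneq s y) st => [->|sy] st; case: (eqVneq t y) st => [->|ty] st.
  + by rewrite arc_irr in st.
  + by case: (hy t (inS1 t tS tx ty)) => + _; apply.
  + by case: (hy s (inS1 s sS sx sy)) => _; apply.
  + by apply: fP => //; exact: inS1.
Qed.

(** Take [S] of maximal size among the sets that contain [U] and have at least
    [2 * (#|S| - #|U|)] arcs, the bound that results from adding vertices with two
    neighbours in the set. Sparsity gives [#|S| < 5/2 * #|U|], so adding one more
    such vertex would not leave the range of sizes. *)
Lemma sparse_closure (V : finType) (G : ograph V) (U : {set V}) (m : nat) :
  3 * #|U| <= m ->
  (forall S : {set V}, S != finset.set0 -> #|S| <= m -> locally_sparse G S) ->
  exists S : {set V}, [/\ U \subset S, #|S| <= m &
    forall v, v \notin S -> inner_deg G S v <= 1].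
Proof.
move=> Um sp.
pose P (S : {set V}) := [&& U \subset S, #|S| <= m & 2 * (#|S| - #|U|) <= inner_arcs G S].
have PU : P U by rewrite /P subxx subnn muln0 /= andbT; lia.
case: (arg_maxnP (fun S : {set V} => #|S|) PU) => S /and3P[US Sm eS] maxS.
exists S; split => // v vS; rewrite leqNgt; apply/negP => dv.
have S0 : S != finset.set0.
  apply/eqP => e; move: dv; rewrite e /inner_deg big_set0//.
have := sp S S0 Sm; rewrite /locally_sparse => spS.
have UleS := subset_leq_card US.
have cv : #|v |: S| = #|S|.+1 by rewrite cardsU1 vS.
have : P (v |: S).
  rewrite /P cv inner_arcs_add// (fintype.subset_trans US (finset.subsetUr _ _)) /=.
  by apply/andP; split; lia.
by move=> /maxS; rewrite cv; lia.
Qed.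

Lemma ocolorable_of_hom (V W : finType) (G : ograph V) (r : rel W) (f : V -> W) :
  irreflexive r -> (forall x y, r x y -> ~~ r y x) ->
  (forall x y, arc G x y -> r (f x) (f y)) -> ocolorable G #|W|.
Proof.
move=> rirr rasym fP.
pose t (x y : 'I_#|W|) :=
  let gx := enum_val x in let gy := enum_val y in
  r gx gy || (~~ r gy gx && (x < y)%N).
pose E := [set e : 'I_#|W| * 'I_#|W| | t e.1 e.2]%SET.
have hE : oriented E.
  apply/andP; split; apply/forallP => x.
    by rewrite inE /t /= rirr ltnn.
  apply/forallP => y; apply/implyP; rewrite !inE /t /=.
  case/orP => [h|/andP[h xy]].
    by rewrite h (negbTE (rasym _ _ h)).
  by rewrite (negbTE h) /= negb_and -leqNgt (ltnW xy) orbT.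
apply/existsP; exists (OGraph hE); apply/andP; split.
  apply/forallP => x; apply/forallP => y; apply/implyP => xy.
  rewrite /arc /= !inE /t /=.
  case: (r (enum_val x) (enum_val y)) => //=.
  by case: (r (enum_val y) (enum_val x)) => //=; rewrite -neq_ltn.
apply/existsP; exists [ffun x => enum_rank (f x)].
apply/forallP => x; apply/forallP => y; apply/implyP => xy.
by rewrite /arc !ffunE inE /t /= !enum_rankK fP.
Qed.

(** Two copies of [T] and a Paley tournament: the copy [true] of [T] has all its arcs
    towards the Paley part, the copy [false] from it. *)
Definition blowup (k : nat) (T : ograph 'I_k) : rel ('I_k * bool + 'I_7) :=
  fun a b => match a, b with
  | inl c, inl c' => arc T c.1 c'.1
  | inl c, inr _ => c.2
  | inr _, inl c => ~~ c.2
  | inr q, inr q' => qr7 q q'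
  end.

(** A vertex outside [S] has at most one neighbour in [S], so it can be put in the
    copy of [T] that fits the direction of this single arc, whatever the colour
    of the neighbour is. *)
Lemma chi_o_le_of_split (V : finType) (G : ograph V) (k : nat) (T : ograph 'I_k)
    (S : {set V}) (f : V -> 'I_k) (g : V -> 'I_7) :
  (forall v, v \notin S -> inner_deg G S v <= 1) ->
  (forall x y, x \notin S -> y \notin S -> arc G x y -> arc T (f x) (f y)) ->
  (forall x y, x \in S -> y \in S -> arc G x y -> qr7 (g x) (g y)) ->
  chi_o G <= 2 * k + 7.
Proof.
move=> deg fP gP.
pose out x := [exists y in S, arc G x y].
pose h x := if x \in S then inr (g x) else inl (f x, out x).
have : ocolorable G #|{: ('I_k * bool + 'I_7)%type}|.
  apply: (@ocolorable_of_hom _ _ _ (blowup T) h).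
  - by case=> [[c i]|q] /=; rewrite ?arc_irr ?qr7_irr.
  - move=> [[c i]|q] [[c' i']|q'] //=; [exact: arc_asym| by rewrite negbK | exact: qr7_asym].
  move=> x y xy; rewrite /h; case: (boolP (x \in S)) => xS; case: (boolP (y \in S)) => yS /=.
  - exact: gP.
  - apply/negP => /exists_inP[z zS yz].
    have [u hu] := inner_deg_le1 (deg y yS).
    have ez : z = u by apply: hu => //; rewrite /adj yz.
    have ex : x = u by apply: hu => //; rewrite /adj xy orbT.
    by move: (arc_asym xy); rewrite ex -ez yz.
  - by apply/exists_inP; exists y.
  - exact: fP.
rewrite card_sum card_prod !card_ord card_bool /chi_o mulnC.
by case: ex_minnP => j _ jmin; exact: jmin.
Qed.

Local Open Scope ring_scope.

(** * The defect *)

(** The first alternative makes the definition meaningful when [W] is empty. *)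
Definition colorable_off (V W : finType) (G : ograph V) (T : ograph W) (U : {set V}) : bool :=
  (U == [set: V]%SET) || [exists f : {ffun V -> W}, [forall x, forall y,
     [&& x \notin U, y \notin U & arc G x y] ==> arc T (f x) (f y)]].

Lemma defect_subproof (V W : finType) (G : ograph V) (T : ograph W) :
  exists m, [exists U : {set V}, (#|U| <= m)%N && colorable_off G T U].
Proof.
exists #|[set: V]%SET|; apply/existsP; exists [set: V]%SET.
by rewrite leqnn /colorable_off eqxx.
Qed.

(** The least number of vertices whose removal leaves a graph with a homomorphism
    to [T]. *)
Definition defect (V W : finType) (G : ograph V) (T : ograph W) : nat :=
  ex_minn (defect_subproof G T).

Lemma defectP (V W : finType) (G : ograph V) (T : ograph W) :
  exists2 U : {set V}, (#|U| <= defect G T)%N & colorable_off G T U.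
Proof.
by rewrite /defect; case: ex_minnP => m /existsP[U /andP[h1 h2]] _; exists U.
Qed.

Lemma defect_le (V W : finType) (G : ograph V) (T : ograph W) (U : {set V}) :
  colorable_off G T U -> (defect G T <= #|U|)%N.
Proof.
move=> h; rewrite /defect; case: ex_minnP => m _; apply.
by apply/existsP; exists U; rewrite leqnn.
Qed.

Lemma defect_hom (V W : finType) (G : ograph V) (T : ograph W) (f : {ffun V -> W}) :
  is_hom G T f -> defect G T = 0%N.
Proof.
move=> /forallP h; apply/eqP; rewrite -leqn0 -[X in (_ <= X)%N](cards0 V); apply: defect_le.
apply/orP; right; apply/existsP; exists f; apply/forallP => x; apply/forallP => y.
by apply/implyP => /and3P[_ _]; exact: (implyP (forallP (h x) y)).
Qed.

Lemma defect_lipschitz (V W : finType) (G G' : ograph V) (T : ograph W) (v : V) :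
  (forall x y, x != v -> y != v -> arc G x y = arc G' x y) ->
  (defect G T <= (defect G' T).+1)%N.
Proof.
move=> h; have [U hU cU] := defectP G' T.
apply: (@leq_trans #|v |: U|); last first.
  by rewrite cardsU1 -add1n leq_add// leq_b1.
apply: defect_le; case/orP: cU => [/eqP ->|/existsP[f /forallP fP]]; apply/orP.
  by left; rewrite finset.setUT.
right; apply/existsP; exists f; apply/forallP => x; apply/forallP => y; apply/implyP.
rewrite !inE !negb_or => /and3P[/andP[xv xU] /andP[yv yU]].
rewrite h// => xy; exact: (implyP (forallP (fP x) y) (introT and3P (And3 xU yU xy))).
Qed.

Lemma chi_o_le_of_defect (V : finType) (G : ograph V) (k m : nat) (T : ograph 'I_k) :
  (3 * defect G T <= m)%N -> (m < #|V|)%N ->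
  (forall S : {set V}, S != finset.set0 -> (#|S| <= m)%N -> locally_sparse G S) ->
  (chi_o G <= 2 * k + 7)%N.
Proof.
move=> dm mV sp; have [U hU cU] := defectP G T.
have Um : (3 * #|U| <= m)%N by apply: leq_trans dm; rewrite leq_mul2l.
case/orP: cU => [/eqP UT|/existsP[f /forallP fP]].
  by move: mV; rewrite ltnNge -cardsT -UT (leq_trans _ Um)// leq_pmull.
have [S [US Sm deg]] := sparse_closure Um sp.
have [g gP] : exists g : V -> 'I_7, forall x y, x \in S -> y \in S -> arc G x y -> qr7 (g x) (g y).
  apply: sparse_hom_qr7 => S' sS' S'0; apply: sp => //.
  exact: leq_trans (subset_leq_card sS') Sm.
apply: (chi_o_le_of_split (T := T) (S := S) (f := f) (g := g)) => // x y xS yS xy.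
apply: (implyP (forallP (fP x) y)); rewrite xy andbT.
by rewrite !(contra (fintype.subsetP US _)).
Qed.

Lemma defect_tail (R : realType) n k (p t r : R) (T : ograph 'I_k) :
  0 <= p < 1 -> 0 <= t ->
  Gnp_prob p (fun G : ograph 'I_n => r <= (defect G T)%:R) *
  Gnp_prob p (fun G : ograph 'I_n => defect G T == 0%N) <=
  expR (p * n%:R ^+ 2 / 2 * (expR t - 1) ^+ 2 - t * r).
Proof.
move=> p01 t0; have p01' : 0 <= p <= 1 by lra.
pose F (G : ograph 'I_n) : R := expR (t * (defect G T)%:R).
have key := @Gnp_exp_inv_le R n p (expR t) F p01.
have {}key : Gnp_exp p F * Gnp_exp p (fun G => (F G)^-1) <=
    expR (p * n%:R ^+ 2 / 2 * (expR t - 1) ^+ 2).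
  apply: key => [|G|G G' v h].
  - by rewrite -expR0 ler_expR.
  - exact: expR_gt0.
  - rewrite /F -expRD ler_expR -[X in X + _]mulr1 -mulrDr; apply: ler_wpM2l => //.
    by have := defect_lipschitz T h; rewrite -(ler_nat R) -natr1 addrC.
rewrite expRB ler_pdivlMr ?expR_gt0//.
apply: le_trans key.
rewrite mulrAC [X in X * _]mulrC; apply: ler_pM.
- by apply: mulr_ge0; [exact: expR_ge0|rewrite Gnp_probE; apply: Gnp_exp_ge0].
- by rewrite Gnp_probE; apply: Gnp_exp_ge0.
- rewrite Gnp_probE -Gnp_expZ; apply: Gnp_exp_le => // G.
  case: (boolP (r <= _)) => h; rewrite ?mulr0 ?expR_ge0// mulr1 ler_expR.
  exact: ler_wpM2l.
- rewrite Gnp_probE; apply: Gnp_exp_le => // G; rewrite /F.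
  by case: eqP => [->|_]; rewrite ?mulr0 ?expR0 ?invr1// invr_ge0 expR_ge0.
Qed.

(** * Overlap of two colourings *)

Definition class_size (R : realType) n k (s : {ffun 'I_n -> 'I_k}) (i : 'I_k) : R :=
  \sum_x (s x == i)%:R.

Definition overlap (R : realType) n k (s t : {ffun 'I_n -> 'I_k}) : 'M[R]_k :=
  \matrix_(i, j) \sum_x ((s x == i) && (t x == j))%:R.

Lemma sum_pick (R : realType) (I : finType) (a : I) (g : I -> R) :
  \sum_i (a == i)%:R * g i = g a.
Proof.
rewrite (bigD1 a)//= eqxx mul1r big1 ?addr0// => i ia.
by rewrite eq_sym (negbTE ia) mul0r.
Qed.

Lemma class_sum (R : realType) n k (s : {ffun 'I_n -> 'I_k}) (g : 'I_k -> R) :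
  \sum_i class_size R s i * g i = \sum_x g (s x).
Proof.
under eq_bigr do rewrite mulr_suml.
by rewrite exchange_big /=; apply: eq_bigr => x _; rewrite sum_pick.
Qed.

Lemma overlap_sum (R : realType) n k (s t : {ffun 'I_n -> 'I_k}) (g : 'I_k -> 'I_k -> R) :
  \sum_i \sum_j overlap R s t i j * g i j = \sum_x g (s x) (t x).
Proof.
transitivity (\sum_i \sum_x (s x == i)%:R * g i (t x)).
  apply: eq_bigr => i _.
  under eq_bigr do rewrite mxE mulr_suml.
  rewrite exchange_big /=; apply: eq_bigr => x _.
  under eq_bigr do rewrite -mulnb natrM -mulrA.
  by rewrite -mulr_sumr (sum_pick (t x) (g i)).
rewrite exchange_big /=; apply: eq_bigr => x _.
exact: (sum_pick (s x) (fun i => g i (t x))).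
Qed.

Lemma overlap_row (R : realType) n k (s t : {ffun 'I_n -> 'I_k}) i :
  \sum_j overlap R s t i j = class_size R s i.
Proof.
under eq_bigr do rewrite mxE.
rewrite exchange_big /=; apply: eq_bigr => x _.
under eq_bigr do rewrite -mulnb natrM.
rewrite -mulr_sumr -[RHS]mulr1; congr (_ * _).
by rewrite -[RHS](sum_pick (t x) (fun=> 1)); apply: eq_bigr => j _; rewrite mulr1.
Qed.

Lemma class_total (R : realType) n k (s : {ffun 'I_n -> 'I_k}) :
  \sum_i class_size R s i = n%:R.
Proof.
transitivity (\sum_i class_size R s i * 1); first by apply: eq_bigr => i _; rewrite mulr1.
by rewrite class_sum sumr_const card_ord.
Qed.

Lemma class_size_ge0 (R : realType) n k (s : {ffun 'I_n -> 'I_k}) i : 0 <= class_size R s i.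
Proof. by apply: sumr_ge0. Qed.

Lemma overlap_ge0 (R : realType) n k (s t : {ffun 'I_n -> 'I_k}) i j : 0 <= overlap R s t i j.
Proof. by rewrite mxE; apply: sumr_ge0. Qed.

Lemma class_size_gt0 (R : realType) n k (s : {ffun 'I_n -> 'I_k}) x :
  0 < class_size R s (s x).
Proof.
by rewrite /class_size (bigD1 x)//= eqxx ltr_pwDl// sumr_ge0.
Qed.

Lemma overlap_gt0 (R : realType) n k (s t : {ffun 'I_n -> 'I_k}) x :
  0 < overlap R s t (s x) (t x).
Proof.
by rewrite mxE (bigD1 x)//= !eqxx ltr_pwDl// sumr_ge0.
Qed.

Lemma overlap_le (R : realType) n k (s t : {ffun 'I_n -> 'I_k}) i j :
  overlap R s t i j <= class_size R s i.
Proof. by rewrite -(overlap_row R s t) (bigD1 j)//= lerDl sumr_ge0// => *; exact: overlap_ge0. Qed.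

Lemma overlap_arcs (R : realType) n k (T : ograph 'I_k) (s t : {ffun 'I_n -> 'I_k}) :
  \sum_x \sum_y (arc T (s x) (s y) && arc T (t x) (t y))%:R =
  mxdot (overlap R s t) (adj_mx R T *m overlap R s t *m (adj_mx R T)^T).
Proof.
rewrite mxdotE (overlap_sum s t (fun i j => (adj_mx R T *m overlap R s t *m (adj_mx R T)^T) i j)).
apply: eq_bigr => x _; rewrite mxE.
transitivity (\sum_i' \sum_j' overlap R s t i' j' * ((arc T (s x) i')%:R * (arc T (t x) j')%:R) : R).
  rewrite (overlap_sum s t (fun i' j' => (arc T (s x) i')%:R * (arc T (t x) j')%:R)).
  by apply: eq_bigr => y _; rewrite -natrM mulnb.
rewrite exchange_big /=; apply: eq_bigr => j' _.
rewrite [X in _ = X * _]mxE mulr_suml; apply: eq_bigr => i' _.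
by rewrite !mxE; ring.
Qed.

(** The squared distance of the overlap matrix from the matrix of its row means. *)
Definition row_excess (R : realType) n k (s t : {ffun 'I_n -> 'I_k}) : R :=
  \sum_i (\sum_j overlap R s t i j ^+ 2 - class_size R s i ^+ 2 / k%:R).

Lemma overlap_arcs_le (R : realType) n k (T : ograph 'I_k) (s t : {ffun 'I_n -> 'I_k}) :
  (0 < k)%N -> doubly_regular T ->
  \sum_x \sum_y (arc T (s x) (s y) && arc T (t x) (t y))%:R <=
  (k%:R - 1) ^+ 2 / (4 * k%:R ^+ 2) * n%:R ^+ 2 + (k%:R + 1) / 4 * row_excess R s t.
Proof.
move=> k0 dT; rewrite overlap_arcs; apply: le_trans (drt_form_le _ k0 dT) _.
under eq_bigr do rewrite overlap_row.
rewrite class_total lerD2l; apply: ler_wpM2l.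
  by rewrite divr_ge0// addr_ge0.
rewrite mxdotE -sumrB; apply: ler_sum => i _.
by under eq_bigr do rewrite -expr2; rewrite overlap_row.
Qed.

Lemma row_term_ge0 (R : realType) n k (s t : {ffun 'I_n -> 'I_k}) (i : 'I_k) :
  0 <= \sum_j overlap R s t i j ^+ 2 - class_size R s i ^+ 2 / k%:R.
Proof.
have k0 : (0 < k)%N by case: k i {s t} => // -[].
by rewrite subr_ge0 -(overlap_row R s t); exact: sqr_sum_le.
Qed.

Lemma row_excess_ge0 (R : realType) n k (s t : {ffun 'I_n -> 'I_k}) : 0 <= row_excess R s t.
Proof. by apply: sumr_ge0 => i _; exact: row_term_ge0. Qed.

(** [n] times the relative entropy of the second colour of a random vertex, given
    its first colour, with respect to the uniform law. *)
Definition log_lift (R : realType) n k (s t : {ffun 'I_n -> 'I_k}) : R :=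
  \sum_x ln (k%:R * (overlap R s t (s x) (t x) / class_size R s (s x))).

(** [entropy_deficit_ge] in every row, the row of colour [i] having weight
    [class_size R s i <= b]. *)
Lemma row_excess_le (R : realType) n k (s t : {ffun 'I_n -> 'I_k}) (b : R) :
  (3 <= k)%N -> 0 <= b -> (forall i, class_size R s i <= b) ->
  row_cst k%:R * row_excess R s t <= b * log_lift R s t.
Proof.
move=> k3 b0 sb.
have K3 : 3 <= k%:R :> R by rewrite ler_nat.
have C0 := row_cst_gt0 K3.
rewrite /log_lift -(overlap_sum s t (fun i j => ln (k%:R * (overlap R s t i j / class_size R s i)))).
rewrite /row_excess !mulr_sumr; apply: ler_sum => i _.
set c := class_size R s i.
have c0 : 0 <= c := class_size_ge0 R s i.
have W0 := row_term_ge0 R s t i; rewrite -/c in W0.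
move: c0; rewrite le_eqVlt => /predU1P[c0|c0].
  have z j : overlap R s t i j = 0.
    by apply/eqP; rewrite eq_le overlap_ge0 andbT c0 overlap_le.
  rewrite !big1 ?mulr0 ?subr0 -?c0 ?expr0n ?mul0r ?subr0 ?mulr0// => j _;
    by rewrite z ?mul0r// expr0n.
have r1 : \sum_j overlap R s t i j / c = 1.
  by rewrite -mulr_suml overlap_row divff// gt_eqF.
have r0 j : 0 <= overlap R s t i j / c by rewrite divr_ge0 ?overlap_ge0// ltW.
have := entropy_deficit_ge k3 r0 r1.
set L := \sum_j _ * ln _; set C := row_cst _ in C0 *.
have eL : \sum_j overlap R s t i j * ln (k%:R * (overlap R s t i j / c)) = c * L.
  by rewrite /L mulr_sumr; apply: eq_bigr => j _; field; lra.
rewrite eL.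
have eW : \sum_j (overlap R s t i j / c) ^+ 2 - k%:R^-1 =
  (\sum_j overlap R s t i j ^+ 2 - c ^+ 2 / k%:R) / c ^+ 2.
  rewrite mulrBl mulr_suml; congr (_ - _); last by field; lra.
  by apply: eq_bigr => j _; rewrite exprMn exprVn.
rewrite eW; set W := _ - _ in W0 *; rewrite mulrA ler_pdivrMr ?exprn_gt0// => h.
apply: (le_trans h).
have cb : c <= b := sb i.
have L0 : 0 <= L.
  have : 0 <= L * c ^+ 2 by apply: le_trans h; rewrite mulr_ge0// ltW.
  by rewrite pmulr_lge0// exprn_gt0.
rewrite (_ : L * c ^+ 2 = c * (c * L)); last by ring.
by apply: ler_wpM2r => //; rewrite mulr_ge0// ltW.
Qed.

Lemma expR_log_lift (R : realType) n k (s t : {ffun 'I_n -> 'I_k}) :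
  (0 < k)%N ->
  expR (log_lift R s t) =
  k%:R ^+ n * \prod_x (overlap R s t (s x) (t x) / class_size R s (s x)).
Proof.
move=> k0; have K0 : 0 < k%:R :> R by rewrite ltr0n.
rewrite /log_lift expR_sum.
have -> : k%:R ^+ n = \prod_(x < n) k%:R :> R by rewrite prodr_const card_ord.
rewrite -big_split /=; apply: eq_bigr => x _.
by rewrite lnK// posrE mulr_gt0// divr_gt0// ?overlap_gt0 ?class_size_gt0.
Qed.

Lemma log_lift_le (R : realType) n k (s t : {ffun 'I_n -> 'I_k}) :
  (0 < k)%N -> log_lift R s t <= n%:R * ln k%:R.
Proof.
move=> k0; have K0 : 0 < k%:R :> R by rewrite ltr0n.
have -> : n%:R * ln k%:R = \sum_(x < n) ln k%:R :> R by rewrite sumr_const card_ord mulr_natl.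
apply: ler_sum => x _.
have o0 := overlap_gt0 R s t x; have c0 := class_size_gt0 R s x.
rewrite ler_ln ?posrE//; last by apply: mulr_gt0 => //; exact: divr_gt0.
by rewrite ler_piMr ?(ltW K0)// ler_pdivrMr// mul1r overlap_le.
Qed.

(** The method of types: for each of the at most [n.+1 ^ (k * k)] possible overlap
    matrices [c], the terms of the colourings [t] with overlap [c] are
    probabilities of distinct outcomes of [n] independent choices, the colour of
    [x] being [j] with probability [c (s x, j)] over the size of the class of [x]. *)
Lemma sum_conditional_types (R : realType) n k (s : {ffun 'I_n -> 'I_k}) :
  \sum_(t : {ffun 'I_n -> 'I_k}) \prod_x (overlap R s t (s x) (t x) / class_size R s (s x)) <=
  n.+1%:R ^+ (k * k).
Proof.
pose cnt (t : {ffun 'I_n -> 'I_k}) (i j : 'I_k) : nat := (\sum_x ((s x == i) && (t x == j)))%N.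
have cntE t i j : overlap R s t i j = (cnt t i j)%:R by rewrite mxE /cnt natr_sum.
have cntn t i j : (cnt t i j < n.+1)%N.
  by rewrite ltnS -[X in (_ <= X)%N]card_ord -sum1_card leq_sum// => x _; exact: leq_b1.
pose ty (t : {ffun 'I_n -> 'I_k}) : {ffun 'I_k * 'I_k -> 'I_n.+1} :=
  [ffun ij => inord (cnt t ij.1 ij.2)].
have tyE t i j : overlap R s t i j = (ty t (i, j))%:R by rewrite cntE ffunE inordK.
rewrite (partition_big ty xpredT)//=.
apply: (@le_trans _ _ (\sum_(c : {ffun 'I_k * 'I_k -> 'I_n.+1}) 1)); last first.
  by rewrite sumr_const -natrX ler_nat card_ffun card_prod !card_ord.
apply: ler_sum => c _.
have [/existsP[t0 /eqP t0c]|none] := boolP [exists t, ty t == c]; last first.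
  rewrite big_pred0// => t; apply/negbTE; move: none; rewrite negb_exists.
  by move=> /forallP/(_ t).
apply: (@le_trans _ _ (\sum_(t : {ffun 'I_n -> 'I_k})
    \prod_x ((c (s x, t x))%:R / class_size R s (s x)))).
  rewrite [X in _ <= X](bigID (fun t => ty t == c)) /=.
  rewrite (eq_bigr (fun t : {ffun 'I_n -> 'I_k} => \prod_x ((c (s x, t x))%:R / class_size R s (s x)))).
    rewrite lerDl sumr_ge0// => t _; apply: prodr_ge0 => x _.
    by rewrite divr_ge0 ?class_size_ge0.
  by move=> t /eqP tc; apply: eq_bigr => x _; rewrite tyE tc.
have := bigA_distr_bigA (fun (x : 'I_n) (j : 'I_k) => (c (s x, j))%:R / class_size R s (s x)).
move=> /= <-.
rewrite big1// => x _.
rewrite -mulr_suml (eq_bigr (fun j => overlap R s t0 (s x) j)); last first.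
  by move=> j _; rewrite tyE t0c.
by rewrite overlap_row divff// gt_eqF// class_size_gt0.
Qed.

(** * Weighted homomorphism counts *)

Lemma expR_le_quad (R : realType) (s : R) : 0 <= s <= 1 / 2 -> expR s <= 1 + s + 2 * s ^+ 2.
Proof.
move=> /andP[s0 s1]; have h := expR_ge1Dx (- s).
rewrite -[X in expR X]opprK expRN.
apply: (@le_trans _ _ (1 - s)^-1).
  by rewrite lef_pV2 ?posrE ?expR_gt0//; lra.
rewrite -[_^-1]mul1r ler_pdivrMr; last lra.
have : 0 <= s ^+ 2 * (1 - 2 * s) by rewrite mulr_ge0 ?sqr_ge0//; lra.
by rewrite !expr2; lra.
Qed.

Lemma prod_arcs_pred (R : realType) n (G : ograph 'I_n) (y : R) (A : rel 'I_n) :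
  \prod_(e : 'I_n * 'I_n | arc G e.1 e.2) (y * (A e.1 e.2)%:R) =
  y ^+ #|arcs G| * [forall x, forall z, arc G x z ==> A x z]%:R.
Proof.
rewrite big_split /= prodr_const; congr (_ * _).
  by congr (_ ^+ _); apply: eq_card => -[x z]; rewrite /in_mem.
case: (boolP [forall x, _]) => [/forallP h|].
  by rewrite big1// => e xz; rewrite (implyP (forallP (h e.1) e.2) xz).
rewrite negb_forall => /existsP[x]; rewrite negb_forall => /existsP[z].
rewrite negb_imply => /andP[xz /negbTE nA].
by rewrite (bigD1 (x, z))//= nA mul0r.
Qed.

Section Moments.
Variables (R : realType) (n k : nat) (T : ograph 'I_k) (p : R).
Implicit Types (s t : {ffun 'I_n -> 'I_k}) (G : ograph 'I_n).
Local Notation K := (k%:R : R).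
Local Notation N := (n%:R : R).

(** Weighting a homomorphism by [y] to the number of arcs: for [y = z] below, the
    inverse of the probability that an arc is respected, the conditional
    expectation given the number of arcs hardly depends on that number. *)
Definition hom_weight (y : R) s G : R := (is_hom G T s)%:R * y ^+ #|arcs G|.

Lemma hom_weightE y s G : hom_weight y s G =
  \prod_(e : 'I_n * 'I_n | arc G e.1 e.2) (y * (arc T (s e.1) (s e.2))%:R).
Proof. by rewrite (prod_arcs_pred G y (fun x z => arc T (s x) (s z))) mulrC. Qed.

Lemma hom_pairs s : tournament T ->
  \sum_x \sum_y (arc T (s x) (s y))%:R = (N ^+ 2 - \sum_i class_size R s i ^+ 2) / 2.
Proof.
move=> tT; set S := \sum_x _.
have e2 : \sum_(x < n) \sum_(y < n) (1 - (s x == s y)%:R) = S + S :> R.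
  have eS : S = \sum_x \sum_y (arc T (s y) (s x))%:R by exact: exchange_big.
  rewrite {2}eS /S -big_split /=; apply: eq_bigr => x _.
  rewrite -big_split /=; apply: eq_bigr => y _.
  have [->|xy] := eqVneq (s x) (s y); first by rewrite arc_irr subrr addr0.
  have /orP[h|h] := implyP (forallP (forallP tT (s x)) (s y)) xy.
    by rewrite h (negbTE (arc_asym h)) subr0 addr0.
  by rewrite h (negbTE (arc_asym h)) subr0 add0r.
have e1 : \sum_(x < n) \sum_(y < n) (1 - (s x == s y)%:R) =
    N ^+ 2 - \sum_i class_size R s i ^+ 2 :> R.
  transitivity (\sum_(x < n) (N - class_size R s (s x))).
    apply: eq_bigr => x _; rewrite sumrB sumr_const card_ord; congr (_ - _).
    by apply: eq_bigr => y _; rewrite eq_sym.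
  rewrite sumrB sumr_const card_ord -[N *+ n]mulr_natr -expr2; congr (_ - _).
  rewrite -(class_sum s (fun i => class_size R s i)).
  by apply: eq_bigr => i _; rewrite expr2.
by rewrite -e1 e2; field.
Qed.

Lemma class_sqr_le s (b : R) : (forall i, class_size R s i <= b) ->
  \sum_i class_size R s i ^+ 2 <= b * N.
Proof.
move=> sb; rewrite -(class_total R s) mulr_sumr; apply: ler_sum => i _.
by rewrite expr2; apply: ler_wpM2r => //; exact: class_size_ge0.
Qed.

Lemma class_sqr_ge s : (0 < k)%N -> N ^+ 2 / K <= \sum_i class_size R s i ^+ 2.
Proof.
by move=> k0; rewrite -(class_total R s); exact: sqr_sum_le.
Qed.

Let z : R := 2 * K / (K - 1).

(** A colouring respects at most a proportion [1 / z] of all ordered pairs, and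
    the balanced ones attain it. *)
Lemma hom_weight_exp_le (y : R) s : (1 < k)%N -> tournament T -> 0 <= p <= 1 -> 0 <= y ->
  Gnp_exp p (hom_weight (z * y) s) <=
  expR (p * N / 2 * (N * (y - 1) + 1)).
Proof.
move=> k1 tT p01 y0; have /andP[p0 _] := p01.
have K1 : 1 < K by rewrite ltr1n.
have z0 : 0 <= z by rewrite /z divr_ge0; lra.
rewrite (eq_Gnp_exp _ (hom_weightE _ _)).
apply: le_trans (Gnp_exp_prod_le (a := fun x x' => z * y * (arc T (s x) (s x'))%:R) p01 _) _.
  by move=> x x'; apply: mulr_ge0 => //; exact: mulr_ge0.
rewrite ler_expR; under eq_bigr do rewrite -mulr_sumr.
rewrite -mulr_sumr hom_pairs//.
have := class_sqr_ge s (ltnW k1); set Q := \sum_i _ => hQ.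
have zQ : z * ((N ^+ 2 - Q) / 2) <= N ^+ 2.
  rewrite /z [X in X <= _](_ : _ = K * (N ^+ 2 - Q) / (K - 1)); last by field; lra.
  rewrite ler_pdivrMr; last lra.
  have : K * (N ^+ 2 / K) <= K * Q by apply: ler_wpM2l => //; lra.
  have -> : K * (N ^+ 2 / K) = N ^+ 2 by field; lra.
  lra.
have -> : p * N / 2 * (N * (y - 1) + 1) = p / 2 * (N ^+ 2 * y - N ^+ 2 + N) by ring.
apply: ler_wpM2l; first lra.
rewrite lerD2r lerD2r (_ : z * y * _ = z * ((N ^+ 2 - Q) / 2) * y); last by ring.
exact: ler_wpM2r.
Qed.

Lemma hom_weight_exp_ge (dl : R) s : (3 <= k)%N -> tournament T -> 0 <= p <= 1 / 2 ->
  0 <= dl -> (forall i, class_size R s i <= (K^-1 + dl) * N) ->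
  expR (- (p * N * dl * N + (p * N) ^+ 2)) <= Gnp_exp p (hom_weight z s).
Proof.
move=> k3 tT p01 dl0 sb; have /andP[p0 _] := p01.
have K3 : 3 <= K by rewrite ler_nat.
have z0 : 0 <= z <= 4.
  rewrite /z divr_ge0 /=; [|lra|lra].
  by rewrite ler_pdivrMr; lra.
rewrite (eq_Gnp_exp _ (hom_weightE _ _)).
apply: le_trans (Gnp_exp_prod_ge (a := fun x x' => z * (arc T (s x) (s x'))%:R) p01 _ _).
- rewrite ler_expR; under eq_bigr do rewrite -mulr_sumr.
  rewrite -mulr_sumr hom_pairs//.
  have := class_sqr_le sb; set Q := \sum_i _ => hQ.
  have zQ : N ^+ 2 - 2 * dl * N ^+ 2 <= z * ((N ^+ 2 - Q) / 2).
    rewrite /z [X in _ <= X](_ : _ = K * (N ^+ 2 - Q) / (K - 1)); last by field; lra.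
    rewrite ler_pdivlMr; last lra.
    have : K * Q <= K * ((K^-1 + dl) * N * N) by apply: ler_wpM2l => //; lra.
    have -> : K * ((K^-1 + dl) * N * N) = N ^+ 2 + K * dl * N ^+ 2 by field; lra.
    have : 0 <= dl * N ^+ 2 * (K - 2) by rewrite mulr_ge0 ?mulr_ge0 ?sqr_ge0//; lra.
    lra.
  have -> : - (p * N * dl * N + (p * N) ^+ 2) = p / 2 * (- (2 * dl * N ^+ 2)) - p ^+ 2 * N ^+ 2 by field.
  by rewrite lerD2r; apply: ler_wpM2l; lra.
- by move=> x; rewrite arc_irr mulr0.
- move=> x x'; case h: (arc T (s x) (s x')); first by rewrite (negbTE (arc_asym h)) mulr1 mulr0 addr0.
  case: (arc T (s x') (s x)); first by rewrite mulr0 mulr1 add0r.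
  by rewrite !mulr0 addr0 lexx /=.
Qed.

(** An exponential Markov inequality: it costs [expR w] per arc, which
    [hom_weight_exp_le] prices. *)
Lemma hom_weight_tail (mu w : R) s : (1 < k)%N -> tournament T -> 0 <= p <= 1 -> 0 <= w ->
  Gnp_exp p (fun G => hom_weight z s G * (mu < #|arcs G|%:R)%R%:R) <=
  expR (p * N / 2 * (N * (expR w - 1) + 1) - w * mu).
Proof.
move=> k1 tT p01 w0; rewrite expRB ler_pdivlMr ?expR_gt0//.
apply: le_trans (hom_weight_exp_le s k1 tT p01 (expR_ge0 w)).
rewrite mulrC -Gnp_expZ; apply: Gnp_exp_le => // G.
have K1 : 1 < K by rewrite ltr1n.
have z0 : 0 <= z by rewrite /z divr_ge0; lra.
have zw : (z * expR w) ^+ #|arcs G| = z ^+ #|arcs G| * expR (w * #|arcs G|%:R).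
  by rewrite expRM_natr -exprMn.
have h0 : 0 <= (is_hom G T s)%:R * z ^+ #|arcs G| by rewrite mulr_ge0// exprn_ge0.
rewrite /hom_weight zw [X in _ <= X]mulrA; set H := _ * z ^+ _ in h0 *.
case: (ltP mu _) => mu_arcs; last first.
  by rewrite !mulr0; apply: mulr_ge0 => //; exact: expR_ge0.
rewrite mulr1 mulrC; apply: ler_wpM2l => //.
by rewrite ler_expR; apply: ler_wpM2l => //; exact: ltW.
Qed.

(** Below [mu] arcs, [z ^ 2] may be lowered to [z ^ 2 * expR (- X)] at the price
    [expR (mu * X)]. With [X] such that [1 + X] bounds the relative excess of
    pairs respected by both colourings, the remaining expectation is bounded. *)
Lemma hom_weight_pair (mu : R) s t : (1 < k)%N -> doubly_regular T -> 0 <= p <= 1 ->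
  (0 < n)%N ->
  Gnp_exp p (fun G => hom_weight z s G * hom_weight z t G * (#|arcs G|%:R <= mu)%R%:R) <=
  expR (mu * ((K + 1) * K ^+ 2 / ((K - 1) ^+ 2 * N ^+ 2) * row_excess R s t) + p * N / 2).
Proof.
move=> k1 dT p01 n0.
have /andP[p0 _] := p01.
have K1 : 1 < K by rewrite ltr1n.
have N0 : 0 < N by rewrite ltr0n.
have z0 : 0 < z by rewrite /z divr_gt0; lra.
have W0 := row_excess_ge0 R s t.
set W := row_excess R s t in W0 *.
set X := _ / _ * W.
have X0 : 0 <= X.
  by rewrite mulr_ge0// divr_ge0// mulr_ge0 ?sqr_ge0//; lra.
pose y : R := z ^+ 2 * expR (- X).
have y0 : 0 <= y by rewrite mulr_ge0 ?expR_ge0 ?sqr_ge0.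
pose A : rel 'I_n := fun x x' => arc T (s x) (s x') && arc T (t x) (t x').
apply: (@le_trans _ _ (Gnp_exp p (fun G => expR (mu * X) *
   \prod_(e : 'I_n * 'I_n | arc G e.1 e.2) (y * (A e.1 e.2)%:R)))).
  apply: Gnp_exp_le => // G; rewrite prod_arcs_pred.
  have hh : (is_hom G T s)%:R * (is_hom G T t)%:R <=
      [forall x, forall x', arc G x x' ==> A x x']%:R :> R.
    case: (boolP (is_hom G T s)) => [/forallP h1|_]; last by rewrite mul0r.
    case: (boolP (is_hom G T t)) => [/forallP h2|_]; last by rewrite mulr0.
    rewrite mulr1; case: (boolP [forall x, _]) => // /negP[]; apply/forallP => x.
    apply/forallP => x'; apply/implyP => xx'.
    by rewrite /A (implyP (forallP (h1 x) x') xx') (implyP (forallP (h2 x) x') xx').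
  case: (leP #|arcs G|%:R mu) => mu_arcs; last first.
    rewrite mulr0; apply: mulr_ge0; first exact: expR_ge0.
    by apply: mulr_ge0 => //; exact: exprn_ge0.
  have zz : z ^+ #|arcs G| * z ^+ #|arcs G| = y ^+ #|arcs G| * expR (X * #|arcs G|%:R).
    rewrite expRM_natr -exprMn -exprMn; congr (_ ^+ _).
    by rewrite /y -[RHS]mulrA -expRD addNr expR0 mulr1 expr2.
  have ym : 0 <= y ^+ #|arcs G| by exact: exprn_ge0.
  have -> : hom_weight z s G * hom_weight z t G * true%:R = expR (X * #|arcs G|%:R) *
      (y ^+ #|arcs G| * ((is_hom G T s)%:R * (is_hom G T t)%:R)).
    by rewrite /hom_weight mulr1 mulrACA zz; ring.
  apply: ler_pM; [exact: expR_ge0| | |].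
  - by apply: mulr_ge0 => //; exact: mulr_ge0.
  - by rewrite ler_expR mulrC; exact: ler_wpM2r.
  - exact: ler_wpM2l.
rewrite Gnp_expZ expRD; apply: ler_wpM2l; first exact: expR_ge0.
apply: le_trans (Gnp_exp_prod_le (a := fun x x' => y * (A x x')%:R) p01 _) _.
  by move=> x x'; exact: mulr_ge0.
rewrite ler_expR; under eq_bigr do rewrite -mulr_sumr.
rewrite -mulr_sumr.
have := overlap_arcs_le R s t (ltnW k1) dT.
rewrite -/W; set Q := \sum_x _ => hQ.
have q1 : 0 < (K - 1) ^+ 2 / (4 * K ^+ 2) by rewrite divr_gt0// ?mulr_gt0 ?exprn_gt0//; lra.
have QX : Q <= (K - 1) ^+ 2 / (4 * K ^+ 2) * N ^+ 2 * (1 + X).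
  apply: le_trans hQ _; rewrite /X le_eqVlt; apply/orP; left; apply/eqP.
  by field; rewrite !lt0r_neq0//; lra.
have yQ : y * Q <= N ^+ 2.
  apply: (@le_trans _ _ (y * ((K - 1) ^+ 2 / (4 * K ^+ 2) * N ^+ 2 * expR X))).
    apply: ler_wpM2l => //; apply: le_trans QX _; apply: ler_wpM2l; last exact: expR_ge1Dx.
    by rewrite mulr_ge0 ?sqr_ge0// ltW.
  rewrite /y [X in X <= _](_ : _ = (z ^+ 2 * ((K - 1) ^+ 2 / (4 * K ^+ 2))) * N ^+ 2 *
    (expR (- X) * expR X)); last by ring.
  rewrite -expRD addNr expR0 mulr1 [z ^+ 2 * _](_ : _ = 1) ?mul1r//.
  by rewrite /z; field; lra.
have -> : p * N / 2 = p / 2 * N by ring.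
by apply: ler_wpM2l; lra.
Qed.
End Moments.

(** * Balanced colourings and the second moment method *)

Definition balanced (R : realType) n k (dl : R) : {set {ffun 'I_n -> 'I_k}} :=
  [set s | [forall i, class_size R s i <= (k%:R^-1 + dl) * n%:R]]%SET.

(** Chernoff bound for the size of a class of a uniform random colouring. *)
Lemma card_large_class (R : realType) n k (dl : R) (i : 'I_k) : 0 <= dl <= 2 ->
  #|[set s : {ffun 'I_n -> 'I_k} | (k%:R^-1 + dl) * n%:R < class_size R s i]%SET|%:R <=
  k%:R ^+ n * expR (- (dl ^+ 2 / 8 * n%:R)).
Proof.
move=> /andP[dl0 dl2]; have k0 : (0 < k)%N by case: k i => // -[].
have K1 : 1 <= k%:R :> R by rewrite ler1n.
set K := k%:R in K1 *; set N := n%:R.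
(* This [w] minimises [2 * w ^ 2 - w * dl]. *)
pose w := dl / 4.
have w0 : 0 <= w by rewrite divr_ge0.
set S := finset _.
apply: (@le_trans _ _ (expR (- (w * ((K^-1 + dl) * N))) *
   \sum_(s : {ffun 'I_n -> 'I_k}) expR (w * class_size R s i))).
  rewrite mulr_sumr -sum1_card natr_sum big_mkcond /=; apply: ler_sum => s _.
  rewrite -expRD; case: ifP => [|_]; last exact: expR_ge0.
  rewrite inE => h; rewrite -[X in X <= _]expR0 ler_expR addrC subr_ge0.
  by apply: ler_wpM2l => //; exact: ltW.
have -> : \sum_(s : {ffun 'I_n -> 'I_k}) expR (w * class_size R s i) = (K - 1 + expR w) ^+ n.
  transitivity (\sum_(s : {ffun 'I_n -> 'I_k}) \prod_x expR (w * (s x == i)%:R)).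
    by apply: eq_bigr => s _; rewrite -expR_sum -mulr_sumr.
  rewrite -(bigA_distr_bigA (fun (x : 'I_n) (j : 'I_k) => expR (w * (j == i)%:R))) /=.
  rewrite prodr_const card_ord; congr (_ ^+ _).
  rewrite (bigD1 i)//= eqxx mulr1 addrC; congr (_ + _).
  rewrite (eq_bigr (fun=> 1)); last by move=> j /negbTE ->; rewrite mulr0 expR0.
  have := sumr_const 'I_k (1 : R); rewrite (bigD1 i)//= card_ord -/K => <-.
  by rewrite addrAC subrr add0r.
have step : (K - 1 + expR w) ^+ n <= K ^+ n * expR ((expR w - 1) / K * N).
  rewrite expRM_natr -exprMn; apply: lerXn2r.
  - by rewrite nnegrE addr_ge0 ?expR_ge0// subr_ge0.
  - by rewrite nnegrE mulr_ge0 ?expR_ge0//; lra.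
  - have -> : K - 1 + expR w = K * (1 + (expR w - 1) / K) by field; lra.
    by apply: ler_wpM2l; [lra|exact: expR_ge1Dx].
apply: le_trans (ler_wpM2l (expR_ge0 _) step) _.
rewrite mulrCA; apply: ler_wpM2l; first by rewrite exprn_ge0//; lra.
rewrite -expRD ler_expR.
have hw : expR w <= 1 + w + 2 * w ^+ 2 by apply: expR_le_quad; rewrite /w; lra.
have Ki : 0 <= K^-1 <= 1 by rewrite invr_ge0 invf_le1; lra.
have /andP[Ki0 Ki1] := Ki.
have h1 : (expR w - 1) / K <= (w + 2 * w ^+ 2) / K by apply: ler_wpM2r; lra.
have h2 : 2 * w ^+ 2 * K^-1 <= 2 * w ^+ 2 * 1.
  by apply: ler_wpM2l => //; rewrite mulr_ge0 ?sqr_ge0.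
have h3 : (expR w - 1) / K - w * (K^-1 + dl) <= - (dl ^+ 2 / 8).
  have : w * dl = dl ^+ 2 / 4 by rewrite /w; field.
  have : 2 * w ^+ 2 = dl ^+ 2 / 8 by rewrite /w; field.
  lra.
have := ler_wpM2r (ler0n R n) h3; rewrite -/N; lra.
Qed.

Lemma balanced_card (R : realType) n k (dl : R) : 0 <= dl <= 2 ->
  k%:R ^+ n * (1 - k%:R * expR (- (dl ^+ 2 / 8 * n%:R))) <= #|balanced n k dl|%:R.
Proof.
move=> dl02.
pose B (i : 'I_k) := [set s : {ffun 'I_n -> 'I_k} | (k%:R^-1 + dl) * n%:R < class_size R s i]%SET.
have cov : (k ^ n <= #|balanced n k dl| + \sum_i #|B i|)%N.
  have -> : (k ^ n = #|[set: {ffun 'I_n -> 'I_k}]%SET|)%N by rewrite cardsT card_ffun !card_ord.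
  apply: (@leq_trans #|balanced n k dl :|: \bigcup_i B i|).
    apply: subset_leq_card; apply/fintype.subsetP => s _; rewrite !inE.
    case: (boolP [forall i, _]) => //=; rewrite negb_forall => /existsP[i].
    by rewrite -ltNge => h; apply/bigcupP; exists i => //; rewrite inE.
  apply: leq_trans (leq_card_setU _ _) _; rewrite leq_add2l.
  elim/big_rec2: _ => [|i m S _ h]; first by rewrite cards0.
  by apply: leq_trans (leq_card_setU _ _) _; rewrite leq_add2l.
have covR : k%:R ^+ n <= #|balanced n k dl|%:R + \sum_i #|B i|%:R :> R.
  by rewrite -natr_sum -natrD -natrX ler_nat.
have h : \sum_i #|B i|%:R <= \sum_(i < k) k%:R ^+ n * expR (- (dl ^+ 2 / 8 * n%:R)) :> R.
  by apply: ler_sum => i _; exact: card_large_class.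
rewrite sumr_const card_ord -[_ *+ k]mulr_natl in h.
lra.
Qed.

(** The Cauchy-Schwarz inequality, in the form [2 * t * x - t ^ 2 * x ^ 2 <= 1] with
    [t] the mean over [B]. *)
Lemma paley_zygmund (R : realType) n (p B : R) (Z : ograph 'I_n -> R) (A : pred (ograph 'I_n)) :
  0 <= p <= 1 -> 0 < B -> (forall G, ~~ A G -> Z G = 0) ->
  Gnp_exp p (fun G => Z G ^+ 2) <= B ->
  (Gnp_exp p Z) ^+ 2 / B <= Gnp_prob p A.
Proof.
move=> p01 B0 ZA hB; set m := Gnp_exp p Z; pose t := m / B.
have : Gnp_exp p (fun G => 2 * t * Z G + - (t ^+ 2) * Z G ^+ 2) <= Gnp_prob p A.
  rewrite Gnp_probE; apply: Gnp_exp_le => // G.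
  case: (boolP (A G)) => hA.
    have : 0 <= (1 - t * Z G) ^+ 2 by exact: sqr_ge0.
    by rewrite /= mulr1n !expr2; lra.
  by rewrite ZA// (expr2 (0 : R)) !mulr0 addr0.
rewrite Gnp_expD !Gnp_expZ -/m => h; apply: le_trans h.
have := ler_wpM2l (sqr_ge0 t) hB.
have -> : m ^+ 2 / B = 2 * t * m - t ^+ 2 * B by rewrite /t; field; lra.
lra.
Qed.

(** The point where [d <= ell_ R k] enters: at equality, the coefficient of
    [row_excess] in the exponent is the one that [row_excess_le] pays for by
    [log_lift]. The error terms vanish with [de] and [dl]. *)
Lemma second_moment_rate (R : realType) n k (d de dl : R) (s t : {ffun 'I_n -> 'I_k}) :
  (3 <= k)%N -> (0 < n)%N -> 0 <= d <= ell_ R k -> 0 <= de -> 0 <= dl ->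
  s \in balanced n k dl ->
  (1 + de) * d * n%:R / 2 *
    ((k%:R + 1) * k%:R ^+ 2 / ((k%:R - 1) ^+ 2 * n%:R ^+ 2) * row_excess R s t) <=
  log_lift R s t + ((1 + de) * (1 + k%:R * dl) - 1) * (n%:R * ln k%:R).
Proof.
move=> k3 n0 /andP[d0 dl_ell] de0 dl0; rewrite inE => /forallP sb.
have K3 : 3 <= k%:R :> R by rewrite ler_nat.
have N0 : 0 < n%:R :> R by rewrite ltr0n.
set K := k%:R in K3 sb *; set N := n%:R in N0 sb *.
have C0 := row_cst_gt0 K3.
have b0 : 0 <= (K^-1 + dl) * N by rewrite mulr_ge0 ?addr_ge0 ?invr_ge0//; lra.
have hW := row_excess_le t k3 b0 sb.
have W0 := row_excess_ge0 R s t.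
have hL := @log_lift_le R n k s t (ltnW (ltnW k3)); rewrite -/K -/N in hL.
set W := row_excess R s t in hW W0 *; set L := log_lift R s t in hW hL *.
set C := row_cst _ in C0 hW.
have eell : ell_ R k = 2 * (K - 1) ^+ 2 * C / (K * (K + 1)).
  by rewrite /ell_ /C /row_cst -/K; field; rewrite !lt0r_neq0//; lra.
have h1 : (1 + de) * d * N / 2 * ((K + 1) * K ^+ 2 / ((K - 1) ^+ 2 * N ^+ 2) * W) <=
    (1 + de) * (C * W * K / N).
  have -> : (1 + de) * d * N / 2 * ((K + 1) * K ^+ 2 / ((K - 1) ^+ 2 * N ^+ 2) * W) =
     (1 + de) * W * ((K + 1) * K ^+ 2 / (2 * (K - 1) ^+ 2 * N)) * d.
    by field; rewrite !lt0r_neq0//; lra.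
  have -> : (1 + de) * (C * W * K / N) =
     (1 + de) * W * ((K + 1) * K ^+ 2 / (2 * (K - 1) ^+ 2 * N)) * ell_ R k.
    by rewrite eell; field; rewrite !lt0r_neq0//; lra.
  apply: ler_wpM2l => //; apply: mulr_ge0; first by rewrite mulr_ge0//; lra.
  by rewrite divr_ge0 ?mulr_ge0 ?sqr_ge0//; lra.
have h2 : C * W * K / N <= (1 + K * dl) * L.
  rewrite ler_pdivrMr//.
  have -> : (1 + K * dl) * L * N = (K^-1 + dl) * N * L * K by field; lra.
  by apply: ler_wpM2r => //; lra.
have h3 : (1 + de) * (C * W * K / N) <= (1 + de) * ((1 + K * dl) * L).
  by apply: ler_wpM2l => //; lra.
have h4 : ((1 + de) * (1 + K * dl) - 1) * L <= ((1 + de) * (1 + K * dl) - 1) * (N * ln K).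
  apply: ler_wpM2l => //.
  have kd : 0 <= K * dl by rewrite mulr_ge0//; lra.
  have := mulr_ge0 de0 kd; lra.
lra.
Qed.

(** * Local sparsity of the random graph *)

(** From [s ^ s / s! <= expR s]. *)
Lemma bin_le_expR (R : realType) (n s : nat) : (0 < s)%N ->
  'C(n, s)%:R <= (n%:R / s%:R) ^+ s * expR s%:R :> R.
Proof.
move=> s0; have S0 : 0 < s%:R :> R by rewrite ltr0n.
have f0 : 0 < (s`!)%:R :> R by rewrite ltr0n fact_gt0.
have h1 : 'C(n, s)%:R * (s`!)%:R <= n%:R ^+ s :> R.
  rewrite -natrM bin_ffact -natrX ler_nat.
  elim: (s) => [|m IH]; first by rewrite ffactn0.
  by rewrite ffactnSr expnSr leq_mul// leq_subr.
have h2 : s%:R ^+ s / (s`!)%:R <= expR s%:R :> R.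
  case: (s) s0 S0 => // m _ S0; apply: le_trans (expR_ge1Dxn m (ltW S0)).
  by rewrite lerDr.
have h3 : s%:R ^+ s <= expR s%:R * (s`!)%:R :> R by rewrite -ler_pdivrMr.
rewrite -(ler_pM2r f0); apply: le_trans h1 _.
rewrite exprMn exprVn -mulrA -mulrA; apply: ler_peMr; first by rewrite exprn_ge0.
by rewrite mulrC ler_pdivlMr ?exprn_gt0// mul1r.
Qed.

(** A constant large enough to absorb, to the power [(s + 4) %/ 5], all factors that
    are exponential in [s] in [dense_term_le]. *)
Definition sparse_base (R : realType) (d : R) : R := (expR 2 * Num.max 1 (d / 2) ^+ 2) ^+ 5.

Lemma sparse_base_ge (R : realType) (d : R) : 0 <= d -> 1 <= sparse_base d /\ d / 2 <= sparse_base d.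
Proof.
move=> d0; rewrite /sparse_base; set D := Num.max _ _.
have D1 : 1 <= D by rewrite le_max lexx.
have Dd : d / 2 <= D by rewrite le_max lexx orbT.
have e1 : 1 <= expR 2 :> R by rewrite -expR0 ler_expR.
have h1 : D <= D ^+ 2 by rewrite expr2 ler_peMr//; lra.
have h2 : D ^+ 2 <= expR 2 * D ^+ 2 by rewrite ler_peMl//; lra.
have h3 : expR 2 * D ^+ 2 <= (expR 2 * D ^+ 2) ^+ 5.
  by rewrite -[X in X <= _]expr1; apply: ler_weXn2l => //; lra.
split; lra.
Qed.

(** The bound on the expected number of sets of size [s] with too many arcs, that
    is with at least [s + t] arcs where [t] is [s / 5] rounded up. The factor
    [(s / n) ^ t] is what remains of the powers of [n]; one of its [t] factors
    gives the [1 / n], the others the geometric decay. *)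
Lemma dense_term_le (R : realType) (n s : nat) (d : R) : (0 < n)%N -> (0 < s)%N -> 0 <= d ->
  sparse_base d * s%:R / n%:R <= (1 / 4) ^+ 5 ->
  (n%:R / s%:R) ^+ s * expR s%:R * (expR s%:R * (d * s%:R / (2 * n%:R)) ^+ (s + (s + 4) %/ 5)%N) <=
  4 ^+ 5 * sparse_base d / n%:R * (1 / 2) ^+ s.
Proof.
move=> n0 s0 d0 hB.
have N0 : 0 < n%:R :> R by rewrite ltr0n.
have S0 : 0 < s%:R :> R by rewrite ltr0n.
have [B1 _] := sparse_base_ge d0.
set t := ((s + 4) %/ 5)%N.
have ts : (t <= s)%N by rewrite /t; lia.
have st : (s <= 5 * t)%N by rewrite /t; lia.
have t0 : (0 < t)%N by rewrite /t; lia.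
pose D : R := Num.max 1 (d / 2).
have D1 : 1 <= D by rewrite le_max lexx.
have Dd : d / 2 <= D by rewrite le_max lexx orbT.
have e1 : 1 <= expR 2 :> R by rewrite -expR0 ler_expR.
have eD1 : 1 <= expR 2 * D ^+ 2.
  have : 1 <= D ^+ 2 by rewrite exprn_ege1.
  by move=> ?; apply: mulr_ege1.
set x : R := s%:R / n%:R.
have x0 : 0 < x by rewrite divr_gt0.
have -> : (n%:R / s%:R) ^+ s * expR s%:R * (expR s%:R * (d * s%:R / (2 * n%:R)) ^+ (s + t)%N) =
  expR 2 ^+ s * (d / 2) ^+ (s + t) * x ^+ t.
  have -> : d * s%:R / (2 * n%:R) = d / 2 * x by rewrite /x; field; lra.
  have -> : n%:R / s%:R = x^-1 by rewrite /x; field; lra.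
  have -> : expR 2 ^+ s = expR s%:R * expR s%:R :> R.
    by rewrite -expRM_natr -expRD; congr expR; ring.
  rewrite exprMn (exprD x) exprVn; field.
  by rewrite expf_neq0// gt_eqF.
apply: (@le_trans _ _ ((sparse_base d * x) ^+ t)).
  rewrite [X in _ <= X]exprMn; apply: ler_wpM2r; first by rewrite exprn_ge0// ltW.
  apply: (@le_trans _ _ ((expR 2 * D ^+ 2) ^+ s)).
    rewrite [X in _ <= X]exprMn; apply: ler_wpM2l; first by rewrite exprn_ge0// ltW// expR_gt0.
    apply: (@le_trans _ _ (D ^+ (s + t))).
      apply: lerXn2r; [rewrite nnegrE; lra|rewrite nnegrE; lra|exact: Dd].
    rewrite -[X in _ <= X]exprM.
    by apply: ler_weXn2l; [exact: D1|rewrite mul2n -addnn leq_add2l].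
  rewrite /sparse_base -/D -[X in _ <= X]exprM; apply: ler_weXn2l; [exact: eD1|exact: st].
have -> : sparse_base d * x = sparse_base d * s%:R / n%:R by rewrite /x mulrA.
set y := _ / n%:R in hB *.
have B0 : 0 <= sparse_base d by lra.
have y0 : 0 <= y by apply: divr_ge0 => //; exact: mulr_ge0.
have -> : y ^+ t = y * y ^+ t.-1 by rewrite -exprS prednK.
have h1 : y ^+ t.-1 <= ((1 / 4) ^+ 5) ^+ t.-1.
  by apply: lerXn2r => //; rewrite nnegrE exprn_ge0//; lra.
apply: le_trans (ler_wpM2l y0 h1) _.
have e2 : ((1 / 4) ^+ 5) ^+ t.-1 = 4 ^+ 5 * ((1 / 4) ^+ 5) ^+ t :> R.
  have q4 : 4 ^+ 5 * (1 / 4) ^+ 5 = 1 :> R by rewrite -exprMn mulrCA divff ?mulr1 ?expr1n// pnatr_eq0.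
  move: ((1 / 4) ^+ 5) q4 => q q4.
  by rewrite -[in RHS](prednK t0) (exprS q) mulrA q4 mul1r.
have h2 : ((1 / 4) ^+ 5) ^+ t <= (1 / 4) ^+ s :> R.
  rewrite -exprM; apply: ler_wiXn2l; [lra|lra|exact: st].
have h3 : s%:R * (1 / 4) ^+ s <= (1 / 2) ^+ s :> R.
  have -> : 1 / 4 = 1 / 2 * (1 / 2) :> R by field.
  rewrite exprMn mulrA; apply: ler_piMl; first by rewrite exprn_ge0//; lra.
  rewrite expr_div_n expr1n mul1r ler_pdivrMr ?exprn_gt0// mul1r -natrX ler_nat.
  exact: ltnW (ltn_expl _ _).
rewrite e2.
have -> : y * (4 ^+ 5 * ((1 / 4) ^+ 5) ^+ t) = 4 ^+ 5 * sparse_base d / n%:R * (s%:R * ((1 / 4) ^+ 5) ^+ t).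
  by rewrite /y; field; lra.
apply: ler_wpM2l; first by apply: divr_ge0 => //; exact: mulr_ge0.
apply: le_trans h3; exact: ler_wpM2l.
Qed.

Lemma sum_half_le (R : realType) m : \sum_(i < m) (1 / 2) ^+ i <= 2 :> R.
Proof.
have -> : \sum_(i < m) (1 / 2) ^+ i = 2 - 2 * (1 / 2) ^+ m :> R.
  elim: m => [|m IH]; first by rewrite big_ord0 expr0; ring.
  by rewrite big_ord_recr /= IH exprS; field.
have : 0 <= (1 / 2) ^+ m :> R by rewrite exprn_ge0//; lra.
lra.
Qed.

Lemma prod_arcs_inner (R : realType) n (G : ograph 'I_n) (S : {set 'I_n}) (y : R) :
  \prod_(e : 'I_n * 'I_n | arc G e.1 e.2) (if (e.1 \in S) && (e.2 \in S) then y else 1) =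
  y ^+ inner_arcs G S.
Proof.
rewrite /inner_arcs.
transitivity (\prod_(x in S) \prod_(z in S) y ^+ arc G x z).
  rewrite pair_big /= big_mkcond [RHS]big_mkcond /=; apply: eq_bigr => -[x z] _ /=.
  by case: (arc G x z); case: ifP.
by rewrite -prodrXr; apply: eq_bigr => x _; rewrite prodrXr.
Qed.

Lemma dense_arcs (n : nat) (G : ograph 'I_n) (S : {set 'I_n}) : ~~ locally_sparse G S ->
  (#|S| + (#|S| + 4) %/ 5 <= inner_arcs G S)%N.
Proof. by rewrite /locally_sparse; lia. Qed.

(** An exponential Markov inequality for the number of arcs in [S], with the base
    [y = 2 * n / (d * #|S|)] that makes the exponent equal to [#|S|]. *)
Lemma dense_set_prob (R : realType) n (p d : R) (S : {set 'I_n}) :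
  0 <= p <= 1 -> p * n%:R = d -> 0 < d -> (0 < #|S|)%N -> d * #|S|%:R <= 2 * n%:R ->
  Gnp_prob p (fun G : ograph 'I_n => ~~ locally_sparse G S) <=
  expR (d / 2) * (expR #|S|%:R * (d * #|S|%:R / (2 * n%:R)) ^+ (#|S| + (#|S| + 4) %/ 5)%N).
Proof.
move=> p01 pn d0 s0 small; have /andP[p0 _] := p01.
set s := #|S| in s0 small *; set r := (s + _)%N.
have S0 : 0 < s%:R :> R by rewrite ltr0n.
have N0 : 0 < n%:R :> R.
  by rewrite -(pmulr_rgt0 _ (_ : 0 < 2)) //; apply: lt_le_trans small; rewrite mulr_gt0.
pose y : R := 2 * n%:R / (d * s%:R).
have ds0 : 0 < d * s%:R by rewrite mulr_gt0.
have y1 : 1 <= y by rewrite ler_pdivlMr// mul1r.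
have y0 : 0 < y by lra.
have yV : d * s%:R / (2 * n%:R) = y^-1 by rewrite /y; field; rewrite !lt0r_neq0.
pose a (x z : 'I_n) : R := if (x \in S) && (z \in S) then y else 1.
have a0 x z : 0 <= a x z by rewrite /a; case: ifP => _; lra.
have sa : \sum_x \sum_z a x z <= n%:R ^+ 2 + y * s%:R ^+ 2.
  have -> : n%:R ^+ 2 + y * s%:R ^+ 2 =
    \sum_(x < n) \sum_(z < n) (1 + y * ((x \in S)%:R * (z \in S)%:R)) :> R.
    have c1 : \sum_(x < n) 1 = n%:R :> R by rewrite sumr_const card_ord.
    have cS : \sum_(x < n) (x \in S)%:R = s%:R :> R.
      by rewrite -natr_sum -big_mkcond /= sum1_card.
    transitivity (\sum_(x < n) (n%:R * 1 + y * s%:R * (x \in S)%:R) : R).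
      by rewrite big_split /= -!mulr_sumr c1 cS !expr2; ring.
    apply: eq_bigr => x _; rewrite big_split /= c1 mulr1; congr (_ + _).
    by rewrite -mulr_sumr -mulr_sumr cS; ring.
  apply: ler_sum => x _; apply: ler_sum => z _; rewrite /a.
  by case: (x \in S); case: (z \in S); rewrite /= ?mulr1 ?mulr0 ?addr0//; lra.
have E := Gnp_exp_prod_le p01 a0.
have h : y ^+ r * Gnp_prob p (fun G : ograph 'I_n => ~~ locally_sparse G S) <=
   Gnp_exp p (fun G => \prod_(e : 'I_n * 'I_n | arc G e.1 e.2) a e.1 e.2).
  rewrite Gnp_probE -Gnp_expZ; apply: Gnp_exp_le => // G.
  rewrite prod_arcs_inner; case: (boolP (locally_sparse G S)) => sp.
    by rewrite mulr0 exprn_ge0// ltW.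
  rewrite mulr1; apply: ler_weXn2l => //.
  exact: dense_arcs.
rewrite yV exprVn mulrA ler_pdivlMr ?exprn_gt0// mulrC.
apply: le_trans h _; apply: le_trans E _; rewrite -expRD ler_expR.
have e1 : p / 2 * (y * s%:R ^+ 2) = s%:R.
  have -> : p = d / n%:R by rewrite -pn; field; lra.
  by rewrite /y; field; rewrite !lt0r_neq0.
have e2 : p / 2 * n%:R = d / 2 by rewrite -pn; ring.
have : p / 2 * (\sum_x \sum_z a x z - n%:R ^+ 2 + n%:R) <= p / 2 * (y * s%:R ^+ 2 + n%:R).
  by apply: ler_wpM2l; lra.
have -> : p / 2 * (y * s%:R ^+ 2 + n%:R) = s%:R + d / 2 by rewrite mulrDr e1 e2.
lra.
Qed.

Lemma Gnp_prob_union (R : realType) n (p : R) (I : finType) (P : pred I)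
    (B : I -> pred (ograph 'I_n)) (A : pred (ograph 'I_n)) :
  0 <= p <= 1 -> (forall G, A G -> exists2 i, P i & B i G) ->
  Gnp_prob p A <= \sum_(i | P i) Gnp_prob p (B i).
Proof.
move=> p01 h; rewrite Gnp_probE.
rewrite (eq_bigr (fun i => Gnp_exp p (fun G => (B i G)%:R))); last first.
  by move=> i _; rewrite Gnp_probE.
rewrite -Gnp_exp_sum; apply: Gnp_exp_le => // G.
case: (boolP (A G)) => [/h[i Pi Bi]|_]; last exact: sumr_ge0.
by rewrite (bigD1 i)//= Bi lerDl sumr_ge0.
Qed.

Lemma dense_sets_prob (R : realType) n (p d : R) (m : nat) :
  0 <= p <= 1 -> p * n%:R = d -> 0 < d -> (0 < n)%N ->
  sparse_base d * m%:R / n%:R <= (1 / 4) ^+ 5 ->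
  Gnp_prob p (fun G : ograph 'I_n =>
    [exists S : {set 'I_n}, [&& S != finset.set0, (#|S| <= m)%N & ~~ locally_sparse G S]]) <=
  expR (d / 2) * (4 ^+ 5 * sparse_base d) * 2 / n%:R.
Proof.
move=> p01 pn d0 n0 hm.
have N0 : 0 < n%:R :> R by rewrite ltr0n.
have [B1 Bd] := sparse_base_ge (ltW d0).
have c0 : 0 <= expR (d / 2) * (4 ^+ 5 * sparse_base d).
  apply: mulr_ge0; first exact: expR_ge0.
  by apply: mulr_ge0; [exact: exprn_ge0|lra].
have small s : (s <= m)%N -> sparse_base d * s%:R / n%:R <= (1 / 4) ^+ 5.
  move=> sm; apply: le_trans hm; apply: ler_wpM2r; first by rewrite invr_ge0 ltW.
  by apply: ler_wpM2l; [lra|rewrite ler_nat].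
apply: (@le_trans _ _ (\sum_(S : {set 'I_n} | (S != finset.set0) && (#|S| <= m)%N)
   Gnp_prob p (fun G : ograph 'I_n => ~~ locally_sparse G S))).
  apply: (Gnp_prob_union (B := fun S G => ~~ locally_sparse G S)) => // G.
  by move=> /existsP[S /and3P[h1 h2 h3]]; exists S; rewrite ?h1.
pose f (s : nat) : R := expR (d / 2) * (expR s%:R * (d * s%:R / (2 * n%:R)) ^+ (s + (s + 4) %/ 5)%N).
apply: (@le_trans _ _ (\sum_(S : {set 'I_n} | (S != finset.set0) && (#|S| <= m)%N) f #|S|)).
  apply: ler_sum => S /andP[S0 Sm]; apply: dense_set_prob => //; first by rewrite card_gt0.
  have := small _ Sm; rewrite ler_pdivrMr// => h.
  have : d / 2 * #|S|%:R <= sparse_base d * #|S|%:R by apply: ler_wpM2r.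
  lra.
have f0 s : 0 <= f s.
  rewrite /f mulr_ge0 ?expR_ge0// mulr_ge0 ?expR_ge0// exprn_ge0// divr_ge0 ?mulr_ge0//; exact: ltW.
rewrite (partition_big (fun S : {set 'I_n} => inord #|S| : 'I_n.+1) xpredT)//=.
apply: (@le_trans _ _ (\sum_(s < n.+1) expR (d / 2) * (4 ^+ 5 * sparse_base d) / n%:R * (1 / 2) ^+ s)).
  apply: ler_sum => s _.
  have cS (S : {set 'I_n}) : nat_of_ord (inord #|S| : 'I_n.+1) = #|S|.
    by rewrite inordK// ltnS -[X in (_ <= X)%N]card_ord max_card.
  case: (boolP ((0 < s)%N && (s <= m)%N)) => [/andP[s0 sm]|nsm]; last first.
    rewrite big_pred0; last first.
      move=> S; apply/negbTE; move: nsm; apply: contra => /andP[/andP[S0 Sm] /eqP e].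
      by rewrite -e cS card_gt0 S0.
    apply: mulr_ge0; first exact: divr_ge0.
    by apply: exprn_ge0; lra.
  apply: (@le_trans _ _ (\sum_(S : {set 'I_n} | #|S| == s) f s)).
    rewrite big_mkcond [X in _ <= X]big_mkcond /=; apply: ler_sum => S _.
    case: ifP => [/andP[_ /eqP e]|_]; last by case: ifP.
    by rewrite -e cS eqxx.
  have -> : \sum_(S : {set 'I_n} | #|S| == s) f s = 'C(n, s)%:R * f s.
    rewrite -[X in 'C(X, _)]card_ord -card_draws -sum1_card natr_sum mulr_suml.
    by rewrite big_mkcond [RHS]big_mkcond; apply: eq_bigr => S _; rewrite inE mul1r.
  have cb := bin_le_expR R n s0.
  have dt := @dense_term_le R n s d n0 s0 (ltW d0) (small _ sm).
  have w0 : 0 <= expR s%:R * (d * s%:R / (2 * n%:R)) ^+ (s + (s + 4) %/ 5)%N.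
    have := f0 s; rewrite /f pmulr_rge0//; exact: expR_gt0.
  have {}dt := le_trans (ler_wpM2r w0 cb) dt.
  rewrite /f mulrCA (_ : _ / n%:R * (1 / 2) ^+ s =
    expR (d / 2) * (4 ^+ 5 * sparse_base d / n%:R * (1 / 2) ^+ s)).
    by apply: ler_wpM2l => //; exact: expR_ge0.
  by move: (4 ^+ 5 : R) => q; ring.
rewrite -mulr_sumr [X in _ <= X](_ : _ =
    expR (d / 2) * (4 ^+ 5 * sparse_base d) / n%:R * 2).
  apply: ler_wpM2l (sum_half_le _ _).
  exact: divr_ge0.
by rewrite mulrAC.
Qed.

(** * The defect vanishes with subexponential probability *)

Local Open Scope classical_set_scope.
Local Open Scope ring_scope.

Lemma near_le_linear (R : realType) (a c : R) : 0 < a -> \forall n \near \oo, c <= a * n%:R.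
Proof.
move=> a0; near=> n; rewrite mulrC -ler_pdivrMr//.
by near: n; exact: nbhs_infty_ger.
Unshelve. all: by end_near.
Qed.

Lemma poly_le_expR (R : realType) (a : R) (m : nat) : 0 < a ->
  exists2 c : R, 0 < c & forall n, n.+1%:R ^+ m <= c * expR (a * n%:R).
Proof.
move=> a0; pose b : R := a / m.+1%:R.
have b0 : 0 < b by rewrite divr_gt0.
exists ((1 + b^-1) ^+ m); first by rewrite exprn_gt0// addr_gt0 ?invr_gt0.
move=> n.
have h : n.+1%:R <= (1 + b^-1) * expR (b * n%:R).
  apply: (@le_trans _ _ ((1 + b^-1) * (1 + b * n%:R))).
    have -> : (1 + b^-1) * (1 + b * n%:R) = n.+1%:R + (b * n%:R + b^-1).
      by rewrite -natr1; field; lra.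
    rewrite lerDl; apply: addr_ge0; last by rewrite invr_ge0 ltW.
    by apply: mulr_ge0 => //; exact: ltW.
  by apply: ler_wpM2l (expR_ge1Dx _); rewrite addr_ge0// invr_ge0 ltW.
apply: (@le_trans _ _ (((1 + b^-1) * expR (b * n%:R)) ^+ m)).
  by apply: lerXn2r; rewrite ?nnegrE// mulr_ge0 ?expR_ge0// addr_ge0// invr_ge0 ltW.
rewrite exprMn; apply: ler_wpM2l; first by rewrite exprn_ge0// addr_ge0// invr_ge0 ltW.
rewrite -expRM_natr ler_expR mulrAC; apply: ler_wpM2r => //.
rewrite /b -mulrA ler_piMr ?(ltW a0)// mulrC ler_pdivrMr// mul1r ler_nat//.
Qed.

(** The graphs with too many arcs carry a negligible part of the weighted count.
    The imbalance [dl] is chosen quadratic in the excess [de] of arcs so that the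
    loss from the imbalance is smaller than the gain in the tail. *)
Lemma first_moment_ge (R : realType) n k (T : ograph 'I_k) (p d de dl : R) (s : {ffun 'I_n -> 'I_k}) :
  (3 <= k)%N -> doubly_regular T -> 0 <= p <= 1 / 2 -> p * n%:R = d ->
  0 <= de <= 1 -> dl = de ^+ 2 / 32 -> s \in balanced n k dl ->
  expR (- (d * dl * n%:R + d ^+ 2)) - expR (d / 2 - d * (2 * dl) * n%:R) <=
  Gnp_exp p (fun G => hom_weight T (2 * k%:R / (k%:R - 1)) s G *
     (#|arcs G|%:R <= (1 + de) * d * n%:R / 2)%R%:R).
Proof.
move=> k3 dT p01 pn /andP[de0 de1] edl sb.
have tT : tournament T by case/and3P: dT.
have /andP[p0 p1] := p01.
have d0 : 0 <= d by rewrite -pn mulr_ge0.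
have dl0 : 0 <= dl by rewrite edl divr_ge0// sqr_ge0.
move: sb; rewrite inE => /forallP sb.
have lo := hom_weight_exp_ge k3 tT p01 dl0 sb.
pose w := de / 4; pose mu := (1 + de) * d * n%:R / 2.
have hi := @hom_weight_tail R n k T p mu w s (ltnW k3) tT (_ : 0 <= p <= 1) (_ : 0 <= w).
have {}hi := hi ltac:(lra) ltac:(rewrite /w; lra).
set z := 2 * k%:R / (k%:R - 1) in lo hi *.
have e : Gnp_exp p (hom_weight T z s) =
    Gnp_exp p (fun G => hom_weight T z s G * (#|arcs G|%:R <= mu)%R%:R) +
    Gnp_exp p (fun G => hom_weight T z s G * (mu < #|arcs G|%:R)%R%:R).
  rewrite -Gnp_expD; apply: eq_Gnp_exp => G.
  by case: (leP #|arcs G|%:R mu) => _; rewrite ?mulr1 ?mulr0 ?addr0 ?add0r.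
rewrite e pn in lo.
rewrite pn in hi.
have hw : expR w <= 1 + w + 2 * w ^+ 2 by apply: expR_le_quad; rewrite /w; lra.
have hi2 : expR (d / 2 * (n%:R * (expR w - 1) + 1) - w * mu) <= expR (d / 2 - d * (2 * dl) * n%:R).
  rewrite ler_expR.
  have : d / 2 * n%:R * (expR w - 1) <= d / 2 * n%:R * (w + 2 * w ^+ 2).
    by apply: ler_wpM2l; [rewrite mulr_ge0//; lra|lra].
  have : d / 2 * n%:R * (w + 2 * w ^+ 2) - w * mu = - (d * (2 * dl) * n%:R).
    by rewrite /mu /w edl; field.
  lra.
rewrite -/mu; lra.
Qed.

Lemma second_moment_le (R : realType) n k (T : ograph 'I_k) (p d de dl : R) :
  (3 <= k)%N -> (0 < n)%N -> doubly_regular T -> 0 <= p <= 1 -> p * n%:R = d ->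
  d <= ell_ R k -> 0 <= de -> 0 <= dl ->
  Gnp_exp p (fun G => (\sum_(s in balanced n k dl) hom_weight T (2 * k%:R / (k%:R - 1)) s G *
     (#|arcs G|%:R <= (1 + de) * d * n%:R / 2)%R%:R) ^+ 2) <=
  #|balanced n k dl|%:R * (k%:R ^+ n * n.+1%:R ^+ (k * k) *
    expR (((1 + de) * (1 + k%:R * dl) - 1) * (n%:R * ln k%:R) + d / 2)).
Proof.
move=> k3 n0 dT p01 pn d_ell de0 dl0.
have /andP[p0 p1] := p01.
have d0 : 0 <= d by rewrite -pn mulr_ge0.
set z := 2 * k%:R / (k%:R - 1); set mu := (1 + de) * d * n%:R / 2.
set eta := (1 + de) * (1 + k%:R * dl) - 1.
rewrite (eq_Gnp_exp _ (F' := fun G => \sum_(s in balanced n k dl) \sum_(t in balanced n k dl)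
   hom_weight T z s G * hom_weight T z t G * (#|arcs G|%:R <= mu)%R%:R)); last first.
  move=> G; rewrite expr2 mulr_suml; apply: eq_bigr => s _.
  rewrite mulr_sumr; apply: eq_bigr => t _.
  by case: (#|arcs G|%:R <= mu)%R; rewrite ?mulr1 ?mulr0 ?mul0r.
rewrite Gnp_exp_sum -sum1_card natr_sum mulr_suml; apply: ler_sum => s sb.
rewrite mul1r Gnp_exp_sum.
apply: (@le_trans _ _ (\sum_(t in balanced n k dl)
   expR (log_lift R s t) * expR (eta * (n%:R * ln k%:R) + d / 2))).
  apply: ler_sum => t _.
  apply: le_trans (hom_weight_pair mu s t (ltnW k3) dT p01 n0) _.
  rewrite -expRD ler_expR pn addrA lerD2r.
  by apply: second_moment_rate => //; rewrite d0.
rewrite -mulr_suml; apply: ler_wpM2r; first exact: expR_ge0.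
have k0 : (0 < k)%N by case: (k) k3.
apply: (@le_trans _ _ (\sum_t expR (log_lift R s t))).
  rewrite [X in _ <= X](bigID (fun t => t \in balanced n k dl)) /= lerDl.
  by apply: sumr_ge0 => t _; exact: expR_ge0.
under eq_bigr do rewrite (expR_log_lift _ _ _ k0).
rewrite -mulr_sumr; apply: ler_wpM2l; first by rewrite exprn_ge0.
exact: sum_conditional_types.
Qed.

(** [paley_zygmund] for the sum of [hom_weight] over the balanced colourings,
    truncated at slightly more than [d * n / 2] arcs. The ratio of the moments is
    [expR] of a small multiple of [n], up to a polynomial factor. *)
Lemma defect_zero_prob (R : realType) k (T : ograph 'I_k) (d ep : R) :
  (3 <= k)%N -> doubly_regular T -> 0 < d <= ell_ R k -> 0 < ep ->
  \forall n \near \oo,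
    expR (- (ep * n%:R)) <= Gnp_prob (d / n%:R) (fun G : ograph 'I_n => defect G T == 0%N).
Proof.
move=> k3 dT /andP[d0 d_ell] ep0.
have K3 : 3 <= k%:R :> R by rewrite ler_nat.
set K := k%:R in K3 *.
have lnK : 0 <= ln K by apply: ln_ge0; lra.
pose A := d + (1 + K) * ln K.
have A0 : 0 < A by rewrite ltr_pwDl// mulr_ge0//; lra.
(* The exponential rates lost in the two moments add up to at most [de * A]. *)
pose de := Num.min 1 (ep / (4 * A)).
have de0 : 0 < de by rewrite lt_min ltr01 divr_gt0// mulr_gt0.
have de1 : de <= 1 by rewrite ge_min lexx.
have deA : de * A <= ep / 4.
  have : de <= ep / (4 * A) by rewrite ge_min lexx orbT.
  by rewrite ler_pdivlMr ?mulr_gt0//; lra.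
pose dl := de ^+ 2 / 32.
have dl0 : 0 < dl by rewrite divr_gt0// exprn_gt0.
have dlde : dl <= de / 32.
  rewrite /dl; have : de * de <= de * 1 by apply: ler_wpM2l => //; exact: ltW.
  by rewrite -expr2; lra.
pose eta := (1 + de) * (1 + K * dl) - 1.
have eta_le : eta * ln K + 2 * d * dl <= ep / 4.
  apply: le_trans deA; rewrite /A mulrDr addrC; apply: lerD.
    have := ler_wpM2l (ltW d0) dlde; have := mulr_ge0 (ltW d0) (ltW de0); lra.
  rewrite mulrA; apply: ler_wpM2r => //; rewrite /eta.
  have h1 : K * dl <= K * (de / 32) by apply: ler_wpM2l => //; lra.
  have h2 : K * dl * de <= K * dl * 1.
    apply: ler_wpM2l => //; apply: mulr_ge0; [lra|exact: ltW].
  have h3 : 0 <= K * de by apply: mulr_ge0; [lra|exact: ltW].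
  lra.
have [c c0 hc] := @poly_le_expR R (ep / 4) (k * k) (ltac:(lra)).
pose C := 8 * c * expR (2 * d ^+ 2 + d / 2).
have C0 : 0 < C by apply: mulr_gt0; [apply: mulr_gt0|exact: expR_gt0].
near=> n.
have n0 : (0 < n)%N by near: n; exact: nbhs_infty_gt.
have N0 : 0 < n%:R :> R by rewrite ltr0n.
pose p := d / n%:R.
have pn : p * n%:R = d by rewrite /p; field; lra.
have p01 : 0 <= p <= 1 / 2.
  apply/andP; split; first by rewrite /p divr_ge0 ?ltW.
  rewrite /p ler_pdivrMr//.
  by near: n; apply: near_le_linear; lra.
have p01' : 0 <= p <= 1 by lra.
have deb : 0 <= de <= 1 by rewrite de1 ltW.
set Bal := balanced n k dl.
have cardB : K ^+ n / 2 <= #|Bal|%:R.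
  have dl2 : 0 <= dl <= 2 by rewrite (ltW dl0) /=; lra.
  apply: le_trans (balanced_card n k dl2); rewrite -/K.
  apply: ler_wpM2l; first by rewrite exprn_ge0//; lra.
  have : 2 * K <= expR (dl ^+ 2 / 8 * n%:R).
    apply: le_trans (expR_ge1Dx _); rewrite -lerBlDl.
    by near: n; apply: near_le_linear; rewrite divr_gt0// exprn_gt0.
  rewrite expRN => h; have e0 := expR_gt0 (dl ^+ 2 / 8 * n%:R).
  have : K / expR (dl ^+ 2 / 8 * n%:R) <= 1 / 2 by rewrite ler_pdivrMr//; lra.
  lra.
pose lo := expR (- (d * dl * n%:R + d ^+ 2)).
have lohi : lo / 2 <= lo - expR (d / 2 - d * (2 * dl) * n%:R).
  have : 2 * expR (d / 2 - d * (2 * dl) * n%:R) <= lo.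
    have -> : lo = expR (d * dl * n%:R - d ^+ 2 - d / 2) * expR (d / 2 - d * (2 * dl) * n%:R).
      by rewrite -expRD /lo; congr expR; ring.
    apply: ler_wpM2r; first exact: expR_ge0.
    apply: le_trans (expR_ge1Dx _).
    have : 1 + d ^+ 2 + d / 2 <= d * dl * n%:R.
      by near: n; apply: near_le_linear; rewrite mulr_gt0.
    lra.
  lra.
pose mu := (1 + de) * d * n%:R / 2.
pose Z (G : ograph 'I_n) : R := \sum_(s in Bal) hom_weight T (2 * K / (K - 1)) s G *
     (#|arcs G|%:R <= mu)%R%:R.
have EZ : #|Bal|%:R * (lo / 2) <= Gnp_exp p Z.
  rewrite /Z Gnp_exp_sum -sum1_card natr_sum mulr_suml; apply: ler_sum => s sb.
  rewrite mul1r; apply: le_trans lohi _.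
  exact: (first_moment_ge k3 dT p01 pn deb erefl sb).
have EZ2 := second_moment_le k3 n0 dT p01' pn d_ell (ltW de0) (ltW dl0).
rewrite -/eta -/K -/mu -/Bal in EZ2.
have Kn0 : 0 < K ^+ n by rewrite exprn_gt0//; lra.
have B0 : 0 < #|Bal|%:R :> R by apply: lt_le_trans cardB; rewrite divr_gt0.
have lo0 : 0 < lo by exact: expR_gt0.
set Q := K ^+ n * n.+1%:R ^+ (k * k) * _ in EZ2.
have Q0 : 0 < Q.
  by apply: mulr_gt0; [apply: mulr_gt0 => //; exact: exprn_gt0|exact: expR_gt0].
have BQ0 : 0 < #|Bal|%:R * Q by rewrite mulr_gt0.
have ZA (G : ograph 'I_n) : ~~ (defect G T == 0%N) -> Z G = 0.
  move=> nd; rewrite /Z big1// => s _; rewrite /hom_weight.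
  case: (boolP (is_hom G T s)) => hs; last by rewrite mulr0n !mul0r.
  by move: nd; rewrite (defect_hom hs).
apply: le_trans (paley_zygmund p01' BQ0 ZA EZ2).
rewrite ler_pdivlMr//.
apply: (@le_trans _ _ ((#|Bal|%:R * (lo / 2)) ^+ 2)); last first.
  have h0 : 0 <= #|Bal|%:R * (lo / 2) by rewrite mulr_ge0// divr_ge0// ltW.
  by apply: lerXn2r; rewrite ?nnegrE// (le_trans h0 EZ).
set X := expR (- (2 * d * dl * n%:R + 2 * d ^+ 2)).
set E := expR (eta * (n%:R * ln K) + d / 2).
have main : c * expR (ep / 4 * n%:R) * (expR (- (ep * n%:R)) * E) <= X / 8.
  have hC : C <= expR (ep / 4 * n%:R).
    apply: le_trans (expR_ge1Dx _); apply: (@le_trans _ _ (ep / 4 * n%:R)); last by rewrite lerDr.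
    by near: n; apply: near_le_linear; lra.
  have e1 : c = C / 8 * expR (- (2 * d ^+ 2 + d / 2)).
    by rewrite /C expRN; field; rewrite expR_eq0.
  have w0 : 0 <= expR (- (2 * d ^+ 2 + d / 2)) * expR (ep / 4 * n%:R) * (expR (- (ep * n%:R)) * E) / 8.
    by rewrite divr_ge0// mulr_ge0// mulr_ge0// expR_ge0.
  have -> : c * expR (ep / 4 * n%:R) * (expR (- (ep * n%:R)) * E) =
    C * (expR (- (2 * d ^+ 2 + d / 2)) * expR (ep / 4 * n%:R) * (expR (- (ep * n%:R)) * E) / 8).
    by rewrite [X in X * _ * _ = _]e1; field.
  apply: le_trans (ler_wpM2r w0 hC) _.
  rewrite [X in X <= _]mulrA ler_pM2r ?invr_gt0// /E -!expRD ler_expR.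
  have := ler_wpM2r (ltW N0) eta_le; have := mulr_ge0 (ltW ep0) (ltW N0); lra.
have key : expR (- (ep * n%:R)) * Q <= K ^+ n / 2 * (lo / 2) ^+ 2.
  have -> : (lo / 2) ^+ 2 = X / 4.
    rewrite /lo exprMn -expRM_natl; congr (expR _ * _); [ring|by field].
  have -> : expR (- (ep * n%:R)) * Q = K ^+ n * (n.+1%:R ^+ (k * k) * (expR (- (ep * n%:R)) * E)).
    by rewrite /Q /E; ring.
  have -> : K ^+ n / 2 * (X / 4) = K ^+ n * (X / 8) by field.
  apply: ler_wpM2l; first exact: ltW.
  apply: le_trans main; apply: ler_wpM2r; last exact: hc.
  by rewrite mulr_ge0// expR_ge0.
rewrite mulrCA exprMn expr2 -mulrA; apply: ler_wpM2l; first exact: ltW.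
apply: le_trans key _; apply: ler_wpM2r => //; exact: sqr_ge0.
Unshelve. all: by end_near.
Qed.

(** * The upper bound *)

Lemma near_expR_le (R : realType) (a c e : R) : 0 < a -> 0 < e ->
  \forall n \near \oo, c * expR (- (a * n%:R)) <= e.
Proof.
move=> a0 e0; near=> n.
rewrite expRN ler_pdivrMr ?expR_gt0// mulrC -ler_pdivrMr//.
apply: le_trans (expR_ge1Dx _); rewrite -lerBlDl.
by near: n; exact: near_le_linear.
Unshelve. all: by end_near.
Qed.

(** [defect_tail] and [defect_zero_prob] make a defect of order [n] unlikely, and
    [dense_sets_prob] excludes dense sets of the size reached by the closure. *)
Lemma chi_o_upper (R : realType) k (T : ograph 'I_k) (d e : R) :
  (3 <= k)%N -> doubly_regular T -> 0 < d <= ell_ R k -> 0 < e ->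
  \forall n \near \oo,
    Gnp_prob (d / n%:R) (fun G : ograph 'I_n => ~~ (chi_o G <= 2 * k + 7)%N) <= e.
Proof.
move=> k3 dT d_ell e0; have /andP[d0 _] := d_ell.
have [B1 _] := sparse_base_ge (ltW d0).
set B := sparse_base d in B1.
pose eta : R := (1 / 4) ^+ 5 / B.
have q0 : 0 < (1 / 4) ^+ 5 :> R by apply: exprn_gt0; lra.
have q1 : (1 / 4) ^+ 5 < 1 :> R by rewrite exprn_ilt1//; lra.
have eta0 : 0 < eta by rewrite divr_gt0//; lra.
have eta1 : eta < 1.
  by rewrite /eta ltr_pdivrMr ?mul1r; lra.
(* [t <= eta / (12 * d)] makes [2 * d * t ^ 2] at most half of [t * eta / 3]. *)
pose t := Num.min (1 / 2) (eta / (12 * d)).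
have t0 : 0 < t.
  by rewrite lt_min; apply/andP; split; [lra|apply: divr_gt0 => //; exact: mulr_gt0].
have t12 : t <= 1 / 2 by rewrite ge_min lexx.
have td : t * (12 * d) <= eta.
  have : t <= eta / (12 * d) by rewrite ge_min lexx orbT.
  by rewrite ler_pdivlMr ?mulr_gt0.
have ep0 : 0 < t * eta / 12 by rewrite divr_gt0// mulr_gt0.
near=> n.
have n0 : (0 < n)%N by near: n; exact: nbhs_infty_gt.
have N0 : 0 < n%:R :> R by rewrite ltr0n.
pose p := d / n%:R.
have pn : p * n%:R = d by rewrite /p; field; lra.
have p01 : 0 <= p < 1.
  apply/andP; split; first by rewrite /p divr_ge0 ?ltW.
  rewrite /p ltr_pdivrMr// mul1r.
  by near: n; exact: nbhs_infty_gtr.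
have p01' : 0 <= p <= 1 by case/andP: p01 => -> /ltW.
pose m := Num.truncn (eta * n%:R).
have en0 : 0 <= eta * n%:R by rewrite mulr_ge0// ltW.
have /andP[m_le m_gt] := truncn_itv en0.
rewrite -/m in m_le m_gt.
have mn : (m < n)%N.
  rewrite -(ltr_nat R); apply: le_lt_trans m_le _.
  by rewrite -[X in _ < X]mul1r ltr_pM2r.
have hm : sparse_base d * m%:R / n%:R <= (1 / 4) ^+ 5.
  rewrite ler_pdivrMr// -/B.
  have -> : (1 / 4) ^+ 5 * n%:R = B * (eta * n%:R) by rewrite /eta; field; lra.
  by apply: ler_wpM2l => //; lra.
have dense := dense_sets_prob p01' pn d0 n0 hm.
set bad_dense := (X in Gnp_prob p X) in dense.
pose r := eta * n%:R / 3.
have tail := @defect_tail R n k p t r T p01 (ltW t0).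
set bad_defect := (X in Gnp_prob p X * _) in tail.
have hz : expR (- (t * eta / 12 * n%:R)) <=
    Gnp_prob p (fun G : ograph 'I_n => defect G T == 0%N).
  by rewrite /p; near: n; exact: defect_zero_prob.
have hdefect : Gnp_prob p bad_defect <= expR (- (t * eta / 12 * n%:R)).
  have expo : p * n%:R ^+ 2 / 2 * (expR t - 1) ^+ 2 - t * r <= - (t * eta / 6 * n%:R).
    have -> : p * n%:R ^+ 2 = d * n%:R by rewrite expr2 mulrA pn.
    have et0 : 0 <= expR t - 1 by rewrite subr_ge0 -expR0 ler_expR ltW.
    have et : expR t - 1 <= 2 * t.
      have : expR t <= 1 + t + 2 * t ^+ 2 by apply: expR_le_quad; rewrite ltW.
      have : t * t <= t * (1 / 2) by apply: ler_wpM2l => //; exact: ltW.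
      by rewrite expr2; lra.
    have et2 : (expR t - 1) ^+ 2 <= (2 * t) ^+ 2.
      by apply: lerXn2r => //; rewrite nnegrE; lra.
    have : d * n%:R / 2 * (expR t - 1) ^+ 2 <= d * n%:R / 2 * (2 * t) ^+ 2.
      by apply: ler_wpM2l => //; rewrite divr_ge0// mulr_ge0// ltW.
    have : n%:R * t * (t * (12 * d)) <= n%:R * t * eta.
      by apply: ler_wpM2l => //; rewrite mulr_ge0// ltW.
    rewrite /r !expr2; lra.
  have h := le_trans tail (_ : _ <= expR (- (t * eta / 12 * n%:R)) * expR (- (t * eta / 12 * n%:R))).
  have {}h := h ltac:(rewrite -expRD ler_expR; lra).
  have bd0 : 0 <= Gnp_prob p bad_defect by rewrite Gnp_probE; apply: Gnp_exp_ge0.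
  rewrite -(ler_pM2r (expR_gt0 (- (t * eta / 12 * n%:R)))).
  apply: le_trans h; exact: ler_wpM2l.
apply: (@le_trans _ _ (Gnp_prob p bad_defect + Gnp_prob p bad_dense)).
  have := @Gnp_prob_union R n p bool xpredT (fun b => if b then bad_defect else bad_dense)
    (fun G => ~~ (chi_o G <= 2 * k + 7)%N) p01'.
  rewrite big_bool /=; apply=> G.
  apply: contraNP => none.
  have nd : ~~ bad_defect G by apply/negP => h; apply: none; exists true.
  have ns : ~~ bad_dense G by apply/negP => h; apply: none; exists false.
  apply: (chi_o_le_of_defect (m := m) (T := T)); last 2 first.
  - by rewrite card_ord.
  - move=> S S0 Sm; apply/negPn/negP => sp; move/negP: ns; apply.
    by apply/existsP; exists S; rewrite S0 Sm sp.
  - rewrite leqNgt; apply/negP => h; move/negP: nd; apply; rewrite /bad_defect /r.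
    have : m.+1%:R <= (3 * defect G T)%:R :> R by rewrite ler_nat.
    rewrite natrM; lra.
have h1 : expR (- (t * eta / 12 * n%:R)) <= e / 2.
  rewrite -[X in X <= _]mul1r; near: n; apply: near_expR_le => //; lra.
have h2 : expR (d / 2) * (4 ^+ 5 * sparse_base d) * 2 / n%:R <= e / 2.
  rewrite ler_pdivrMr//; near: n; apply: near_le_linear; lra.
lra.
Unshelve. all: by end_near.
Qed.

(** * The lower bound and the theorem *)

Lemma ocolorable_mono (V : finType) (G : ograph V) (j k : nat) :
  (j <= k)%N -> ocolorable G j -> ocolorable G k.
Proof.
move=> jk /existsP[T /andP[_ /existsP[f /forallP fP]]].
pose r (x y : 'I_k) := [exists a, exists b,
  [&& x == widen_ord jk a, y == widen_ord jk b & arc T a b]].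
have rP a b : r (widen_ord jk a) (widen_ord jk b) = arc T a b.
  apply/existsP/idP => [[a' /existsP[b' /and3P[/eqP ea /eqP eb ab]]]|ab].
    have -> : a = a' by apply: val_inj; have := congr1 val ea.
    by have -> : b = b' by apply: val_inj; have := congr1 val eb.
  by exists a; apply/existsP; exists b; rewrite !eqxx.
have rim x y : r x y -> exists a b, x = widen_ord jk a /\ y = widen_ord jk b.
  by move=> /existsP[a /existsP[b /and3P[/eqP -> /eqP -> _]]]; exists a, b.
have := @ocolorable_of_hom V 'I_k G r (fun x => widen_ord jk (f x)).
rewrite card_ord; apply.
- move=> x; case h : (r x x) => //; have [a [b [ea eb]]] := rim x x h.
  by move: h; rewrite ea rP arc_irr.
- move=> x y h; have [a [b [ea eb]]] := rim x y h.
  by move: h; rewrite ea eb !rP; exact: arc_asym.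
- by move=> x y xy; rewrite rP; exact: (implyP (forallP (fP x) y)).
Qed.

(** Chernoff bound for the lower tail of the number of arcs. *)
Lemma few_arcs_prob (R : realType) n (p d de : R) :
  0 <= p <= 1 -> p * n%:R = d -> 0 <= de ->
  Gnp_prob p (fun G : ograph 'I_n => #|arcs G|%:R < (1 - de) * d * n%:R / 2) <=
  expR (d / 2) * expR (- (d * de ^+ 2 / 8 * n%:R)).
Proof.
move=> p01 pn de0; have /andP[p0 _] := p01.
have d0 : 0 <= d by rewrite -pn mulr_ge0.
set mu := (1 - de) * d * n%:R / 2; pose w := de / 2.
have w0 : 0 <= w by rewrite divr_ge0.
have E := Gnp_exp_prod_le (a := fun _ _ : 'I_n => expR (- w)) p01 (fun _ _ => expR_ge0 _).
apply: (@le_trans _ _ (expR (w * mu) * Gnp_exp (n := n) p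
   (fun G => \prod_(e : 'I_n * 'I_n | arc G e.1 e.2) expR (- w)))).
  rewrite Gnp_probE -Gnp_expZ; apply: Gnp_exp_le => // G.
  have -> : \prod_(e : 'I_n * 'I_n | arc G e.1 e.2) expR (- w) = expR (- (w * #|arcs G|%:R)).
    transitivity (\prod_(e : 'I_n * 'I_n | arc G e.1 e.2) (expR (- w) * (true%:R : R))).
      by apply: eq_bigr => e _; rewrite mulr1.
    rewrite (prod_arcs_pred G _ (fun _ _ => true)) -expRM_natr mulNr.
    case: (boolP [forall x, _]) => [_|]; first by rewrite mulr1.
    by rewrite negb_forall => /existsP[x]; rewrite negb_forall => /existsP[z]; rewrite implybT.
  rewrite -expRD; case: ltP => h; last exact: expR_ge0.
  rewrite -[X in X <= _]expR0 ler_expR subr_ge0; apply: ler_wpM2l => //; exact: ltW.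
apply: le_trans (ler_wpM2l (expR_ge0 _) E) _.
rewrite -!expRD ler_expR.
have -> : \sum_(x < n) \sum_(y < n) expR (- w) = n%:R ^+ 2 * expR (- w) :> R.
  have c (x : R) : \sum_(y < n) x = n%:R * x by rewrite sumr_const card_ord mulr_natl.
  by rewrite (eq_bigr (fun=> n%:R * expR (- w))) => [|x _]; rewrite c // expr2 mulrA.
have ew : expR (- w) <= 1 - w + w ^+ 2.
  rewrite expRN; apply: (@le_trans _ _ (1 + w)^-1).
    by rewrite lef_pV2 ?posrE ?expR_gt0 ?expR_ge1Dx//; lra.
  rewrite -[_^-1]mul1r ler_pdivrMr; last lra.
  have : 0 <= w ^+ 2 * w by rewrite mulr_ge0// sqr_ge0.
  rewrite !expr2; lra.
have : d / 2 * n%:R * expR (- w) <= d / 2 * n%:R * (1 - w + w ^+ 2).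
  by apply: ler_wpM2l => //; rewrite mulr_ge0// divr_ge0.
have -> : p / 2 * (n%:R ^+ 2 * expR (- w) - n%:R ^+ 2 + n%:R) =
  d / 2 * n%:R * expR (- w) - d / 2 * n%:R + d / 2 by rewrite -pn; field.
rewrite /mu /w !expr2; lra.
Qed.

Lemma many_arcs_hom_prob (R : realType) n k (T : ograph 'I_k) (p d mu : R) (s : {ffun 'I_n -> 'I_k}) :
  (1 < k)%N -> tournament T -> 0 <= p <= 1 -> p * n%:R = d ->
  Gnp_prob p (fun G : ograph 'I_n => is_hom G T s && (mu <= #|arcs G|%:R)) <=
  expR (d / 2) * expR (- (ln (2 * k%:R / (k%:R - 1)) * mu)).
Proof.
move=> k1 tT p01 pn.
have K1 : 1 < k%:R :> R by rewrite ltr1n.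
set z := 2 * k%:R / (k%:R - 1).
have z1 : 1 <= z by rewrite /z ler_pdivlMr; lra.
have h := hom_weight_exp_le s k1 tT p01 ler01.
rewrite mulr1 subrr mulr0 add0r mulr1 pn -/z in h.
rewrite mulrC; apply: le_trans (ler_wpM2l (expR_ge0 _) h).
rewrite Gnp_probE -Gnp_expZ; apply: Gnp_exp_le => // G; rewrite /hom_weight.
case: (is_hom G T s); last by rewrite mul0r mulr0.
rewrite mul1r /=; case: (leP mu) => hmu; last first.
  by apply: mulr_ge0; [exact: expR_ge0|apply: exprn_ge0; lra].
have -> : z ^+ #|arcs G| = expR (ln z * #|arcs G|%:R).
  by rewrite expRM_natr lnK// posrE; lra.
rewrite -expRD -[X in X <= _]expR0 ler_expR addrC subr_ge0.
by apply: ler_wpM2l => //; exact: ln_ge0.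
Qed.

(** Union bound over the tournaments of order [k] and the maps to them, and over
    the event that there are too few arcs. The number [g] is the gap in
    [u_ R k < d], half of which is spent on the deviation of the number of
    arcs. *)
Lemma chi_o_lower (R : realType) k (d e : R) :
  (2 <= k)%N -> 0 < d -> u_ R k < d -> 0 < e ->
  \forall n \near \oo,
    Gnp_prob (d / n%:R) (fun G : ograph 'I_n => (chi_o G <= k)%N) <= e.
Proof.
move=> k2 d0 du e0.
have K2 : 2 <= k%:R :> R by rewrite ler_nat.
set K := k%:R in K2 *.
set w := ln (2 * K / (K - 1)).
have w0 : 0 < w by apply: ln_gt0; rewrite ltr_pdivlMr; lra.
have gap : 0 < d / 2 * w - ln K.
  move: du; rewrite /u_ -/K.
  have -> : ln K - ln ((K - 1) / 2) = w.
    rewrite /w -ln_div ?posrE//; [congr ln; field; lra|lra|lra].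
  by rewrite ltr_pdivrMr//; lra.
set g := d / 2 * w - ln K in gap.
pose de := g / (d * w).
have dw0 : 0 < d * w by rewrite mulr_gt0.
have de0 : 0 < de by rewrite divr_gt0.
pose c := #|{: ograph 'I_k}|%:R * expR (d / 2) : R.
have a0 : 0 < d * de ^+ 2 / 8 by rewrite divr_gt0// mulr_gt0// exprn_gt0.
near=> n.
have n0 : (0 < n)%N by near: n; exact: nbhs_infty_gt.
have N0 : 0 < n%:R :> R by rewrite ltr0n.
pose p := d / n%:R.
have pn : p * n%:R = d by rewrite /p; field; lra.
have p01 : 0 <= p <= 1.
  apply/andP; split; first by rewrite /p divr_ge0 ?ltW.
  rewrite /p ler_pdivrMr// mul1r.
  by near: n; exact: nbhs_infty_ger.
have few := few_arcs_prob p01 pn (ltW de0).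
set mu := (1 - de) * d * n%:R / 2 in few.
set bad_few := (X in Gnp_prob p X) in few.
pose bad_hom (Ts : ograph 'I_k * {ffun 'I_n -> 'I_k}) (G : ograph 'I_n) :=
  is_hom G Ts.1 Ts.2 && (mu <= #|arcs G|%:R).
apply: (@le_trans _ _ (\sum_(i : option (ograph 'I_k * {ffun 'I_n -> 'I_k}) |
    if i is Some Ts then tournament Ts.1 else true)
    Gnp_prob p (if i is Some Ts then bad_hom Ts else bad_few))).
  apply: (Gnp_prob_union (B := fun i => if i is Some Ts then bad_hom Ts else bad_few)) => // G chi.
  have [few_G|many] := boolP (bad_few G); first by exists None.
  have : ocolorable G k.
    apply: (ocolorable_mono chi); rewrite /chi_o; by case: ex_minnP.
  move=> /existsP[T /andP[tT /existsP[f hf]]]; exists (Some (T, f)) => //.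
  by rewrite /bad_hom hf /= leNgt.
rewrite (bigD1 None)//=.
have sumS : \sum_(i : option (ograph 'I_k * {ffun 'I_n -> 'I_k}) |
    (if i is Some Ts then tournament Ts.1 else true) && (i != None))
    Gnp_prob p (if i is Some Ts then bad_hom Ts else bad_few) <=
    c * expR (- (g / 2 * n%:R)).
  rewrite big_mkcond /=.
  apply: (@le_trans _ _ (\sum_(i : option (ograph 'I_k * {ffun 'I_n -> 'I_k}) | i != None)
     (expR (d / 2) * expR (- (w * mu))))).
    rewrite [X in _ <= X]big_mkcond /=; apply: ler_sum => -[[T f]|] _ //=.
    rewrite andbT; case: ifP => tT; first exact: many_arcs_hom_prob.
    by rewrite mulr_ge0 ?expR_ge0.
  rewrite sumr_const.
  have -> : #|[pred i : option (ograph 'I_k * {ffun 'I_n -> 'I_k}) | i != None]| =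
     (#|{: ograph 'I_k}| * k ^ n)%N.
    have := cardC1 (None : option (ograph 'I_k * {ffun 'I_n -> 'I_k})).
    rewrite card_option card_prod card_ffun !card_ord /= => <-.
    by apply: eq_card => i; rewrite !inE.
  rewrite -[_ *+ (_ * _)]mulr_natl natrM natrX -/K.
  have -> : K ^+ n = expR (ln K * n%:R) by rewrite expRM_natr lnK// posrE; lra.
  have -> : #|{: ograph 'I_k}|%:R * expR (ln K * n%:R) * (expR (d / 2) * expR (- (w * mu))) =
    c * (expR (ln K * n%:R) * expR (- (w * mu))) by rewrite /c; ring.
  apply: ler_wpM2l; first by rewrite /c mulr_ge0 ?expR_ge0.
  rewrite -expRD ler_expR.
  have : w * mu = (d / 2 * w - de * (d * w) / 2) * n%:R by rewrite /mu; field.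
  have -> : de * (d * w) = g by rewrite /de divfK// gt_eqF.
  have -> : d / 2 * w = ln K + g by rewrite /g; ring.
  lra.
have h1 : expR (d / 2) * expR (- (d * de ^+ 2 / 8 * n%:R)) <= e / 2.
  near: n; apply: near_expR_le => //; lra.
have h2 : c * expR (- (g / 2 * n%:R)) <= e / 2.
  near: n; apply: near_expR_le; lra.
lra.
Unshelve. all: by end_near.
Qed.

Unset Implicit Arguments.

Theorem theorem1p1 (R : realType) (d : R) (k1 k2 : nat)
    (d_gt0 : 0 < d)
    (k1_ge3 : (3 <= k1)%N) (k2_ge3 : (3 <= k2)%N)
    (drt : exists T : ograph 'I_k2, doubly_regular T)
    (d_lower : u_ R (k1 - 1)%N < d) (d_upper : d <= ell_ R k2) :
  Gnp_prob (d / n%:R)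
    (fun G : ograph 'I_n => (k1 <= chi_o G <= 2 * k2 + 11)%N)
    @[n --> \oo] --> (1 : R).
Proof.
have [T dT] := drt.
apply/cvgrPdist_le => e e0.
have e2 : 0 < e / 2 by rewrite divr_gt0.
have k1m : (2 <= k1 - 1)%N by case: k1 k1_ge3 {d_lower} => [|[|[|m]]].
have d_ell : 0 < d <= ell_ R k2 by rewrite d_gt0.
near=> n.
have n0 : (0 < n)%N by near: n; exact: nbhs_infty_gt.
have N0 : 0 < n%:R :> R by rewrite ltr0n.
set p := d / n%:R.
have p01 : 0 <= p <= 1.
  apply/andP; split; first by rewrite /p divr_ge0 ?ltW.
  rewrite /p ler_pdivrMr// mul1r.
  by near: n; exact: nbhs_infty_ger.
have up : Gnp_prob p (fun G : ograph 'I_n => ~~ (chi_o G <= 2 * k2 + 7)%N) <= e / 2.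
  by rewrite /p; near: n; exact: (chi_o_upper (T := T)).
have lo : Gnp_prob p (fun G : ograph 'I_n => (chi_o G <= k1 - 1)%N) <= e / 2.
  by rewrite /p; near: n; exact: chi_o_lower.
set A := (X in Gnp_prob p X).
have total : 1 = Gnp_prob p A + Gnp_prob p (fun G => ~~ A G).
  rewrite !Gnp_probE -Gnp_expD -[LHS](Gnp_exp1 n p); apply: eq_Gnp_exp => G.
  by case: (A G); rewrite ?addr0 ?add0r.
have not_A : Gnp_prob p (fun G => ~~ A G) <= e.
  have := @Gnp_prob_union R n p bool xpredT
    (fun b G => if b then ~~ (chi_o G <= 2 * k2 + 7)%N else (chi_o G <= k1 - 1)%N)
    (fun G => ~~ A G) p01.
  rewrite big_bool /= => h; apply: le_trans (h _) _; last by rewrite [e]splitr lerD.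
  move=> G; rewrite /A negb_and -!ltnNge => /orP[hlt|hlt].
    exists false => //; lia.
  exists true => //; apply: leq_ltn_trans hlt; by rewrite leq_add2l.
have not_A0 : 0 <= Gnp_prob p (fun G => ~~ A G).
  by rewrite Gnp_probE; apply: Gnp_exp_ge0.
rewrite {1}total addrAC subrr add0r ger0_norm//.
Unshelve. all: by end_near.
Qed.
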